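(* In the setting of the context, assume the following conditions. [B1] $\displaystyle\sup_{(\theta,\tau)\in\Xi}|\mathbb Y_T(\theta,\tau)-\mathbb Y(\theta)|\to0$ in probability; and with probability $1$, $\mathbb Y(\theta)<0$ for every $\theta\in\Theta$ with $\theta\ne\theta^*$. [B2] For some $\tau_0\in\mathcal T$, $$\sup_{\tau\in\mathcal T}\big|a_T'\partial_\theta\mathbb H_T(\theta^*,\tau)-a_T'\partial_\theta\mathbb H_T(\theta^*,\tau_0)\big|\xrightarrow{P}0,\qquad a_T'\partial_\theta\mathbb H_T(\theta^*,\tau_0)\xrightarrow{d_s(\mathcal G)}\Delta(\theta^* ).$$ Also, for any positive sequence $\delta_T$ with $\delta_T\to0$, $$\sup_{(\theta,\tau)\in\overline{\mathcal N}\times\mathcal T,\ |\theta-\theta^*|<\delta_T}\big\|a_T'\partial_\theta^2\mathbb H_T(\theta,\tau)a_T+\Gamma(\theta^* )\big\|\xrightarrow{P}0.$$ [B3] $\Gamma(\theta^* )$ is almost surely positive definite. [A3] $\displaystyle U\supset\bigcap_{N=1}^\infty\overline{\bigcup_{T\ge N}U_T}$. [A4] For the continuous random field $$\mathbb Z(u)=\exp\Big\{\Delta(\theta^* )[u]-\tfrac12\Gamma(\theta^* )[u^{\otimes2}]\Big\}\qquad(u\in\mathbb R^{\mathsf p}),$$ there exists a $U$-valued random variable $\hat u$ such that with probability $1$, $\mathbb Z(\hat u)=\sup_{u\in U}\mathbb Z(u)$, and with probability $1$, $\mathbb Z(u)<\mathbb Z(\hat u)$ for all $u\in U$ with $u\neq\hat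 u$. Then $$\hat u_T\xrightarrow{d_s(\mathcal G)}\hat u.$$ Moreover, assume in addition [A5] for the continuous random field $$\mathbb V_T(u)=\exp\Big\{\Delta_T(\theta^*,\hat\tau_T)[u]-\tfrac12\Gamma(\theta^* )[u^{\otimes2}]\Big\}\quad(u\in\mathbb R^{\mathsf p}),\qquad \Delta_T(\theta^*,\cdot)=a_T'\partial_\theta\mathbb H_T(\theta^*,\cdot),$$ that is: there exist $T_0\in\mathbb T$ and $U$-valued random variables $\hat v_T$ ($T\in\mathbb T,T\ge T_0$) such that with probability $1$, $\mathbb V_T(\hat v_T)=\sup_{u\in U}\mathbb V_T(u)$, and such that $\{\hat v_T\}_{T\ge T_0}$ is tight. Then $$\hat u_T-\hat v_T=o_P(1).$$
   Context: $(\Omega,\mathcal F,P)$ is a probability space, $\mathcal G\subset\mathcal F$ a sub-$\sigma$-algebra. $\Theta\subset\mathbb R^{\mathsf p}$ and $\mathcal T\subset\mathbb R^{\mathsf q}$ are compact, $\Xi=\Theta\times\mathcal T$. $\mathbb T\subset\mathbb R$ satisfies $\sup\mathbb T=\infty$; all indices $T$ range over $\mathbb T$ and limits are as $T\to\infty$. For each $T$, $\mathbb H_T:\Omega\times\Xi\to\mathbb R$ is a continuous random field (continuous on $\Xi$ for each $\omega$). $\theta^*\in\Theta$ is fixed. $\hat\tau_T$ is an arbitrary $\mathcal T$-valued random variable and $\hat\theta_T$ is a $\Theta$-valued random variable asymptotically maximizing $\mathbb H_T(\cdot,\hat\tau_T)$ on $\Theta$, i.e. $P[\mathbb H_T(\hat\theta_T,\hat\tau_T)=\sup_{\theta\in\Theta}\mathbb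 H_T(\theta,\hat\tau_T)]\to1$. $\mathcal N\subset\mathbb R^{\mathsf p}$ is a bounded open set such that (i) for some $\delta>0$, $\Theta\cap\{|\theta-\theta^*|<\delta\}\subset\overline{\mathcal N}$; (ii) for any $\theta\in\mathcal N$ and $0<t\le1$, $t\theta+(1-t)\theta^*\in\mathcal N$. It is supposed that $\mathbb H_T$ extends to a continuous random field on $\Omega\times\overline{\mathcal N}\times\mathcal T$ such that for every $\omega,\tau$, $\mathbb H_T(\omega,\cdot,\tau)$ is of class $C^2(\overline{\mathcal N})$, i.e. $C^2$ in $\mathcal N$ with derivatives continuously extendable to $\overline{\mathcal N}$ (derivatives on the boundary are these extensions). $a_T\in GL(\mathsf p)$ is deterministic with $\|a_T\|\to0$, where $\|A\|=\{\mathrm{Tr}(AA')\}^{1/2}$ and $A'$ denotes transpose; $b_T=\lambda_{\min}[(a_T'a_T)^{-1}]$ ($\lambda_{\min}$ = minimum eigenvalue). $\Delta(\theta^* )$ is an $\mathbb R^{\mathsf p}$-valued random variable and $\Gamma(\theta^* )$ is a $\mathcal G$-measurable $\mathbb R^{\mathsf p}\otimes\mathbb R^{\mathsf p}$-valued (i.e. $\mathsf p\times\mathsf p$-matrix-valued) random variable. Define $$\mathbb Y_T(\theta,\tau)=\frac1{b_T}\big(\mathbb H_T(\theta,\tau)-\mathbb H_T(\theta^*,\tau)\big),\quad(\theta,\tau)\in\Xi,$$ and let $\mathbb Y:\Omega\times\Theta\to\mathbb R$ be a continuous random field. Define $$U_T=\{u\in\mathbb R^{\mathsf p};\theta^*+a_Tu\in\Theta\},\quad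 U=\bigcap_{\delta>0}\bigcup_{N=1}^\infty\bigcap_{T\ge N}U_T^{\,\delta},\quad \hat u_T=a_T^{-1}(\hat\theta_T-\theta^* ),$$ with $A^\delta=\{x;\inf_{a\in A}|x-a|<\delta\}$. Notation: $v[u]=\sum_iv_iu_i$ for a vector $v$, $M[u^{\otimes2}]=u'Mu$ for a matrix $M$. $Y_T\xrightarrow{d_s(\mathcal G)}Y$ means $E[f(Y_T)Z]\to E[f(Y)Z]$ for every bounded continuous $f$ and every bounded $\mathcal G$-measurable random variable $Z$. *)

(* Defs.v *)
From HB Require Import structures.
From mathcomp Require Import all_boot all_order all_algebra.
From mathcomp Require Import all_classical all_reals all_analysis.

Set Implicit Arguments.
Unset Strict Implicit.
Unset Printing Implicit Defensive.
Import Order.TTheory GRing.Theory Num.Theory numFieldNormedType.Exports.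

Local Open Scope classical_set_scope.
Local Open Scope ring_scope.

Section linear_algebra.
Context {R : realType}.

(* {Tr(A A')}^(1/2); on column vectors this is the Euclidean norm. *)
Definition fnorm m n (A : 'M[R]_(m, n)) : R := Num.sqrt (\tr (A *m A^T)).

(* v[u] *)
Definition dotv n (v u : 'cV[R]_n) : R := \sum_i v i 0 * u i 0.

(* M[u^{(x)2}] *)
Definition quadf n (M : 'M[R]_n) (u : 'cV[R]_n) : R := (u^T *m M *m u) 0 0.

(* Symmetry is not part of the definition; it is only applied to a matrix that
   is almost surely symmetric, being a limit in probability of Hessians. *)
Definition posdef n (M : 'M[R]_n) := forall u : 'cV[R]_n, u != 0 -> 0 < quadf M u.

(* Only meaningful for n > 0 and M having a real eigenvalue, e.g. M symmetric;
   the set is then finite and nonempty, so that the infimum is a minimum. *)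
Definition lambda_min n (M : 'M[R]_n) : R := inf [set l | eigenvalue M l].

(* A^delta = {x; inf_(a in A) |x - a| < delta} *)
Definition enlarge n (A : set 'cV[R]_n) (delta : R) : set 'cV[R]_n :=
  [set x | (ereal_inf [set (fnorm (x - y))%:E | y in A] < delta%:E)%E].

End linear_algebra.

Section differential_calculus.
Context {R : realType} {n : nat}.
Implicit Types (N : set 'cV[R]_n) (f : 'cV[R]_n -> R).

Definition unitv (i : 'I_n) : 'cV[R]_n := delta_mx i 0.

Definition grad f (x : 'cV[R]_n) : 'cV[R]_n := \col_i 'D_(unitv i) f x.

Definition hess f (x : 'cV[R]_n) : 'M[R]_n :=
  \matrix_(i, j) 'D_(unitv i) ('D_(unitv j) f) x.

(* Meant for open N. *)
Definition C2_on N f :=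
  [/\ forall x i, N x -> derivable f x (unitv i),
      forall x i j, N x -> derivable ('D_(unitv j) f) x (unitv i)
    & [/\ {within N, continuous f}, {within N, continuous (grad f)}
        & {within N, continuous (hess f)}]].

Definition continuously_extendable (V : topologicalType) N (g : 'cV[R]_n -> V) :=
  exists2 g' : 'cV[R]_n -> V,
    {within closure N, continuous g'} & forall x, N x -> g' x = g x.

Definition C2_closure N f :=
  [/\ C2_on N f, {within closure N, continuous f},
      continuously_extendable N (grad f) & continuously_extendable N (hess f)].

(* For f in C2_closure N, the continuous extensions of the gradient and of the
   Hessian from N to closure N; they agree with grad f and hess f on N. *)
Definition gradc N f (x : 'cV[R]_n) : 'cV[R]_n :=
  lim (grad f y @[y --> within N (nbhs x)]).

Definition hessc N f (x : 'cV[R]_n) : 'M[R]_n :=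
  lim (hess f y @[y --> within N (nbhs x)]).

End differential_calculus.

Section random.
Context {R : realType} {d : measure_display} {Om : measurableType d}.

(* Borel measurability of X with respect to a sigma-algebra S on Om. *)
Definition measurable_wrt (S : set (set Om)) (V : topologicalType) (X : Om -> V) :=
  forall B : set V, <<s (@open V) >> B -> S (X @^-1` B).

Definition borel_rv (V : topologicalType) (X : Om -> V) :=
  measurable_wrt (@measurable d Om) X.

Definition continuous_random_field (V : topologicalType) (A : set V)
    (X : Om -> V -> R) :=
  (forall x, A x -> borel_rv (fun w => X w x)) /\
  (forall w, {within A, continuous (X w)}).

(* T tends to +oo inside the index set TT. *)
Definition to_infty (TT : set R) : set_system R := within TT (pinfty_nbhs R).

(* Convergence to 0 in probability. The outer measure P^* coincides with P on
   measurable events; it is needed because a supremum over an uncountable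
   parameter set is not known a priori to be measurable. *)
Definition cvg_proba0 (P : probability Om R) (TT : set R) (X : R -> Om -> \bar R) :=
  forall eps : R, 0 < eps ->
    (P^*)%mu [set w | (eps%:E < `|X T w|)%E] @[T --> to_infty TT] --> 0%E.

(* Stable convergence in law d_s(G). *)
Definition cvg_stable (P : probability Om R) (TT : set R) (G : set (set Om))
    (V : topologicalType) (Y_ : R -> Om -> V) (Y : Om -> V) :=
  forall (f : V -> R) (Z : Om -> R),
    continuous f -> (exists M, forall x, `|f x| <= M) ->
    measurable_wrt G Z -> (exists M, forall w, `|Z w| <= M) ->
    ('E_P[fun w => (f (Y_ T w) * Z w)%R] @[T --> to_infty TT]
       --> 'E_P[fun w => (f (Y w) * Z w)%R])%E.

Definition tight (P : probability Om R) (I : set R) (V : topologicalType)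
    (X : R -> Om -> V) :=
  forall eps : R, 0 < eps -> exists2 K : set V, compact K &
    forall T, I T -> (P (X T @^-1` (~` K)) <= eps%:E)%E.

End random.

Section qlan.
Context {R : realType} {d : measure_display} {Om : measurableType d} {p q : nat}.
Variables (a : R -> 'M[R]_p) (Theta N : set 'cV[R]_p) (ths : 'cV[R]_p).
Variable (H : R -> Om -> 'cV[R]_p -> 'cV[R]_q -> R).

(* b_T *)
Definition rate (T : R) : R := lambda_min (invmx ((a T)^T *m a T)).

(* Y_T(theta, tau) *)
Definition YY (T : R) (w : Om) (th : 'cV[R]_p) (tau : 'cV[R]_q) : R :=
  (rate T)^-1 * (H T w th tau - H T w ths tau).

(* Delta_T(theta^*, tau) = a_T' d_theta H_T(theta^*, tau) *)
Definition score (T : R) (w : Om) (tau : 'cV[R]_q) : 'cV[R]_p :=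
  (a T)^T *m gradc N (fun th => H T w th tau) ths.

(* a_T' d_theta^2 H_T(theta, tau) a_T *)
Definition scaled_hess (T : R) (w : Om) (th : 'cV[R]_p) (tau : 'cV[R]_q) : 'M[R]_p :=
  (a T)^T *m hessc N (fun x => H T w x tau) th *m a T.

(* U_T *)
Definition local_set (T : R) : set 'cV[R]_p := [set u | Theta (ths + a T *m u)].

(* U *)
Definition limit_set (TT : set R) : set 'cV[R]_p :=
  \bigcap_(delta in [set delta : R | 0 < delta])
  \bigcup_(M in [set M : nat | (1 <= M)%N])
  \bigcap_(T in TT `&` [set T | M%:R <= T]) enlarge (local_set T) delta.

End qlan.

(* exp{D[u] - (1/2) Gam[u^{(x)2}]} *)
Definition ZZ {R : realType} {p : nat} (D : 'cV[R]_p) (Gam : 'M[R]_p)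
    (u : 'cV[R]_p) : R := expR (dotv D u - 2^-1 * quadf Gam u).

(* Main.v *)
Require Import Defs.
From HB Require Import structures.
From mathcomp Require Import all_boot all_order all_algebra.
From mathcomp Require Import all_classical all_reals all_analysis.
From mathcomp Require Import finmap measurable_realfun ring lra.

(** Let Q(D, M, u) = D[u] - M[u,u]/2 be the quadratic criterion [qcrit], U the limit of
    the local parameter sets, and X_T the score at tau0. The proof has a local part, about
    the estimator, and an abstract part, about maximisers of Q.

    Local part. The uniform convergence of the contrast gives consistency
    ([consistency]), and even with a deterministic rate ([exists_slow_rate]), so that only
    shrinking neighbourhoods of ths matter. There Taylor's formula makes the contrast,
    as a function of the local coordinate u, equal to Q(X_T, Gamma, u) up to an error that
    is uniform on balls and small in probability ([local_expansion]). Since Gamma is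
    coercive, the estimator in the local coordinate stays in a ball; since the local sets
    converge to U, uniformly on balls by compactness ([local_set_near],
    [limit_set_near]), it is close to a near-maximiser of Q(X_T, Gamma, _) over U
    ([estimator_asymptotic_maximiser]). The same holds for maximisers of the quadratic
    criterion itself ([limit_maximiser_asymptotic_maximiser]).

    Abstract part. An argmax is not a continuous function of (D, M). It is replaced by
    the envelope: for a function h of two points, the supremum of h(u, v) over a ball of
    U, penalised by n times the defects of maximality of u and v ([argmax_envelope]). The
    envelope dominates h at near-maximisers, is Lipschitz in (D, M), and tends to h(u0, u0)
    as n grows if u0 is the unique maximiser. Stable convergence of X_T carries the
    expectations of the envelope to the limit: as Gamma is G-measurable, its
    discretisation is absorbed by the test variables ([stable_grid]). With
    h(u, v) = f(u) this gives the stable convergence of asymptotic maximisers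
    ([maximiser_stable]). With h(u, v) = min(|u - v|, 1), which vanishes on the diagonal,
    it shows that two asymptotic maximisers merge ([maximisers_merge]).

    Suprema over uncountable sets are handled by outer probability. Where measurability
    is needed it comes from countable dense subsets of compact sets and from
    finite-range approximations of random points ([measurable_field]). *)

Set Implicit Arguments.
Unset Strict Implicit.
Unset Printing Implicit Defensive.
Import Order.TTheory GRing.Theory Num.Theory numFieldNormedType.Exports.

Local Open Scope classical_set_scope.
Local Open Scope ring_scope.

(** * Norms and quadratic criteria *)

Section norms.
Context {R : realType}.

Lemma mx_coord_le m n (A : 'M[R]_(m, n)) i j : `|A i j| <= `|A|.
Proof.
rewrite [leRHS]/Num.norm /= mx_normrE.
exact: (le_bigmax_cond _ (fun ij : 'I_m * 'I_n => `|A ij.1 ij.2|) (j := (i, j))).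
Qed.

Lemma mx_norm_le m n (A : 'M[R]_(m, n)) c :
  0 <= c -> (forall i j, `|A i j| <= c) -> `|A| <= c.
Proof.
move=> c0 Ac; rewrite [leLHS]/Num.norm /= mx_normrE.
by apply/bigmax_leP; split => // -[i j] _; exact: Ac.
Qed.

Lemma sum_ord_le n (F : 'I_n -> R) c :
  (forall i, F i <= c) -> \sum_i F i <= n%:R * c.
Proof.
move=> Fc; rewrite -[X in X%:R * _]card_ord mulr_natl -sumr_const.
by apply: ler_sum => i _.
Qed.

Lemma mulmx_norm_le m n k (A : 'M[R]_(m, n)) (B : 'M[R]_(n, k)) :
  `|A *m B| <= n%:R * `|A| * `|B|.
Proof.
apply: mx_norm_le => [|i j]; first by rewrite !mulr_ge0.
rewrite mxE (le_trans (ler_norm_sum _ _ _))//.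
rewrite -mulrA; apply: sum_ord_le => l.
by rewrite normrM ler_pM// mx_coord_le.
Qed.

Lemma trmx_norm m n (A : 'M[R]_(m, n)) : `|A^T| = `|A|.
Proof.
apply/eqP; rewrite eq_le; apply/andP; split; apply: mx_norm_le => // i j.
  by rewrite mxE mx_coord_le.
by rewrite -[A]trmxK mxE (le_trans (mx_coord_le _ _ _))// trmxK.
Qed.

Lemma tr_mulmx_tr m n (A : 'M[R]_(m, n)) :
  \tr (A *m A^T) = \sum_i \sum_j A i j ^+ 2.
Proof.
by apply: eq_bigr => i _; rewrite mxE; apply: eq_bigr => j _; rewrite mxE expr2.
Qed.

Lemma fnorm_ge m n (A : 'M[R]_(m, n)) : `|A| <= fnorm A.
Proof.
apply: mx_norm_le => [|i j]; first exact: sqrtr_ge0.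
rewrite -sqrtr_sqr ler_wsqrtr// tr_mulmx_tr (bigD1 i)//= (bigD1 j)//=.
by rewrite -addrA lerDl addr_ge0//; do ?apply: sumr_ge0 => ? _; rewrite ?sqr_ge0//;
  apply: sumr_ge0 => ? _; rewrite sqr_ge0.
Qed.

(** With [fnorm_ge], hypotheses and conclusions in the Frobenius norm are exchanged
    for the sup norm of matrices, which is the one that carries their topology. *)
Lemma fnorm_le m n (A : 'M[R]_(m, n)) : fnorm A <= (m * n)%:R * `|A|.
Proof.
have [mn0|mn0] := posnP (m * n)%N.
  rewrite /fnorm tr_mulmx_tr mn0 mul0r big1 ?sqrtr0// => i _; rewrite big1// => j _.
  by move/eqP: mn0; rewrite muln_eq0 => /orP[] /eqP mn0;
    [have := ltn_ord i | have := ltn_ord j]; rewrite {2}mn0.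
rewrite -[leRHS]ger0_norm ?mulr_ge0// -sqrtr_sqr ler_wsqrtr// tr_mulmx_tr.
apply: (@le_trans _ _ ((m * n)%:R * `|A| ^+ 2)).
  rewrite natrM -mulrA; apply: sum_ord_le => i; apply: sum_ord_le => j.
  by rewrite -(real_normK (num_real (A i j))) lerXn2r ?nnegrE// mx_coord_le.
by rewrite exprMn ler_wpM2r ?sqr_ge0// expr2 ler_peMl// ler1n.
Qed.

Lemma fnorm_norm m n (A : 'M[R]_(m, n)) : `|fnorm A| = fnorm A.
Proof. by rewrite ger0_norm// sqrtr_ge0. Qed.

Section vectors.
Variable p : nat.
Implicit Types (u v D : 'cV[R]_p) (M : 'M[R]_p).

Lemma dotvE v u : dotv v u = (v^T *m u) 0 0.
Proof. by rewrite mxE; apply: eq_bigr => i _; rewrite mxE. Qed.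

Lemma dotv_le v u : `|dotv v u| <= p%:R * `|v| * `|u|.
Proof.
rewrite dotvE (le_trans (mx_coord_le _ _ _))// (le_trans (mulmx_norm_le _ _))//.
by rewrite trmx_norm.
Qed.

Lemma dotvBl v w u : dotv (v - w) u = dotv v u - dotv w u.
Proof. by rewrite !dotvE linearB mulmxBl !mxE. Qed.

Lemma dotvBr v u w : dotv v (u - w) = dotv v u - dotv v w.
Proof. by rewrite !dotvE mulmxBr !mxE. Qed.

Lemma bilin_le u M v :
  `|(u^T *m M *m v) 0 0| <= p%:R ^+ 2 * `|M| * `|u| * `|v|.
Proof.
rewrite (le_trans (mx_coord_le _ _ _))// (le_trans (mulmx_norm_le _ _))//.
rewrite ler_wpM2r// (_ : _ * `|M| * `|u| = p%:R * (p%:R * `|u^T| * `|M|)).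
  by rewrite ler_wpM2l// mulmx_norm_le.
by rewrite trmx_norm; ring.
Qed.

Lemma quadf_le M u : `|quadf M u| <= p%:R ^+ 2 * `|M| * `|u| ^+ 2.
Proof. by rewrite (le_trans (bilin_le _ _ _))// -mulrA expr2. Qed.

Lemma quadf0 M : quadf M 0 = 0.
Proof. by rewrite /quadf mulmx0 mxE. Qed.

Lemma quadfBl M M' u : quadf (M - M') u = quadf M u - quadf M' u.
Proof. by rewrite /quadf mulmxBr mulmxBl !mxE. Qed.

Lemma quadfDl M M' u : quadf (M + M') u = quadf M u + quadf M' u.
Proof. by rewrite /quadf mulmxDr mulmxDl !mxE. Qed.

Lemma quadfZr M c u : quadf M (c *: u) = c ^+ 2 * quadf M u.
Proof.
have -> : quadf M (c *: u) = ((c *: u^T) *m M *m (c *: u)) 0 0.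
  by rewrite /quadf [(c *: u)^T]linearZ.
by rewrite -scalemxAr -!scalemxAl scalerA mxE expr2.
Qed.

Lemma quadfBr_le M u v :
  `|quadf M u - quadf M v| <= p%:R ^+ 2 * `|M| * (`|u| + `|v|) * `|u - v|.
Proof.
have -> : quadf M u - quadf M v =
    ((u - v)^T *m M *m u) 0 0 + (v^T *m M *m (u - v)) 0 0.
  by rewrite /quadf linearB/= mulmxBr !mulmxBl !mxE addrA subrK.
rewrite (le_trans (ler_normD _ _))// mulrDr mulrDl lerD//.
  by rewrite (le_trans (bilin_le _ _ _))// mulrAC.
exact: bilin_le.
Qed.

(** The exponent of the limiting likelihood ratio [ZZ]; as exp is increasing, the
    two have the same maximisers. *)
Definition qcrit D M u : R := dotv D u - 2^-1 * quadf M u.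

Lemma qcrit_lip_param D D' M M' u c : `|u| <= c ->
  `|qcrit D M u - qcrit D' M' u| <=
     p%:R * `|D - D'| * c + p%:R ^+ 2 * `|M - M'| * c ^+ 2.
Proof.
move=> uc; have c0 : 0 <= c by apply: le_trans uc.
have -> : qcrit D M u - qcrit D' M' u =
    dotv (D - D') u - 2^-1 * quadf (M - M') u.
  by rewrite dotvBl quadfBl /qcrit; lra.
rewrite (le_trans (ler_normB _ _))// lerD//.
  by rewrite (le_trans (dotv_le _ _))// ler_wpM2l// mulr_ge0.
rewrite normrM (@ger0_norm _ 2^-1)//.
rewrite (@le_trans _ _ `|quadf (M - M') u|)//; first by rewrite ler_piMl//; lra.
by rewrite (le_trans (quadf_le _ _))// ler_wpM2l ?mulr_ge0// lerXn2r ?nnegrE.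
Qed.

Lemma qcrit_lip_score D D' M u c : `|u| <= c ->
  `|qcrit D M u - qcrit D' M u| <= p%:R * `|D - D'| * c.
Proof.
move=> uc; have := qcrit_lip_param D D' M M uc.
by rewrite subrr normr0 mulr0 mul0r addr0.
Qed.

Lemma qcrit_lip D M u v c : `|u| <= c -> `|v| <= c ->
  `|qcrit D M u - qcrit D M v| <=
     (p%:R * `|D| + p%:R ^+ 2 * `|M| * c) * `|u - v|.
Proof.
move=> uc vc; have c0 : 0 <= c by apply: le_trans uc.
have -> : qcrit D M u - qcrit D M v =
    dotv D (u - v) - 2^-1 * (quadf M u - quadf M v).
  by rewrite dotvBr /qcrit; lra.
rewrite (le_trans (ler_normB _ _))// mulrDl lerD ?dotv_le//.
rewrite normrM (@ger0_norm _ 2^-1)//.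
rewrite (@le_trans _ _ (2^-1 * (p%:R ^+ 2 * `|M| * (2 * c) * `|u - v|)))//.
  rewrite ler_wpM2l// (le_trans (quadfBr_le _ _ _))// ler_wpM2r//.
  by rewrite ler_wpM2l ?mulr_ge0//; lra.
by rewrite le_eqVlt; apply/orP; left; apply/eqP; field.
Qed.

Lemma qcrit_bounded D M u c : `|u| <= c ->
  `|qcrit D M u| <= p%:R * `|D| * c + p%:R ^+ 2 * `|M| * c ^+ 2.
Proof.
move=> uc; have := @qcrit_lip_param D 0 M 0 u c uc.
rewrite !subr0 (_ : qcrit 0 0 u = 0) ?subr0//.
by rewrite /qcrit dotvE /quadf linear0 mulmx0 !mul0mx !mxE mulr0 subr0.
Qed.

End vectors.
End norms.

(** * Compactness and continuity *)

Section compactness.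
Context {R : realType}.

Lemma vec_mx_norm m n (v : 'rV[R]_(m * n)) : `|vec_mx v| <= `|v|.
Proof. by apply: mx_norm_le => // i j; rewrite mxE mx_coord_le. Qed.

Lemma mxvec_norm m n (A : 'M[R]_(m, n)) : `|mxvec A| <= `|A|.
Proof.
by apply: mx_norm_le => // i j; rewrite ord1; case/mxvec_indexP: j => k l;
  rewrite mxvecE mx_coord_le.
Qed.

Lemma near_dist_lt (V : normedModType R) (x : V) e : 0 < e ->
  \forall y \near x, `|x - y| < e.
Proof. by move=> e0; apply/nbhs_ballP; exists e => // y; rewrite -ball_normE. Qed.

Lemma eps_delta_continuous (V W : normedModType R) (f : V -> W) :
  (forall x e, 0 < e -> exists2 del, 0 < del &
     forall y, `|x - y| < del -> `|f x - f y| < e) -> continuous f.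
Proof.
move=> fP x; apply/cvgrPdist_lt => e e0; have [del del0 h] := fP x e e0.
by apply: filterS (near_dist_lt x del0).
Qed.

Lemma continuous_oppr (V : topologicalType) (f : V -> R) :
  continuous f -> continuous (fun x => - f x).
Proof. by move=> cf x; apply: cvgN; exact: cf. Qed.

Lemma norm_lip_continuous (V W : normedModType R) (f : V -> W) :
  (forall x y, `|f x - f y| <= `|x - y|) -> continuous f.
Proof.
move=> fl; apply: eps_delta_continuous => x e e0; exists e => // y.
exact: le_lt_trans.
Qed.

Lemma affine_continuous m n (A : 'M[R]_(m, n)) (b : 'cV[R]_n) :
  continuous (fun x : 'cV[R]_n => A *m (x - b)).
Proof.
have c0 : 0 < n%:R * `|A| + 1 :> R by rewrite ltr_wpDl// mulr_ge0.
apply: eps_delta_continuous => x e e0.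
exists (e / (n%:R * `|A| + 1)); first by rewrite divr_gt0.
move=> y; rewrite ltr_pdivlMr//; apply: le_lt_trans.
rewrite -mulmxBr opprB addrA subrK (le_trans (mulmx_norm_le _ _))//.
by rewrite [leRHS]mulrC ler_wpM2r// lerDl.
Qed.

(** Heine-Borel for row vectors, transported along [vec_mx]. *)
Lemma bounded_closed_mx_compact m n (A : set 'M[R]_(m, n)) :
  bounded_set A -> closed A -> compact A.
Proof.
move=> [M [Mreal MA]] Acl.
have vc : continuous (@vec_mx R m n).
  by apply: norm_lip_continuous => x y; rewrite -linearB vec_mx_norm.
have -> : A = vec_mx @` (vec_mx @^-1` A).
  apply/seteqP; split => [B AB|_ [v Av <-]//].
  by exists (mxvec B); rewrite /= mxvecK.
apply: continuous_compact; first exact: continuous_subspaceT.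
apply: bounded_closed_compact.
  exists M; split => // x Mx v Av /=; rewrite -[v]vec_mxK.
  by rewrite (le_trans (mxvec_norm _))// MA.
by apply: preimage_closed => // x _; exact: vc.
Qed.

Lemma closed_norm_le (V : normedModType R) (c : R) : closed [set x : V | `|x| <= c].
Proof.
rewrite (_ : [set _ | _] = (fun x : V => `|x|) @^-1` [set y | y <= c])//.
by apply: preimage_closed; [move=> x _; exact: norm_continuous|exact: closed_le].
Qed.

Lemma closed_ball_mx_compact m n (c : R) : compact [set x : 'M[R]_(m, n) | `|x| <= c].
Proof.
apply: bounded_closed_mx_compact; last exact: closed_norm_le.
by exists c; split => [|x cx y /= yc]; [exact: num_real|rewrite (le_trans yc)// ltW].
Qed.

(** The filter of finite subsets of A, ordered by inclusion, turns the near-covering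
    form of compactness into a finite subcover by balls. *)
Lemma finite_net (V : pseudoMetricType R) (A : set V) (e : R) : compact A -> 0 < e ->
  exists2 s : seq V, (forall c, c \in s -> A c) &
    forall x, A x -> exists2 c, c \in s & ball c e x.
Proof.
move=> /compact_near_coveringP Aco e0.
pose F : set_system (seq V) := [set P | exists2 s0 : seq V,
  (forall c, c \in s0 -> A c) & forall s : seq V, {subset s0 <= s} -> P s].
have FF : Filter F.
  split=> [|P Q [s sA sP] [t tA tQ]|P Q PQ [s sA sP]].
  - by exists [::].
  - exists (s ++ t) => [c|u stu]; first by rewrite mem_cat => /orP[/sA|/tA].
    by split; [apply: sP|apply: tQ] => c cs; apply: stu; rewrite mem_cat cs ?orbT.
  - by exists s => // t st; apply/PQ/sP.
have /Aco[s sA] : forall x, A x -> \forall x' \near x & s \near F,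
    exists2 c, c \in s & ball c e x'.
  move=> x Ax; exists (ball x e, [set s : seq V | x \in s]).
    split; first exact: nbhsx_ballx.
    exists [:: x] => [c|s]; first by rewrite inE => /eqP ->.
    by apply; rewrite inE.
  by move=> [x' s] /= [xx' xs]; exists x.
by move=> /(_ s) sP; exists s => //; exact: sP.
Qed.

(** The sequence lists the union over n of finite nets of mesh 1/(n+1). *)
Lemma dense_seq (V : pseudoMetricType R) (A : set V) x0 : compact A -> A x0 ->
  exists2 s : nat -> V, (forall k, A (s k)) &
    forall x, A x -> forall e, 0 < e -> exists k, ball x e (s k).
Proof.
move=> Aco Ax0.
have net n : exists s : seq V, (forall c, c \in s -> A c) /\
    forall x, A x -> exists2 c, c \in s & ball c n.+1%:R^-1 x.
  by have [|s] := @finite_net V A n.+1%:R^-1 Aco; [rewrite invr_gt0|exists s].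
have [s sP] := choice net.
(* Codes that denote no net point are sent to x0. *)
pose t k := if (choice.unpickle k : option (nat * nat)) is Some (n, i) then
  nth x0 (s n) i else x0.
exists t => [k|x Ax e e0].
  rewrite /t; case: choice.unpickle => [[n i]|//].
  by have [i_s|i_s] := ltnP i (size (s n));
    [apply: (sP n).1; exact: mem_nth | rewrite nth_default].
have [N] := @ltr_add_invr R 0 e e0; rewrite add0r => Ne.
have [c cs cx] := (sP N).2 x Ax.
exists (choice.pickle (N, index c (s N))); rewrite /t choice.pickleK nth_index//.
by apply: (le_ball (ltW Ne)); exact: ball_sym.
Qed.

(** Compactness turns continuity into uniform continuity against points that
    may lie outside the compact set. *)
Lemma unif_continuous_compact (V : normedModType R) (f : V -> R) (A : set V) (k : R) :
  compact A -> continuous f -> 0 < k ->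
  exists2 e, 0 < e & forall x y, A x -> `|x - y| <= e -> `|f x - f y| <= k.
Proof.
move=> /compact_near_coveringP Aco cf k0.
pose P (e : R) x := forall y, `|x - y| <= e -> `|f x - f y| <= k.
have : \forall e \near 0^'+, A `<=` P e.
  apply: Aco => x Ax.
  have k20 : 0 < k / 2 by rewrite divr_gt0.
  have /cvgrPdist_lt/(_ _ k20)/nbhs_ballP[d /= d0 fd] := cf x.
  exists (ball x (d / 2), [set e | e < d / 2]).
    split; first by apply: nbhsx_ballx; rewrite divr_gt0.
    by apply: nbhs_right_lt; rewrite divr_gt0.
  move=> [x' e] /= [xx' ed] y x'y.
  rewrite -ball_normE /= in xx'.
  have h1 : `|f x - f x'| < k / 2.
    by apply: fd; rewrite -ball_normE /= (lt_le_trans xx')//; lra.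
  have h2 : `|f x - f y| < k / 2.
    apply: fd; rewrite -ball_normE /=.
    have -> : x - y = (x - x') + (x' - y) by rewrite addrA subrK.
    by rewrite (le_lt_trans (ler_normD _ _))//; lra.
  have -> : f x' - f y = (f x - f y) - (f x - f x') by lra.
  by rewrite (le_trans (ler_normB _ _))//; lra.
move=> AP; near (0:R)^'+ => e.
exists e => // x y Ax xy.
have : A `<=` P e by near: e.
by move=> /(_ x Ax); exact.
Unshelve. all: by end_near. Qed.

End compactness.

(** * Measurability through finite-range approximations *)

Section nearest.
Context {R : realType} {V : pseudoMetricType R}.

(** A finite-range approximation of the identity. It is defined by recursion on
    the centres so that its measurability, and limits of expectations involving
    it, follow by induction on the list. *)
Definition near_pt (e : R) (x0 : V) (s : seq V) (x : V) : V :=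
  foldr (fun c r => if `[< ball c e x >] then c else r) x0 s.

Lemma near_pt_in (A : set V) e x0 s x : A x0 -> (forall c, c \in s -> A c) ->
  A (near_pt e x0 s x).
Proof.
move=> Ax0; elim: s => //= c s IH As; case: asboolP => _.
  by apply: As; rewrite mem_head.
by apply: IH => c' c's; apply: As; rewrite inE c's orbT.
Qed.

Lemma near_pt_ball e x0 s x : (exists2 c, c \in s & ball c e x) ->
  ball (near_pt e x0 s x) e x.
Proof.
elim: s => [[]//|c s IH] /= [c']; rewrite inE => /orP[/eqP ->|c's] bx.
  by case: asboolP.
by case: asboolP => // _; apply: IH; exists c'.
Qed.

End nearest.

Section measurability.
Context {R : realType} {d : measure_display} {Om : measurableType d}.

Lemma measurable_fun_gtP (f : Om -> R) :
  (forall r, measurable [set w | r < f w]) -> measurable_fun setT f.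
Proof.
move=> mf _; apply: (measurability _ (RGenOInfty.measurableE R)) => //.
move=> /= _ [_ [x ->] <-]; rewrite setTI.
by rewrite preimage_itvoy; exact: mf.
Qed.

Lemma measurable_fun_set (A : set Om) (f g : Om -> R) : measurable A ->
  measurable_fun setT f -> measurable_fun setT g ->
  measurable_fun setT (fun w => if `[< A w >] then f w else g w).
Proof.
move=> mA mf mg; apply: measurable_fun_ifT => //.
apply: (measurable_fun_bool true); rewrite setTI.
rewrite (_ : _ @^-1` _ = A)//.
by apply/seteqP; split => w /=; [move/asboolP|move=> Aw; apply/asboolP].
Qed.

Lemma measurable_wrt_comp (S : set (set Om)) (V W : topologicalType) (X : Om -> V)
    (f : V -> W) : measurable_wrt S X -> continuous f -> measurable_wrt S (f \o X).
Proof.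
move=> mX cf B mB; have : (image_set_system setT f <<s @open V >>) B.
  apply: smallest_sub mB.
    exact: sigma_algebra_image (smallest_sigma_algebra _ _).
  move=> O oO; rewrite /image_set_system /= setTI; apply: sub_sigma_algebra.
  by apply: open_comp => // x _; exact: cf.
by rewrite /image_set_system /= setTI => /mX.
Qed.

Section borel.
Context {V : topologicalType}.
Implicit Types X : Om -> V.

Lemma borel_open X (B : set V) : borel_rv X -> open B -> measurable (X @^-1` B).
Proof. by move=> mX oB; apply: mX; exact: sub_sigma_algebra. Qed.

Lemma borel_closed X (B : set V) : borel_rv X -> closed B ->
  measurable (X @^-1` B).
Proof.
move=> mX cB; rewrite -[B]setCK preimage_setC; apply: measurableC.
exact: (@borel_open X (~` B) mX (closed_openC cB)).
Qed.

Lemma borel_comp X (f : V -> R) : borel_rv X -> continuous f ->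
  measurable_fun setT (fun w => f (X w)).
Proof.
move=> mX cf; apply: measurable_fun_gtP => r.
apply: (@borel_open X [set x | r < f x]) => //.
rewrite (_ : [set x | _] = f @^-1` [set y | r < y])//.
by apply: open_comp => [x _|]; [exact: cf|exact: open_gt].
Qed.

End borel.

(** A field that is measurable at each point and continuous in space can be
    evaluated at a random point, as the pointwise limit of its values at
    finite-range approximations of that point. *)
Lemma measurable_field (V : pseudoMetricType R) (A : set V) (X : Om -> V -> R)
    (xi : Om -> V) (net : nat -> seq V) :
  (forall x, A x -> measurable_fun setT (X ^~ x)) ->
  (forall w, {within A, continuous (X w)}) ->
  (forall w, A (xi w)) ->
  (forall c e, 0 < e -> measurable [set w | ball c e (xi w)]) ->
  (forall n c, c \in net n -> A c) ->
  (forall w, \forall n \near \oo, exists2 c, c \in net n & ball c n.+1%:R^-1 (xi w)) ->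
  measurable_fun setT (fun w => X w (xi w)).
Proof.
move=> mX cX xiA mxi netA netP.
have [[w0 _]|Om0] := pselect (exists w : Om, True); last first.
  by apply: measurable_fun_gtP => r; rewrite [mkset _](_ : _ = set0)//;
    apply/seteqP; split => // w _; apply: Om0; exists w.
pose h n w := near_pt n.+1%:R^-1 (xi w0) (net n) (xi w).
apply: (@measurable_fun_cvg _ _ _ _ (fun n w => X w (h n w))) => [n|w _].
  rewrite /h; move: (netA n); elim: (net n) => [_|c s IH sA] /=.
    exact/mX/xiA.
  rewrite (_ : (fun w => _) = fun w => if `[< ball c n.+1%:R^-1 (xi w) >] then
    X w c else X w (near_pt n.+1%:R^-1 (xi w0) s (xi w))); last first.
    by apply/funext => w; case: ifP.
  apply: measurable_fun_set.
  - by apply: mxi; rewrite invr_gt0.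
  - by apply: mX; apply: sA; rewrite mem_head.
  - by apply: IH => c' c's; apply: sA; rewrite inE c's orbT.
have /subspace_continuousP/(_ (xi w) (xiA w)) cw := cX w.
have hA n : A (h n w) by apply: near_pt_in => // c; exact: netA.
have hw : h n w @[n --> \oo] --> xi w.
  apply/cvg_ballP => e e0; have [N Ne] := @ltr_add_invr R 0 e e0.
  rewrite add0r in Ne; near=> n.
  apply: (@le_ball _ _ _ n.+1%:R^-1).
    rewrite (le_trans _ (ltW Ne))// lef_pV2 ?posrE// ler_nat ltnS.
    by near: n; exact: nbhs_infty_ge.
  by apply: ball_sym; apply: near_pt_ball; near: n.
apply: (@cvg_comp _ _ _ (h ^~ w) (X w) \oo _ _ _ cw) => B /= AB.
have hB : \forall n \near \oo, A (h n w) -> B (h n w) by exact: hw _ AB.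
by rewrite nbhs_simpl /=; apply: filterS hB => n; apply.
Unshelve. all: by end_near. Qed.

Lemma mx_ballE m n (A B : 'M[R]_(m, n)) e : 0 < e ->
  ball A e B <-> forall i j, `|A i j - B i j| < e.
Proof. by move=> e0; split => [[_]|h]; [exact|split]. Qed.

(** [measurable_field] for a deterministic field: a continuous function of a matrix
    with measurable entries is measurable, the finite nets of balls playing the part
    of a countable base. *)
Lemma measurable_coord_comp m n (X : Om -> 'M[R]_(m, n)) (f : 'M[R]_(m, n) -> R) :
  (forall i j, measurable_fun setT (fun w => X w i j)) -> continuous f ->
  measurable_fun setT (fun w => f (X w)).
Proof.
move=> mX cf.
have net k : exists s : seq 'M[R]_(m, n), forall x, `|x| <= k%:R ->
    exists2 c, c \in s & ball c k.+1%:R^-1 x.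
  have [||s _ sP] := @finite_net R _ [set x : 'M[R]_(m, n) | `|x| <= k%:R] k.+1%:R^-1.
  - exact: closed_ball_mx_compact.
  - by rewrite invr_gt0.
  - by exists s.
have [s sP] := choice net.
apply: (@measurable_field _ setT (fun=> f) X s) => //.
- by move=> w; exact: continuous_subspaceT.
- move=> c e e0; rewrite [mkset _](_ : _ =
      \bigcap_(ij in [set: 'I_m * 'I_n]) [set w | `|c ij.1 ij.2 - X w ij.1 ij.2| < e]).
    apply: fin_bigcap_measurable => [|[i j] _]; first exact: finite_finset.
    rewrite -[mkset _]setTI; apply: measurable_fun_ltr => //.
    by apply: measurableT_comp => //; exact: measurable_funB.
  apply/seteqP; split => w /=; first by move/mx_ballE => h [i j] _ /=; exact: h.
  by move=> h; apply/mx_ballE => // i j; exact: (h (i, j)).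
- move=> w; near=> k; apply: sP.
  near: k; exact: nbhs_infty_ger.
Unshelve. all: by end_near. Qed.

End measurability.

(** * Outer probability and expectations of bounded variables *)

Section probability_tools.
Context {R : realType} {d : measure_display} {Om : measurableType d}.
Variable P : probability Om R.

Lemma outerU_le (A B : set Om) (x y : R) :
  ((P^*)%mu A <= x%:E -> (P^*)%mu B <= y%:E -> (P^*)%mu (A `|` B) <= (x + y)%:E)%E.
Proof.
move=> Ax By; rewrite EFinD (le_trans _ (leeD Ax By))//.
exact: outer_measureU2.
Qed.

Lemma outer_negligible (A : set Om) : P.-negligible A -> (P^*)%mu A = 0%E.
Proof.
move=> [B [mB B0 AB]]; apply/eqP; rewrite eq_le outer_measure_ge0 andbT.
by rewrite -B0 -measurable_mu_extE// le_outer_measure.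
Qed.

Lemma ae_outer (Q : Om -> Prop) : {ae P, forall w, Q w} ->
  (P^*)%mu [set w | ~ Q w] = 0%E.
Proof. by move=> h; exact: outer_negligible. Qed.

(** Outer probability is not continuous from above in general, so the events have to
    be measurable; the exceptional null set need not be. *)
Lemma decreasing_outer_small (A : nat -> set Om) (k : R) :
  (forall n, measurable (A n)) -> (forall m n, (m <= n)%N -> A n `<=` A m) ->
  {ae P, forall w, exists n, ~ A n w} -> 0 < k ->
  exists n, ((P^*)%mu (A n) <= k%:E)%E.
Proof.
move=> mA dA A0 k0.
have mcap : measurable (\bigcap_n A n) by exact: bigcapT_measurable.
have PA0 : P (\bigcap_n A n) = 0%E.
  rewrite -measurable_mu_extE//; apply: outer_negligible.
  by apply: negligibleS A0 => w wA [n]; apply; exact: wA.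
have : P (A n) @[n --> \oo] --> 0%E.
  rewrite -PA0; apply: nonincreasing_cvg_mu => //.
    by rewrite (le_lt_trans (probability_le1 _ _))// ltry.
  by move=> m n mn; apply/subsetPset; exact: dA.
move=> /fine_cvgP[_ /cvgrPdist_le/(_ _ k0)[n _ /(_ n (leqnn n))]].
rewrite /= sub0r normrN ger0_norm ?fine_ge0// => Ak.
exists n; rewrite measurable_mu_extE// -[leLHS]fineK ?lee_fin//.
by rewrite fin_num_measure.
Qed.

Lemma borel_tight (V : normedModType R) (X : Om -> V) k : borel_rv X -> 0 < k ->
  exists n0, forall n, (n0 <= n)%N ->
    ((P^*)%mu [set w | (n%:R < `|X w|)%R] <= k%:E)%E.
Proof.
move=> mX k0; have [|||n nk] := @decreasing_outer_small
    (fun n => [set w | n%:R < `|X w|]) k _ _ _ k0.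
- move=> n; rewrite -[mkset _]setTI; apply: measurable_fun_ltr => //.
  exact: (borel_comp mX (@norm_continuous _ _)).
- by move=> m n mn w /=; apply: le_lt_trans; rewrite ler_nat.
- apply: aeW => w; exists (Num.truncn `|X w|).+1 => /=.
  by apply/negP; rewrite -leNgt ltW// truncnS_gt.
exists n => m nm; apply: le_trans nk; apply: le_outer_measure => w /=.
by apply: le_lt_trans; rewrite ler_nat.
Qed.

Section eventually.
Variable TT : set R.
Local Notation F := (to_infty TT).

Lemma to_infty_filter : Filter F.
Proof. exact: within_filter. Qed.

Lemma near_index : \forall T \near F, TT T.
Proof. exact: withinT. Qed.

(** Stated for the outer probability because suprema of random fields over
    uncountable sets occur in the events. *)
Definition ultimately_le (k : R) (A : R -> set Om) :=
  \forall T \near F, ((P^*)%mu (A T) <= k%:E)%E.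

Lemma ultimately_leU k1 k2 A B : ultimately_le k1 A -> ultimately_le k2 B ->
  ultimately_le (k1 + k2) (fun T => A T `|` B T).
Proof. by apply: filterS2 => T; exact: outerU_le. Qed.

Lemma ultimately_leS k (A B : R -> set Om) : ultimately_le k B ->
  (\forall T \near F, A T `<=` B T) -> ultimately_le k A.
Proof. by apply: filterS2 => T Bk AB; rewrite (le_trans _ Bk)// le_outer_measure. Qed.

Lemma ultimately_le_weaken k k' A : k <= k' -> ultimately_le k A -> ultimately_le k' A.
Proof. by move=> kk'; apply: filterS => T /le_trans; apply; rewrite lee_fin. Qed.

Lemma ultimately_le_cst k (A : set Om) : ((P^*)%mu A <= k%:E)%E ->
  ultimately_le k (fun=> A).
Proof. by move=> Ak; apply: filterE. Qed.

Lemma cvg_ultimately_le (A : R -> set Om) :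
  ((P^*)%mu (A T) @[T --> F] --> 0%E) <->
  forall k, 0 < k -> ultimately_le k A.
Proof.
split=> [A0 k k0|h].
  have /fine_cvgP[Afin /cvgrPdist_le/(_ _ k0)] := A0.
  move: Afin; apply: filterS2 => T Af; rewrite /= sub0r normrN => Ak.
  rewrite -[leLHS]fineK// lee_fin (le_trans _ Ak)//.
  exact: ler_norm.
apply/fine_cvgP; split.
  apply: filterS (h 1 ltr01) => T A1.
  by rewrite ge0_fin_numE ?outer_measure_ge0// (le_lt_trans A1)// ltry.
apply/cvgrPdist_le => e e0; apply: filterS (h e e0) => T Ae /=.
rewrite sub0r normrN ger0_norm ?fine_ge0 ?outer_measure_ge0//.
rewrite -lee_fin fineK// ge0_fin_numE ?outer_measure_ge0//.
by rewrite (le_lt_trans Ae)// ltry.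
Qed.

Lemma cvg_proba0P (X : R -> Om -> \bar R) : cvg_proba0 P TT X <->
  forall e k, 0 < e -> 0 < k -> ultimately_le k (fun T => [set w | (e%:E < `|X T w|)%E]).
Proof.
split=> h e => [k e0 k0|e0].
  exact: ((cvg_ultimately_le _).1 (h e e0) k k0).
by apply/cvg_ultimately_le => k; exact: h.
Qed.

End eventually.

Definition bounded_meas (X : Om -> R) :=
  measurable_fun setT X /\ exists M, forall w, `|X w| <= M.

(** The real-valued expectation, whose limits are limits in R; [expectationE] relates
    it to the extended-real one. *)
Definition Ex (X : Om -> R) : R := \int[P]_(w in setT) X w.

Lemma bounded_meas_integrable X : bounded_meas X -> P.-integrable setT (EFin \o X).
Proof.
move=> [mX [M XM]]; apply: measurable_bounded_integrable => //.
  by rewrite (le_lt_trans (probability_le1 _ _))// ltry.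
exists M; split => [|y My w _ /=]; first exact: num_real.
by rewrite (le_trans (XM w))// ltW.
Qed.

Lemma bounded_meas_cst c : bounded_meas (fun=> c).
Proof. by split => //; exists `|c|. Qed.

Lemma bounded_measD X Y : bounded_meas X -> bounded_meas Y ->
  bounded_meas (fun w => X w + Y w).
Proof.
move=> [mX [M XM]] [mY [M' YM]]; split; first exact: measurable_funD.
by exists (M + M') => w; rewrite (le_trans (ler_normD _ _))// lerD.
Qed.

Lemma bounded_measM X Y : bounded_meas X -> bounded_meas Y ->
  bounded_meas (fun w => X w * Y w).
Proof.
move=> [mX [M XM]] [mY [M' YM]]; split; first exact: measurable_funM.
by exists (M * M') => w; rewrite normrM ler_pM.
Qed.

Lemma bounded_meas_indic (A : set Om) : measurable A -> bounded_meas (\1_A : Om -> R).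
Proof.
move=> mA; split; first exact: measurable_indic.
by exists 1 => w; rewrite indicE; case: (_ \in _); rewrite ?normr1 ?normr0.
Qed.

Lemma expectationE X : bounded_meas X -> ('E_P[X] = (Ex X)%:E)%E.
Proof.
move=> bX; rewrite unlock /Ex /Rintegral fineK//.
by apply: integrable_fin_num => //; exact: bounded_meas_integrable.
Qed.

Lemma ExD X Y : bounded_meas X -> bounded_meas Y ->
  Ex (fun w => X w + Y w) = Ex X + Ex Y.
Proof. by move=> bX bY; apply: RintegralD => //; exact: bounded_meas_integrable. Qed.

Lemma ExZ c X : bounded_meas X -> Ex (fun w => c * X w) = c * Ex X.
Proof. by move=> bX; apply: RintegralZl => //; exact: bounded_meas_integrable. Qed.

Lemma Ex_le X Y : bounded_meas X -> bounded_meas Y -> (forall w, X w <= Y w) ->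
  Ex X <= Ex Y.
Proof. by move=> bX bY XY; apply: le_Rintegral => //; exact: bounded_meas_integrable. Qed.

Lemma Ex_cst c : Ex (fun=> c) = c.
Proof.
rewrite /Ex Rintegral_cst// (_ : _ [set: _] = 1%E) ?mulr1//; exact: probability_setT.
Qed.

Lemma Ex_indic (A : set Om) : measurable A -> Ex (\1_A : Om -> R) = fine (P A).
Proof. by move=> mA; rewrite /Ex /Rintegral integral_indic// setIT. Qed.

(** Functions that are close outside of an event of small probability and
    bounded apart on it have close expectations. *)
Lemma Ex_le_outer X Y (M c k : R) : bounded_meas X -> bounded_meas Y ->
  0 <= c -> 0 <= M -> (forall w, X w <= Y w + M) ->
  ((P^*)%mu [set w | (Y w + c < X w)%R] <= k%:E)%E ->
  Ex X <= Ex Y + c + M * k.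
Proof.
move=> bX bY c0 M0 XYM.
set A := [set w | _] => Ak.
have mA : measurable A.
  rewrite -[A]setTI; apply: measurable_fun_ltr => //; last exact: bX.1.
  by apply: measurable_funD => //; exact: bY.1.
have bA := bounded_measM (bounded_meas_cst M) (bounded_meas_indic mA).
have bYc := bounded_measD bY (bounded_meas_cst c).
apply: (@le_trans _ _ (Ex (fun w => Y w + c + M * \1_A w))).
  apply: Ex_le => // [|w]; first exact: bounded_measD.
  rewrite indicE; have [wA|wA] := boolP (w \in A).
    by rewrite mulr1 (le_trans (XYM w))// lerD2r lerDl.
  by rewrite mulr0 addr0 leNgt; apply: contra wA; exact: mem_set.
rewrite ExD// ExD ?Ex_cst//; last exact: bounded_meas_cst.
rewrite lerD2l ExZ; last exact: bounded_meas_indic.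
rewrite Ex_indic// ler_wpM2l// -lee_fin fineK ?fin_num_measure//.
by rewrite -measurable_mu_extE.
Qed.

Lemma markov_outer X (e : R) : bounded_meas X -> (forall w, 0 <= X w) -> 0 < e ->
  ((P^*)%mu [set w | (e <= X w)%R] <= (Ex X / e)%:E)%E.
Proof.
move=> bX X0 e0; set A := [set w | _].
have mA : measurable A.
  by rewrite -[A]setTI; apply: measurable_fun_ler => //; exact: bX.1.
rewrite measurable_mu_extE// -[leLHS]fineK ?fin_num_measure// lee_fin.
rewrite ler_pdivlMr// -Ex_indic// mulrC -ExZ; last exact: bounded_meas_indic.
apply: Ex_le => //.
  by apply: bounded_measM; [exact: bounded_meas_cst|exact: bounded_meas_indic].
move=> w; rewrite indicE; have [/set_mem|_] := boolP (w \in A).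
  by rewrite mulr1.
by rewrite mulr0.
Qed.

Lemma Ex_dominated_cvg (X : nat -> Om -> R) (Y : Om -> R) (M : R) :
  (forall n, measurable_fun setT (X n)) -> measurable_fun setT Y ->
  (forall n w, `|X n w| <= M) ->
  {ae P, forall w, X n w @[n --> \oo] --> Y w} ->
  Ex (X n) @[n --> \oo] --> Ex Y.
Proof.
move=> mX mY XM XY.
have := @dominated_convergence _ _ _ P setT measurableT (fun n => EFin \o X n)
  (EFin \o Y) (cst M%:E).
case.
- by move=> n; exact/measurable_EFinP.
- exact/measurable_EFinP.
- by apply: filterS XY => w h _; apply: cvg_EFin h; exact: nearW.
- apply: bounded_meas_integrable; exact: bounded_meas_cst.
- by apply: aeW => w n _ /=; rewrite lee_fin.
move=> iY _; rewrite (_ : integral _ _ _ = (Ex Y)%:E); last first.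
  by rewrite /Ex /Rintegral fineK//; exact: integrable_fin_num.
by move=> /fine_cvgP[].
Qed.

End probability_tools.

(** * A continuous envelope of the argmax *)

Section argmax_functional.
Context {R : realType} {p : nat}.
Implicit Types (u v D : 'cV[R]_p) (M : 'M[R]_p) (A : set 'cV[R]_p).

Lemma sup_image_le {T : Type} (A : set T) (f : T -> R) c :
  A !=set0 -> (forall x, A x -> f x <= c) -> sup (f @` A) <= c.
Proof.
move=> [x Ax] fc; apply: ge_sup; first by exists (f x), x.
by move=> _ [y Ay <-]; exact: fc.
Qed.

Lemma sup_image_ge {T : Type} (A : set T) (f : T -> R) x c :
  (forall x, A x -> f x <= c) -> A x -> f x <= sup (f @` A).
Proof.
move=> fc Ax; apply: ub_le_sup; last by exists x.
by exists c => _ [y Ay <-]; exact: fc.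
Qed.

Lemma sup_image_adherent {T : Type} (A : set T) (f : T -> R) e :
  A !=set0 -> 0 < e -> exists2 x, A x & sup (f @` A) - e <= f x.
Proof.
move=> A0 e0; apply: contrapT => h.
suff : sup (f @` A) <= sup (f @` A) - e by rewrite lerBrDr gerDl leNgt e0.
apply: sup_image_le => // x Ax; rewrite leNgt; apply/negP => /ltW xs.
by apply: h; exists x.
Qed.

Variable U : set 'cV[R]_p.
Hypothesis U0 : U 0.

Definition truncset (n : nat) : set 'cV[R]_p := U `&` [set u | `|u| <= n%:R].

Lemma truncset0 n : truncset n 0.
Proof. by split => //=; rewrite normr0. Qed.

Definition qsup n D M : R := sup (qcrit D M @` truncset n).

Lemma qsup_ge n D M u : truncset n u -> qcrit D M u <= qsup n D M.
Proof.
apply: (@sup_image_ge _ _ _ _ (p%:R * `|D| * n%:R + p%:R ^+ 2 * `|M| * n%:R ^+ 2)).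
by move=> x [_ xn]; rewrite (le_trans (ler_norm _))// qcrit_bounded.
Qed.

Lemma qsup_le n D M c : (forall u, truncset n u -> qcrit D M u <= c) ->
  qsup n D M <= c.
Proof. by apply: sup_image_le; exists 0; exact: truncset0. Qed.

(** A bound on the variation of [qcrit] over the ball of radius n when its parameters
    change; see [qcrit_lip_param]. *)
Definition qlip n D D' M M' : R :=
  p%:R * `|D - D'| * n%:R + p%:R ^+ 2 * `|M - M'| * n%:R ^+ 2.

Lemma qsup_lip n D D' M M' : qsup n D M <= qsup n D' M' + qlip n D D' M M'.
Proof.
apply: qsup_le => u Ku; rewrite -lerBlDr.
apply: le_trans (qsup_ge D' M' Ku).
have := qcrit_lip_param D D' M M' Ku.2; rewrite -/(qlip n D D' M M').
by rewrite ler_distl => /andP[_]; lra.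
Qed.

Variable h : 'cV[R]_p -> 'cV[R]_p -> R.

(** A supremum of h over pairs of points of a ball of U, penalised by n times the
    amounts by which the two points fail to maximise [qcrit] there. Unlike the value
    of h at an argmax it depends continuously on the parameters ([envelope_lip]), and
    it tends to that value as n grows ([envelope_cvg]). *)
Definition argmax_envelope n D M : R :=
  sup [set h x.1 x.2 + n%:R * (qcrit D M x.1 + qcrit D M x.2)
      | x in truncset n `*` truncset n] - 2 * n%:R * qsup n D M.
Local Notation psi := argmax_envelope.

Variable C : R.
Hypothesis hC : forall u v, `|h u v| <= C.

Let pairs0 n : (truncset n `*` truncset n) !=set0.
Proof. by exists (0, 0); split; exact: truncset0. Qed.

Let penalised_le n D M x : (truncset n `*` truncset n) x ->
  h x.1 x.2 + n%:R * (qcrit D M x.1 + qcrit D M x.2) <= C + 2 * n%:R * qsup n D M.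
Proof.
move=> [x1 x2]; have := hC x.1 x.2; rewrite ler_norml => /andP[_ hx].
apply: lerD => //; rewrite -mulrA [leRHS]mulrCA ler_wpM2l//.
by have := qsup_ge D M x1; have := qsup_ge D M x2; lra.
Qed.

Lemma envelope_le n D M : psi n D M <= C.
Proof. by rewrite lerBlDr; apply: sup_image_le => // x; exact: penalised_le. Qed.

(** The penalty paid by two maximisers up to eta is at most 2 n eta. *)
Lemma le_envelope n D M u v (eta : R) : truncset n u -> truncset n v ->
  (forall u', truncset n u' -> qcrit D M u' <= qcrit D M u + eta) ->
  (forall u', truncset n u' -> qcrit D M u' <= qcrit D M v + eta) ->
  h u v <= psi n D M + 2 * n%:R * eta.
Proof.
move=> Ku Kv uopt vopt; rewrite addrAC lerBrDr -lerBlDr.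
apply: le_trans (@sup_image_ge _ _ _ (u, v) _ (@penalised_le n D M) (conj Ku Kv)).
rewrite /=.
have := qsup_le uopt; have := qsup_le vopt => qv qu.
have : n%:R * (2 * qsup n D M) <= n%:R * (qcrit D M u + qcrit D M v + 2 * eta).
  by rewrite ler_wpM2l//; lra.
by lra.
Qed.

Lemma envelope_ge n D M (c : R) : (forall u, c <= h u u) -> c <= psi n D M.
Proof.
move=> ch; apply/ler_addgt0Pr => e e0.
have e'0 : 0 < e / (2 * n%:R + 1) by rewrite divr_gt0// ltr_wpDl.
have [u Ku ue] := @sup_image_adherent _ (truncset n) (qcrit D M) _
  (ex_intro _ _ (truncset0 n)) e'0.
have uopt u' : truncset n u' -> qcrit D M u' <= qcrit D M u + e / (2 * n%:R + 1).
  by move=> /(qsup_ge D M); rewrite -/(qsup n D M) in ue *; lra.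
have := le_envelope Ku Ku uopt uopt; have := ch u.
move=> /le_trans /[apply] /le_trans; apply; rewrite lerD2l.
by rewrite mulrA ler_pdivrMr ?ltr_wpDl//; lra.
Qed.

Lemma envelope_norm n D M : `|psi n D M| <= C.
Proof.
rewrite ler_norml envelope_le envelope_ge// => u.
by have := hC u u; rewrite ler_norml => /andP[].
Qed.

Lemma envelope_lip_le n D D' M M' :
  psi n D M <= psi n D' M' + 4 * n%:R * qlip n D D' M M'.
Proof.
have lipP u : truncset n u -> qcrit D M u <= qcrit D' M' u + qlip n D D' M M'.
  move=> Ku; have := qcrit_lip_param D D' M M' Ku.2.
  by rewrite ler_distl => /andP[_].
have -> : psi n D' M' + 4 * n%:R * qlip n D D' M M' =
    sup [set h x.1 x.2 + n%:R * (qcrit D' M' x.1 + qcrit D' M' x.2)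
      | x in truncset n `*` truncset n] + 2 * n%:R * qlip n D D' M M'
    - 2 * n%:R * (qsup n D' M' - qlip n D D' M M') by rewrite /psi; ring.
apply: lerB.
  apply: sup_image_le => // x Kx; rewrite -lerBlDr.
  apply: le_trans (sup_image_ge (@penalised_le n D' M') Kx).
  have : n%:R * (qcrit D M x.1 + qcrit D M x.2) <= n%:R *
      (qcrit D' M' x.1 + qcrit D' M' x.2 + 2 * qlip n D D' M M').
    by rewrite ler_wpM2l//; have := lipP _ Kx.1; have := lipP _ Kx.2; lra.
  by lra.
rewrite ler_wpM2l ?mulr_ge0// lerBlDr.
by have := qsup_lip n D' D M' M; rewrite /qlip !(distrC D) !(distrC M).
Qed.

Lemma envelope_lip n D D' M M' :
  `|psi n D M - psi n D' M'| <= 4 * n%:R * qlip n D D' M M'.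
Proof.
rewrite ler_distl lerBlDr; apply/andP; split; last exact: envelope_lip_le.
by have := envelope_lip_le n D' D M' M; rewrite /qlip !(distrC D') !(distrC M').
Qed.

Lemma envelope_continuous n M : continuous (fun D => psi n D M).
Proof.
apply: eps_delta_continuous => D e e0.
pose c := 4 * n%:R * (p%:R * n%:R) + 1 : R.
have c0 : 0 < c by rewrite ltr_wpDl// !mulr_ge0.
have ec0 : 0 < e / c by rewrite divr_gt0.
exists (e / c) => // D' DD'.
rewrite (le_lt_trans (envelope_lip _ _ _ _ _))//.
rewrite /qlip subrr normr0 mulr0 mul0r addr0.
move: DD'; rewrite ltr_pdivlMr// => /(le_lt_trans _); apply.
have -> : 4 * n%:R * (p%:R * `|D - D'| * n%:R) =
  `|D - D'| * (4 * n%:R * (p%:R * n%:R)) by ring.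
by rewrite ler_wpM2l// /c lerDl.
Qed.

(** For large n a pair with a component far from u0 pays a penalty that exceeds the
    range of h, and on the remaining pairs h is close to its value at (u0, u0). *)
Lemma envelope_cvg D M u0 : U u0 ->
  (forall u, U u -> qcrit D M u <= qcrit D M u0) ->
  (forall e : R, 0 < e -> exists2 eta : R, 0 < eta &
     forall u, U u -> qcrit D M u0 - eta <= qcrit D M u -> `|u0 - u| <= e) ->
  (forall k : R, 0 < k -> exists2 e : R, 0 < e &
     forall u v, `|u0 - u| <= e -> `|u0 - v| <= e -> h u v <= h u0 u0 + k) ->
  psi n D M @[n --> \oo] --> h u0 u0.
Proof.
move=> Uu0 u0max sep hcont; apply/cvgrPdist_le => k k0.
have [e e0 he] := hcont k k0; have [eta eta0 sepe] := sep e e0.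
have C0 : 0 <= C by apply: le_trans (hC 0 0).
near=> n.
have nu0 : truncset n u0.
  by split => //=; near: n; exact: nbhs_infty_ger.
have nC : 2 * C <= n%:R * eta.
  by rewrite -ler_pdivrMr//; near: n; exact: nbhs_infty_ger.
have lo : h u0 u0 <= psi n D M.
  have := @le_envelope n D M u0 u0 0 nu0 nu0; rewrite mulr0 !addr0.
  by apply => u [Uu _]; exact: u0max.
rewrite distrC ger0_norm ?subr_ge0// lerBlDr /argmax_envelope lerBlDr.
apply: sup_image_le => // -[u v] [[/= Uu un] [Uv vn]] /=.
have qS : qcrit D M u0 <= qsup n D M by exact: qsup_ge.
have nn : (0 : R) <= n%:R by [].
have qS' := ler_wpM2l nn qS.
have u1 := ler_wpM2l nn (u0max u Uu); have v1 := ler_wpM2l nn (u0max v Uv).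
have := hC u v; have := hC u0 u0; rewrite !ler_norml => /andP[h0 _] /andP[_ h1].
have [uc|uc] := leP (qcrit D M u0 - eta) (qcrit D M u); last first.
  by have := ler_wpM2l nn (ltW uc); lra.
have [vc|vc] := leP (qcrit D M u0 - eta) (qcrit D M v); last first.
  by have := ler_wpM2l nn (ltW vc); lra.
have := he u v (sepe u Uu uc) (sepe v Uv vc); lra.
Unshelve. all: by end_near. Qed.

End argmax_functional.

Section separation.
Context {R : realType} {p : nat}.
Implicit Types (u v D : 'cV[R]_p) (M : 'M[R]_p).

Definition coercive M (c : R) := forall u, c * `|u| ^+ 2 <= quadf M u.

Lemma quadf_continuous M : continuous (quadf M).
Proof.
apply: eps_delta_continuous => u e e0.
pose c := p%:R ^+ 2 * `|M| * (2 * `|u| + 1) + 1 : R.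
have c0 : 0 < c by rewrite ltr_wpDl// !mulr_ge0// ?exprn_ge0// addr_ge0// mulr_ge0.
have ec0 : 0 < e / c by rewrite divr_gt0.
exists (Num.min 1 (e / c)); first by rewrite lt_min ltr01.
move=> v; rewrite lt_min => /andP[uv1 uv].
rewrite (le_lt_trans (quadfBr_le _ _ _))//.
move: uv; rewrite ltr_pdivlMr// => /(le_lt_trans _); apply.
rewrite mulrC ler_wpM2l// /c.
rewrite (@le_trans _ _ (p%:R ^+ 2 * `|M| * (2 * `|u| + 1)))//; last by rewrite lerDl.
rewrite ler_wpM2l ?mulr_ge0 ?exprn_ge0//.
have : `|v| <= `|u| + `|u - v|.
  by rewrite -[v in leLHS](subKr u) (le_trans (ler_normB _ _)).
by lra.
Qed.

(** The constant is the minimum of the quadratic form on the unit sphere. *)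
Lemma posdef_coercive M : posdef M -> exists2 c : R, 0 < c & coercive M c.
Proof.
move=> pM; pose S : set 'cV[R]_p := [set u | `|u| = 1].
have Sco : compact S.
  apply: bounded_closed_mx_compact.
    exists 1; split => [|x x1 u /= ->]; [exact: num_real|exact: ltW].
  rewrite (_ : S = (fun x : 'cV[R]_p => `|x|) @^-1` [set 1])//.
  by apply: preimage_closed => [x _|]; [exact: norm_continuous|exact: closed_eq].
have [S0|S0] := pselect (S !=set0); last first.
  exists 1 => // u; have [->|u0] := eqVneq u 0.
    by rewrite normr0 expr0n mulr0 quadf0.
  exfalso; apply: S0; exists (`|u|^-1 *: u).
  by rewrite /S /= normrZ normfV normr_id mulVf// normr_eq0.
have [u1 /set_mem Su1 umin] := compact_EVT_min S0 Sco
  (continuous_subspaceT (@quadf_continuous M)).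
have u10 : u1 != 0 by rewrite -normr_eq0 Su1 oner_eq0.
exists (quadf M u1); first exact: pM.
move=> u; have [->|u0] := eqVneq u 0.
  by rewrite normr0 expr0n mulr0 quadf0.
have -> : u = `|u| *: (`|u|^-1 *: u) by rewrite scalerA mulfV ?scale1r// normr_eq0.
rewrite [leRHS]quadfZr normrZ normr_id mulrC.
have Su : S (`|u|^-1 *: u) by rewrite /S /= normrZ normfV normr_id mulVf// normr_eq0.
by rewrite Su mulr1 ler_wpM2l ?exprn_ge0// umin//; exact: mem_set.
Qed.

Lemma qcrit_continuous D M : continuous (qcrit D M).
Proof.
apply: eps_delta_continuous => u e e0.
pose c := p%:R * `|D| + p%:R ^+ 2 * `|M| * (`|u| + 1) + 1 : R.
have c0 : 0 < c.
  by rewrite ltr_wpDl// addr_ge0// !mulr_ge0// ?exprn_ge0// addr_ge0.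
have ec0 : 0 < e / c by rewrite divr_gt0.
exists (Num.min 1 (e / c)); first by rewrite lt_min ltr01.
move=> v; rewrite lt_min => /andP[uv1 uv].
have vu : `|v| <= `|u| + 1.
  rewrite -[v in leLHS](subKr u) (le_trans (ler_normB _ _))// lerD2l.
  exact: ltW.
have uu : `|u| <= `|u| + 1 by rewrite lerDl.
rewrite (le_lt_trans (qcrit_lip _ _ uu vu))//.
move: uv; rewrite ltr_pdivlMr// => /(le_lt_trans _); apply.
by rewrite mulrC ler_wpM2l// /c lerDl.
Qed.

Lemma coercive_qcrit_le D M c u : coercive M c ->
  qcrit D M u <= `|u| * (p%:R * `|D| - 2^-1 * c * `|u|).
Proof.
move=> /(_ u) cu; have := dotv_le D u; rewrite ler_norml => /andP[_ du].
by rewrite /qcrit; lra.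
Qed.

(** Points far away have small values by coercivity; on the compact set that remains
    after removing a ball around u0, the maximum is attained and lies strictly below
    the value at u0. *)
Lemma well_separated (U : set 'cV[R]_p) D M u0 : closed U -> U u0 -> posdef M ->
  (forall u, U u -> u != u0 -> qcrit D M u < qcrit D M u0) ->
  forall e : R, 0 < e -> exists2 eta : R, 0 < eta &
     forall u, U u -> qcrit D M u0 - eta <= qcrit D M u -> `|u0 - u| <= e.
Proof.
move=> Ucl Uu0 /posdef_coercive[c c0 cM] umax e e0.
pose q0 := qcrit D M u0.
pose r := 1 + 2 * (p%:R * `|D| + 1 + `|q0|) / c.
have rP u : r <= `|u| -> qcrit D M u < q0 - 1.
  move=> ru; have r1 : 1 <= `|u|.
    apply: le_trans ru; rewrite lerDl; apply: divr_ge0; last exact: ltW.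
    by apply: mulr_ge0 => //; do 2!apply: addr_ge0 => //; exact: mulr_ge0.
  have cr : p%:R * `|D| + 1 + `|q0| < 2^-1 * c * `|u|.
    have : 2^-1 * c * r <= 2^-1 * c * `|u| by rewrite ler_wpM2l// mulr_ge0// ltW.
    apply: lt_le_trans; rewrite /r.
    have -> : 2^-1 * c * (1 + 2 * (p%:R * `|D| + 1 + `|q0|) / c) =
      2^-1 * c + (p%:R * `|D| + 1 + `|q0|) by field; rewrite gt_eqF.
    by rewrite ltrDr mulr_gt0.
  rewrite (le_lt_trans (coercive_qcrit_le _ _ cM))//.
  have : - `|q0| <= q0 by have := ler_norm (- q0); rewrite normrN; lra.
  have : `|u| * (p%:R * `|D| - 2^-1 * c * `|u|) <= 1 * (p%:R * `|D| - 2^-1 * c * `|u|).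
    by rewrite ler_wnM2r//; have := normr_ge0 q0; lra.
  by lra.
pose B := U `&` [set u | e <= `|u0 - u|] `&` [set u | `|u| <= r].
have Bco : compact B.
  apply: (@subclosed_compact _ B [set u | `|u| <= r]).
  - apply: closedI; last exact: closed_norm_le.
    apply: closedI => //.
    rewrite (_ : [set u | _] = (fun u => `|u0 - u|) @^-1` [set y | e <= y])//.
    apply: preimage_closed => [u _|]; last exact: closed_ge.
    apply: norm_lip_continuous => x y; rewrite (le_trans (ler_dist_dist _ _))//.
    by rewrite opprB addrC addrA subrK distrC.
  - exact: closed_ball_mx_compact.
  - by move=> u [].
have [B0|B0] := pselect (B !=set0); last first.
  exists 1 => // u Uu qu; rewrite leNgt; apply/negP => eu; apply: B0.
  exists u; split => /=; first by split => //=; exact: ltW.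
  by rewrite leNgt; apply/negP => /ltW/rP; rewrite ltNge qu.
have [b /set_mem Bb bmax] := compact_EVT_max B0 Bco
  (continuous_subspaceT (@qcrit_continuous D M)).
have b0 : qcrit D M b < q0.
  apply: umax; first exact: Bb.1.1.
  by apply/eqP => bu0; have := Bb.1.2; rewrite /= bu0 subrr normr0 leNgt e0.
exists (Num.min 1 ((q0 - qcrit D M b) / 2)).
  by rewrite lt_min ltr01 divr_gt0 ?subr_gt0.
move=> u Uu; rewrite lerBlDr -lerBlDl le_min => /andP[q1 q2].
rewrite leNgt; apply/negP => eu.
have /bmax : u \in B.
  apply/mem_set; split => /=; first by split => //=; exact: ltW.
  by rewrite leNgt; apply/negP => /ltW/rP; rewrite -/q0 in q1 *; lra.
by rewrite -/q0 in q2 *; lra.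
Qed.

End separation.

(** * Asymptotic maximisers under stable convergence *)

Section stable.
Context {R : realType} {d : measure_display} {Om : measurableType d} {p : nat}.
Variables (P : probability Om R) (TT : set R) (G : set (set Om)).
Hypothesis G_sigma : sigma_algebra [set: Om] G.
Hypothesis G_sub : G `<=` @measurable d Om.
Local Notation F := (to_infty TT).

Definition vec_meas (X : Om -> 'cV[R]_p) :=
  forall f : 'cV[R]_p -> R, continuous f -> measurable_fun setT (fun w => f (X w)).

Definition bounded_wrtG (Z : Om -> R) :=
  measurable_wrt G Z /\ exists M, forall w, `|Z w| <= M.

Lemma bounded_wrtG_meas Z : bounded_wrtG Z -> bounded_meas Z.
Proof.
move=> [mZ bZ]; split => //.
apply: (@borel_comp _ _ _ _ Z id); last by move=> x; exact: cvg_id.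
by move=> B mB; apply: G_sub; exact: mZ.
Qed.

Lemma sigmaC (A : set Om) : G A -> G (~` A).
Proof. by case: G_sigma => _ + _ GA => /(_ A GA); rewrite setTD. Qed.

Lemma sigmaU (A B : set Om) : G A -> G B -> G (A `|` B).
Proof.
case: G_sigma => G0 _ GU GA GB; rewrite -bigcup2E; apply: GU => -[|[|n]] //=.
Qed.

Lemma sigmaI (A B : set Om) : G A -> G B -> G (A `&` B).
Proof.
by move=> GA GB; rewrite -[A `&` B]setCK setCI; apply/sigmaC/sigmaU; exact: sigmaC.
Qed.

Lemma bounded_wrtG_cst c : bounded_wrtG (fun=> c).
Proof.
split; last by exists `|c|.
move=> B _; have [G0 _ _] := G_sigma.
have [Bc|Bc] := pselect (B c).
  rewrite (_ : _ @^-1` B = ~` set0); first exact: sigmaC.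
  by apply/seteqP; split => w //= _ [].
by rewrite (_ : _ @^-1` B = set0)//; apply/seteqP; split => w //=.
Qed.

Lemma bounded_wrtG_indicM (A : set Om) Z : G A -> bounded_wrtG Z ->
  bounded_wrtG (fun w => \1_A w * Z w).
Proof.
move=> GA [mZ [M ZM]]; split; last first.
  exists M => w; rewrite normrM indicE; case: (_ \in _).
    by rewrite normr1 mul1r.
  by rewrite normr0 mul0r (le_trans _ (ZM w)).
move=> B mB; have [B0|B0] := pselect (B 0).
  rewrite (_ : _ @^-1` B = (A `&` (Z @^-1` B)) `|` ~` A).
    by apply: sigmaU; [apply: sigmaI => //; exact: mZ|exact: sigmaC].
  apply/seteqP; split => w /=; rewrite indicE.
    have [/set_mem wA|wA _] := boolP (w \in A); first by rewrite mul1r; left.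
    by right => /mem_set; rewrite (negbTE wA).
  move=> [[wA]|wA]; first by rewrite mem_set// mul1r.
  by rewrite memNset// mul0r.
rewrite (_ : _ @^-1` B = A `&` (Z @^-1` B)).
  by apply: sigmaI => //; exact: mZ.
apply/seteqP; split => w /=; rewrite indicE.
  have [/set_mem wA|wA] := boolP (w \in A); first by rewrite mul1r.
  by rewrite mul0r.
by move=> [wA]; rewrite mem_set// mul1r.
Qed.

Variables (X : R -> Om -> 'cV[R]_p) (Delta : Om -> 'cV[R]_p) (Gamma : Om -> 'M[R]_p).
Hypothesis X_meas : forall T, TT T -> vec_meas (X T).
Hypothesis Delta_rv : borel_rv Delta.
Hypothesis Gamma_G : measurable_wrt G Gamma.
Hypothesis X_stable : cvg_stable P TT G X Delta.

Lemma Gamma_rv : borel_rv Gamma.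
Proof. by move=> B mB; apply: G_sub; exact: Gamma_G. Qed.

Lemma Delta_meas : vec_meas Delta.
Proof. by move=> f; exact: borel_comp. Qed.

Lemma Gamma_ball_G c e : G [set w | ball c e (Gamma w)].
Proof. by apply: (Gamma_G (B := ball c e)); apply: sub_sigma_algebra; exact: ball_open. Qed.

Lemma stable_Ex (f : 'cV[R]_p -> R) (Z : Om -> R) : continuous f ->
  (exists M, forall x, `|f x| <= M) -> bounded_wrtG Z ->
  Ex P (fun w => f (X T w) * Z w) @[T --> F] --> Ex P (fun w => f (Delta w) * Z w).
Proof.
move=> cf bf bZ; have := X_stable cf bf bZ.1 bZ.2.
have bfZ (Y : Om -> 'cV[R]_p) : vec_meas Y -> bounded_meas (fun w => f (Y w) * Z w).
  move=> mY; apply: (@bounded_measM _ _ _ (f \o Y)); last exact: bounded_wrtG_meas.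
  by split; [exact: mY|have [M fM] := bf; exists M => w; exact: fM].
rewrite expectationE; last exact/bfZ/Delta_meas.
move=> /fine_cvgP[_]; apply: cvg_trans; apply: near_eq_cvg.
apply: filterS (near_index TT) => T TTT /=.
by rewrite expectationE; last exact/bfZ/X_meas.
Qed.

Section discretised.
Variables (phi : 'cV[R]_p -> 'M[R]_p -> R) (C e : R) (x0 : 'M[R]_p).
Hypothesis phi_continuous : forall M, continuous (phi ^~ M).
Hypothesis phiC : forall D M, `|phi D M| <= C.
Local Notation gridG s w := (near_pt e x0 s (Gamma w)).

Let split_cons (Y : Om -> 'cV[R]_p) c s w :
  let A := [set w | ball c e (Gamma w)] in
  phi (Y w) (gridG (c :: s) w) =
    phi (Y w) c * \1_A w + phi (Y w) (gridG s w) * \1_(~` A) w.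
Proof.
move=> A; rewrite /= !indicE; case: asboolP => Aw.
  by rewrite mem_set// memNset ?mulr0 ?mulr1 ?addr0//; apply.
by rewrite memNset// mem_set// mulr0 mulr1 add0r.
Qed.

Lemma meas_grid (Y : Om -> 'cV[R]_p) s : vec_meas Y ->
  bounded_meas (fun w => phi (Y w) (gridG s w)).
Proof.
move=> mY; elim: s => [|c s IH] /=.
  by split; [exact: (mY (phi ^~ x0))|exists C => w; exact: phiC].
have mA := G_sub (Gamma_ball_G c e).
rewrite (_ : (fun w => _) = (fun w => phi (Y w) c * \1_[set w | ball c e (Gamma w)] w +
    phi (Y w) (gridG s w) * \1_(~` [set w | ball c e (Gamma w)]) w)); last first.
  by apply/funext => w; rewrite -split_cons.
apply: bounded_measD; apply: bounded_measM => //; try exact: bounded_meas_indic.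
  by split; [exact: (mY (phi ^~ c))|exists C => w; exact: phiC].
by apply: bounded_meas_indic; exact: measurableC.
Qed.

(** Stable convergence of X extends to functions of X and of a finitely valued
    function of the G-measurable matrix: the latter splits the test variable Z into
    finitely many G-measurable pieces, one for each of its values. *)
Lemma stable_grid s (Z : Om -> R) : bounded_wrtG Z ->
  Ex P (fun w => phi (X T w) (gridG s w) * Z w) @[T --> F] -->
  Ex P (fun w => phi (Delta w) (gridG s w) * Z w).
Proof.
elim: s Z => [|c s IH] Z bZ.
  by apply: (stable_Ex (f := phi ^~ x0)) => //; exists C => x.
set A := [set w | ball c e (Gamma w)].
have GA : G A by exact: Gamma_ball_G.
have bA := bounded_wrtG_indicM GA bZ.
have bAc := bounded_wrtG_indicM (sigmaC GA) bZ.
have eqE (Y : Om -> 'cV[R]_p) : vec_meas Y ->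
    Ex P (fun w => phi (Y w) (gridG (c :: s) w) * Z w) =
    Ex P (fun w => phi (Y w) c * (\1_A w * Z w)) +
    Ex P (fun w => phi (Y w) (gridG s w) * (\1_(~` A) w * Z w)).
  move=> mY; rewrite -ExD.
  - by congr Ex; apply/funext => w; rewrite split_cons mulrDl !mulrA.
  - apply: bounded_measM; last exact: bounded_wrtG_meas.
    by split; [exact: (mY (phi ^~ c))|exists C => w; exact: phiC].
  - by apply: bounded_measM; [exact: meas_grid|exact: bounded_wrtG_meas].
rewrite (eqE _ Delta_meas).
apply: cvg_trans (cvgD (stable_Ex (f := phi ^~ c) _ _ bA) (IH _ bAc)) => //.
  apply: near_eq_cvg; apply: filterS (near_index TT) => T TTT /=.
  by rewrite eqE//; exact: X_meas.
by exists C => x.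
Qed.

End discretised.

Variable U : set 'cV[R]_p.
Hypothesis U0 : U 0.
Hypothesis Gamma_pos : {ae P, forall w, posdef (Gamma w)}.
Variable uh : Om -> 'cV[R]_p.
Hypothesis uh_rv : borel_rv uh.
Hypothesis uh_U : forall w, U (uh w).
Hypothesis uh_unique : {ae P, forall w, forall u, U u -> u != uh w ->
  qcrit (Delta w) (Gamma w) u < qcrit (Delta w) (Gamma w) (uh w)}.
Hypothesis Ucl : closed U.

Definition near_max n eta D M u := exists2 u', truncset U n u' & `|u - u'| <= eta /\
  forall v, truncset U n v -> qcrit D M v <= qcrit D M u' + eta.

(** Eventually, and up to small probability, [u T] is as close as desired to a
    near-maximiser of the random quadratic criterion over large balls of U. *)
Definition asymptotic_maximiser (u : R -> Om -> 'cV[R]_p) :=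
  forall k : R, 0 < k -> exists n0, forall n, (n0 <= n)%N -> forall eta : R, 0 < eta ->
    ultimately_le P TT k
      (fun T => [set w | ~ near_max n eta (X T w) (Gamma w) (u T w)]).

Variable net : nat -> seq 'M[R]_p.
Let mesh n : R := (n.+1%:R ^+ 4)^-1.
Hypothesis netP : forall n M, `|M| <= n%:R -> exists2 c, c \in net n & ball c (mesh n) M.
Let grid n w := near_pt (mesh n) 0 (net n) (Gamma w).

Section envelope.
Variables (h : 'cV[R]_p -> 'cV[R]_p -> R) (C : R).
Hypothesis hC : forall u v, `|h u v| <= C.
Hypothesis h_unif : forall n (k : R), 0 < k -> exists2 e : R, 0 < e &
  forall u' v' u v, `|u'| <= n%:R -> `|v'| <= n%:R -> `|u' - u| <= e ->
    `|v' - v| <= e -> `|h u' v' - h u v| <= k.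
Local Notation psi := (argmax_envelope U h).

Let g n (Y : Om -> 'cV[R]_p) w := psi n (Y w) (grid n w).

Let K := 4 * p%:R ^+ 2 : R.

(* The mesh is n^-4 because the Lipschitz constant of the envelope in the matrix is
   of order n^3. *)
Let grid_lip n w D : `|Gamma w| <= n%:R ->
  `|psi n D (Gamma w) - psi n D (grid n w)| <= K * n.+1%:R^-1.
Proof.
move=> wn; rewrite (le_trans (envelope_lip U0 hC _ _ _ _ _))//.
have /ltW : `|Gamma w - grid n w| < mesh n.
  by have := near_pt_ball 0 (netP wn); rewrite -ball_normE /= distrC.
rewrite /qlip subrr normr0 mulr0 mul0r add0r => wg.
have n1 : (0 : R) < n.+1%:R by [].
have -> : 4 * n%:R * (p%:R ^+ 2 * `|Gamma w - grid n w| * n%:R ^+ 2) =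
  K * (n%:R ^+ 3 * `|Gamma w - grid n w|) by rewrite /K; ring.
rewrite ler_wpM2l ?mulr_ge0 ?exprn_ge0//.
apply: (@le_trans _ _ (n.+1%:R ^+ 3 * mesh n)).
  by rewrite ler_pM// ?exprn_ge0// lerXn2r ?nnegrE// ler_nat.
by rewrite /mesh (exprSr _ 3) invfM mulrA mulfV ?mul1r// expf_neq0.
Qed.

(** The envelope dominates h at near-maximisers, and asymptotic maximisers are close
    to such points up to small probability; replacing Gamma by its discretisation
    costs at most the oscillation of the envelope over the mesh. *)
Lemma envelope_majorises u v : asymptotic_maximiser u -> asymptotic_maximiser v ->
  forall k : R, 0 < k -> exists n0, forall n, (n0 <= n)%N ->
    ultimately_le P TT k (fun T => [set w | g n (X T) w + k < h (u T w) (v T w)]).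
Proof.
move=> uM vM k k0; have k30 : 0 < k / 3 by rewrite divr_gt0.
have [n1 n1P] := uM _ k30; have [n2 n2P] := vM _ k30.
have [n3 n3P] := borel_tight P Gamma_rv k30.
pose n4 := Num.truncn (K / (k / 3)).
exists (maxn (maxn n1 n2) (maxn n3 n4)) => n.
rewrite !geq_max => /andP[/andP[nn1 nn2] /andP[nn3 nn4]].
have [e e0 he] := h_unif n k30.
pose eta := Num.min e (k / 3 / (2 * n%:R + 1)).
have dn : 0 < 2 * n%:R + 1 :> R by rewrite ltr_wpDl.
have eta0 : 0 < eta by rewrite lt_min e0 divr_gt0.
have etae : eta <= e by rewrite ge_min lexx.
have etak : 2 * n%:R * eta <= k / 3.
  apply: (@le_trans _ _ ((2 * n%:R + 1) * eta)).
    by rewrite ler_wpM2r ?(ltW eta0)// lerDl.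
  by rewrite mulrC -ler_pdivlMr// ge_min lexx orbT.
have Kn : K * n.+1%:R^-1 <= k / 3.
  rewrite ler_pdivrMr// mulrC -ler_pdivrMr//.
  by rewrite ltW// (lt_le_trans (truncnS_gt _))// ler_nat ltnS.
have -> : k = k / 3 + k / 3 + k / 3 by field.
apply: ultimately_leS (ultimately_leU (ultimately_leU (n1P _ nn1 _ eta0)
  (n2P _ nn2 _ eta0)) (ultimately_le_cst TT (n3P _ nn3))) _.
apply: filterE => T w /= gh; apply: contrapT => /not_orP[/not_orP[+ +] +].
move=> /contrapT[u' Ku [uu uopt]] /contrapT[v' Kv [vv vopt]] /negP; rewrite -leNgt.
move=> /grid_lip - /(_ (X T w)) => gl.
have h1 := le_envelope U0 hC Ku Kv uopt vopt.
have h2 : `|h u' v' - h (u T w) (v T w)| <= k / 3.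
  apply: he; [exact: Ku.2|exact: Kv.2|rewrite distrC|rewrite distrC].
    exact: le_trans uu _.
  exact: le_trans vv _.
move: h2 gl; rewrite !ler_norml => /andP[h2 _] /andP[_ gl].
have {}gl := le_trans gl Kn.
by move: gh; rewrite ltNge => /negP; apply; rewrite /g; lra.
Qed.

Let psi_cont n M : continuous (psi n ^~ M).
Proof. exact: envelope_continuous. Qed.

Let psi_norm n D M : `|psi n D M| <= C.
Proof. exact: envelope_norm. Qed.

Lemma envelope_grid_bounded_meas n Y : vec_meas Y -> bounded_meas (g n Y).
Proof.
move=> mY.
exact: (@meas_grid (psi n) C (mesh n) 0 (@psi_cont n) (@psi_norm n) Y (net n) mY).
Qed.

Lemma envelope_grid_stable n Z : bounded_wrtG Z ->
  Ex P (fun w => g n (X T) w * Z w) @[T --> F] --> Ex P (fun w => g n Delta w * Z w).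
Proof.
move=> bZ.
exact: (@stable_grid (psi n) C (mesh n) 0 (@psi_cont n) (@psi_norm n) (net n) Z bZ).
Qed.

(** Almost surely the maximiser of the limit criterion is unique and well separated,
    so that the envelopes converge to h there; they are uniformly bounded. *)
Lemma envelope_limit Z : bounded_wrtG Z -> measurable_fun setT (fun w => h (uh w) (uh w)) ->
  Ex P (fun w => g n Delta w * Z w) @[n --> \oo] --> Ex P (fun w => h (uh w) (uh w) * Z w).
Proof.
move=> bZ mh; have mZ := (bounded_wrtG_meas bZ).1; have [_ [M ZM]] := bZ.
apply: (@Ex_dominated_cvg _ _ _ _ _ _ (C * M)).
- move=> n; apply: measurable_funM => //.
  exact: (envelope_grid_bounded_meas n Delta_meas).1.
- exact: measurable_funM.
- by move=> n w; rewrite normrM ler_pM// psi_norm.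
move: Gamma_pos uh_unique; apply: filterS2 => w Gw uw.
apply: cvgMl; have lim : psi n (Delta w) (Gamma w) @[n --> \oo] --> h (uh w) (uh w).
  apply: (envelope_cvg U0 hC) => //.
  - move=> u Uu; have [->//|uuh] := eqVneq u (uh w); exact/ltW/uw.
  - exact: well_separated.
  - move=> k k0; pose m := (Num.truncn `|uh w|).+1.
    have [e e0 he] := h_unif m k0; exists e => // u v ue ve.
    have um : `|uh w| <= m%:R by rewrite ltW// truncnS_gt.
    by have := he _ _ _ _ um um ue ve; rewrite ler_norml => /andP[]; lra.
have gap : psi n (Delta w) (Gamma w) - g n Delta w @[n --> \oo] --> 0.
  apply/cvgrPdist_le => e e0; near=> n; rewrite sub0r normrN.
  rewrite (le_trans (grid_lip _ _))//.
    by near: n; exact: nbhs_infty_ger.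
  rewrite ler_pdivrMr// mulrC -ler_pdivrMr// (@le_trans _ _ n%:R) ?ler_nat//.
  by near: n; exact: nbhs_infty_ger.
rewrite (_ : (fun n => g n Delta w) = (fun n => psi n (Delta w) (Gamma w) -
    (psi n (Delta w) (Gamma w) - g n Delta w))).
  by rewrite -[X in _ --> X]subr0; exact: cvgB.
by apply/funext => n; rewrite subKr.
Unshelve. all: by end_near. Qed.

End envelope.

(** The envelope of h(u, v) = f(u) gives an upper bound only; a lower bound follows by
    passing to - f. *)
Lemma maximiser_stable_ub u (f : 'cV[R]_p -> R) (Z : Om -> R) :
  asymptotic_maximiser u -> (forall T, TT T -> borel_rv (u T)) ->
  continuous f -> (exists M, forall x, `|f x| <= M) ->
  bounded_wrtG Z -> (forall w, 0 <= Z w) ->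
  forall e, 0 < e -> \forall T \near F,
    Ex P (fun w => f (u T w) * Z w) <= Ex P (fun w => f (uh w) * Z w) + e.
Proof.
move=> uM u_rv cf [C fC] bZ Z0 e e0.
have [_ [M ZM]] := bZ; have {}ZM w : Z w <= M by rewrite (le_trans (ler_norm _)).
pose h (a b : 'cV[R]_p) := f a.
have hC a b : `|h a b| <= C by exact: fC.
have h_unif n (k : R) : 0 < k -> exists2 e : R, 0 < e &
  forall u' v' u v, `|u'| <= n%:R -> `|v'| <= n%:R -> `|u' - u| <= e ->
    `|v' - v| <= e -> `|h u' v' - h u v| <= k.
  move=> k0; have [e1 e10 fe] := unif_continuous_compact
    (@closed_ball_mx_compact R p 1 n%:R) cf k0.
  by exists e1 => // u' v' a b un _ ue _; exact: fe.
have [w0|noOm] := pselect (exists w : Om, True); last first.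
  apply: nearW => T; rewrite (_ : (fun w => f (u T w) * Z w) =
    (fun w => f (uh w) * Z w)) ?lerDl ?(ltW e0)//.
  by apply/funext => w; exfalso; apply: noOm; exists w.
have [w _] := w0.
have C0 : 0 <= C by apply: le_trans (fC 0).
have M0 : 0 <= M by apply: le_trans (ZM w).
pose k := e / 3 / (M + 2 * C * M + 1).
have D0 : 0 < M + 2 * C * M + 1 by rewrite ltr_wpDl// addr_ge0// !mulr_ge0.
have k0 : 0 < k by rewrite divr_gt0// divr_gt0.
have kM : k * M + 2 * C * M * k <= e / 3.
  apply: (@le_trans _ _ (k * (M + 2 * C * M + 1))); last by rewrite divfK// gt_eqF.
  by lra.
have [n0 n0P] := envelope_majorises hC h_unif uM uM k0.
have mh : measurable_fun setT (fun w => h (uh w) (uh w)) by exact: borel_comp uh_rv cf.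
have e30 : 0 < e / 3 by rewrite divr_gt0.
have := envelope_limit hC h_unif bZ mh.
move=> /cvgrPdist_le/(_ _ e30)[n1 _ n1P].
pose n := maxn n0 n1.
have lim1 := n1P n (leq_maxr _ _).
have /cvgrPdist_le/(_ _ e30) lim2 := @envelope_grid_stable h C hC n Z bZ.
move: lim2 (n0P n (leq_maxl _ _)) (near_index TT).
apply: filterS3 => T lim2 maj TTT.
pose gT w := argmax_envelope U h n (X T w) (grid n w).
have bg : bounded_meas gT by exact: envelope_grid_bounded_meas (X_meas TTT).
have bgZ := bounded_measM bg (bounded_wrtG_meas bZ).
have bfZ : bounded_meas (fun w => f (u T w) * Z w).
  apply: (@bounded_measM _ _ _ (f \o u T)); last exact: bounded_wrtG_meas.
  by split; [exact: borel_comp (u_rv _ TTT) cf|exists C => w'; exact: fC].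
have : Ex P (fun w => f (u T w) * Z w) <= Ex P (fun w => gT w * Z w) + k * M + 2 * C * M * k.
  apply: Ex_le_outer => //.
  - by apply: mulr_ge0 => //; exact: ltW.
  - by rewrite !mulr_ge0.
  - move=> w'; rewrite -lerBlDl -mulrBl (le_trans (ler_norm _))// normrM.
    rewrite ler_pM// ?(ger0_norm (Z0 _))//.
    rewrite (le_trans (ler_normB _ _))// mulr2n mulrDl !mul1r lerD//.
    exact: envelope_norm.
  apply: le_trans maj; apply: le_outer_measure => w' /=; rewrite /h.
  apply: contraTT; rewrite -!leNgt => fg.
  apply: le_trans (ler_wpM2r (Z0 w') fg) _; rewrite mulrDl lerD2l.
  by rewrite ler_wpM2l// ltW.
move: lim1 lim2; rewrite !ler_distl => /andP[lim1 _] /andP[lim2 _].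
by rewrite /gT; move=> /le_trans; apply; lra.
Qed.

Lemma maximiser_stable_nonneg u (f : 'cV[R]_p -> R) (Z : Om -> R) :
  asymptotic_maximiser u -> (forall T, TT T -> borel_rv (u T)) ->
  continuous f -> (exists M, forall x, `|f x| <= M) ->
  bounded_wrtG Z -> (forall w, 0 <= Z w) ->
  Ex P (fun w => f (u T w) * Z w) @[T --> F] --> Ex P (fun w => f (uh w) * Z w).
Proof.
move=> uM u_rv cf [C fC] bZ Z0.
have bf : exists M, forall x, `|f x| <= M by exists C.
have bNf : exists M, forall x, `|- f x| <= M by exists C => x; rewrite normrN.
have cNf : continuous (fun x => - f x) by exact: continuous_oppr.
have bfZ (Y : Om -> 'cV[R]_p) : borel_rv Y -> bounded_meas (fun w => f (Y w) * Z w).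
  move=> mY; apply: (@bounded_measM _ _ _ (f \o Y)); last exact: bounded_wrtG_meas.
  by split; [exact: borel_comp mY cf|exists C => w'; exact: fC].
have ExN (Y : Om -> 'cV[R]_p) : borel_rv Y ->
    Ex P (fun w => - f (Y w) * Z w) = - Ex P (fun w => f (Y w) * Z w).
  move=> mY; rewrite -mulN1r -ExZ; last exact: bfZ.
  by congr Ex; apply/funext => w; rewrite mulN1r mulNr.
apply/cvgrPdist_le => e e0.
have ub := maximiser_stable_ub uM u_rv cf bf bZ Z0 e0.
have lb := maximiser_stable_ub uM u_rv cNf bNf bZ Z0 e0.
move: ub lb (near_index TT); apply: filterS3 => T ub lb TTT.
rewrite (ExN _ (u_rv _ TTT)) (ExN _ uh_rv) in lb.
by rewrite ler_distl; apply/andP; split; lra.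
Qed.

Lemma bounded_wrtG_comp (f : R -> R) Z : continuous f ->
  (forall x, `|f x| <= `|x| + 1) -> bounded_wrtG Z -> bounded_wrtG (f \o Z).
Proof.
move=> cf fb [mZ [M ZM]]; split; last first.
  by exists (M + 1) => w; rewrite (le_trans (fb _))// lerD2r.
exact: measurable_wrt_comp mZ cf.
Qed.

(** The sandwich for nonnegative test variables extends to all bounded ones through
    their positive and negative parts. *)
Lemma maximiser_stable u : asymptotic_maximiser u ->
  (forall T, TT T -> borel_rv (u T)) -> cvg_stable P TT G u uh.
Proof.
move=> uM u_rv f Z cf bf mZ [M ZM].
have bZ : bounded_wrtG Z by split => //; exists M.
pose Zp w := Num.max (Z w) 0; pose Zn w := Num.max (- Z w) 0.
have bZp : bounded_wrtG Zp.
  apply: (@bounded_wrtG_comp (fun x => Num.max x 0)) => // [x|x].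
    by apply: continuous_max; [exact: cvg_id|exact: cvg_cst].
  rewrite ger0_norm ?le_max ?lexx ?orbT// ge_max addr_ge0// andbT.
  by have := ler_norm x; lra.
have bZn : bounded_wrtG Zn.
  apply: (@bounded_wrtG_comp (fun x => Num.max (- x) 0)) => // [x|x].
    by apply: continuous_max; [apply: cvgN; exact: cvg_id|exact: cvg_cst].
  rewrite ger0_norm ?le_max ?lexx ?orbT// ge_max addr_ge0// andbT.
  by have := ler_norm (- x); rewrite normrN; lra.
have Z0p w : 0 <= Zp w by rewrite le_max lexx orbT.
have Z0n w : 0 <= Zn w by rewrite le_max lexx orbT.
have ZE w : Z w = Zp w + -1 * Zn w.
  by rewrite /Zp /Zn; case: (leP (Z w) 0); case: (leP (- Z w) 0); lra.
have bfY (Y : Om -> 'cV[R]_p) W : borel_rv Y -> bounded_wrtG W ->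
    bounded_meas (fun w => f (Y w) * W w).
  move=> mY bW; apply: (@bounded_measM _ _ _ (f \o Y)); last exact: bounded_wrtG_meas.
  by split; [exact: borel_comp mY cf|have [C fC] := bf; exists C => w'; exact: fC].
have splitE (Y : Om -> 'cV[R]_p) : borel_rv Y ->
    ('E_P[fun w => (f (Y w) * Z w)%R] = (Ex P (fun w => f (Y w) * Zp w)
       - Ex P (fun w => f (Y w) * Zn w))%:E)%E.
  move=> mY; rewrite expectationE; last exact: bfY.
  congr EFin; rewrite -mulN1r -ExZ; last exact: bfY.
  rewrite -ExD; last 2 first.
  - exact: bfY.
  - by apply: bounded_measM; [exact: bounded_meas_cst|exact: bfY].
  by congr Ex; apply/funext => w; rewrite ZE; ring.
rewrite splitE//.
have lim := cvgB (maximiser_stable_nonneg uM u_rv cf bf bZp Z0p)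
  (maximiser_stable_nonneg uM u_rv cf bf bZn Z0n).
apply: (@cvg_trans _ ((Ex P (fun w => f (u T w) * Zp w)
  - Ex P (fun w => f (u T w) * Zn w))%:E @[T --> F])); last first.
  by apply: cvg_EFin; [exact: nearW|exact: lim].
apply: near_eq_cvg; apply: filterS (near_index TT) => T TTT /=.
by rewrite splitE//; exact: u_rv.
Qed.

(** The function h(a, b) = min(|a - b|, 1) vanishes on the diagonal, so the expectation
    of its envelope tends to 0 and Markov's inequality applies to the envelope, which is
    measurable even when u and v are not. *)
Lemma maximisers_merge u v : asymptotic_maximiser u -> asymptotic_maximiser v ->
  cvg_proba0 P TT (fun T w => (fnorm (u T w - v T w))%:E).
Proof.
move=> uM vM; apply/cvg_proba0P => e k e0 k0.
pose h (a b : 'cV[R]_p) := Num.min `|a - b| 1.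
have h0 a b : 0 <= h a b by rewrite le_min normr_ge0 ler01.
have hC a b : `|h a b| <= 1 by rewrite ger0_norm// ge_min lexx orbT.
have hd a b a' b' : h a b <= h a' b' + (`|a' - a| + `|b' - b|).
  have tri : `|a - b| <= `|a' - b'| + (`|a' - a| + `|b' - b|).
    have -> : a - b = (a' - b') - ((a' - a) - (b' - b)).
      have -> : a' - b' - (a' - a - (b' - b)) = a' - b' + (b' - b) - (a' - a).
        by rewrite opprB addrA.
      have -> : a' - b' + (b' - b) = a' - b by rewrite addrA subrK.
      by rewrite opprB [RHS]addrC addrA subrK.
    rewrite (le_trans (ler_normB _ _))// lerD2l.
    exact: ler_normB.
  have := normr_ge0 (a' - a); have := normr_ge0 (b' - b).
  by rewrite /h; case: (leP `|a - b| 1); case: (leP `|a' - b'| 1); lra.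
have h_unif n (k' : R) : 0 < k' -> exists2 e : R, 0 < e &
  forall u' v' u v, `|u'| <= n%:R -> `|v'| <= n%:R -> `|u' - u| <= e ->
    `|v' - v| <= e -> `|h u' v' - h u v| <= k'.
  move=> k'0; exists (k' / 2); first by rewrite divr_gt0.
  move=> u' v' a b _ _ ua vb; have h1 := hd u' v' a b; have h2 := hd a b u' v'.
  rewrite !(distrC a) !(distrC b) in h1.
  by rewrite ler_distl; apply/andP; split; lra.
pose e' := Num.min (e / (p%:R + 1)) 1.
have p1 : 0 < p%:R + 1 :> R by rewrite ltr_wpDl.
have e'0 : 0 < e' by rewrite lt_min ltr01 divr_gt0.
pose k1 := Num.min (e' / 2) (k / 2).
have k10 : 0 < k1 by rewrite lt_min !divr_gt0.
have [n0 n0P] := envelope_majorises hC h_unif uM vM k10.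
have huh : (fun w => h (uh w) (uh w)) = fun=> 0.
  by apply/funext => w; rewrite /h subrr normr0 minEle ler01.
have b1 := bounded_wrtG_cst 1.
have mh : measurable_fun setT (fun w => h (uh w) (uh w)) by rewrite huh.
have ek0 : 0 < e' / 2 * (k / 2) / 2 by rewrite !divr_gt0// !mulr_gt0// divr_gt0.
have /cvgrPdist_le/(_ _ ek0)[n1 _ n1P] := envelope_limit hC h_unif b1 mh.
pose n := maxn n0 n1.
have := n1P n (leq_maxr _ _).
rewrite (_ : Ex P (fun w => h (uh w) (uh w) * 1) = 0); last first.
  by rewrite -[RHS](Ex_cst P); congr Ex; apply/funext => w; rewrite (congr1 (@^~ w) huh) mul0r.
rewrite sub0r normrN => lim1.
have /cvgrPdist_le/(_ _ ek0) lim2 := @envelope_grid_stable h 1 hC n _ b1.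
move: lim2 (n0P n (leq_maxl _ _)) (near_index TT).
apply: filterS3 => T lim2 maj TTT.
pose gT w := argmax_envelope U h n (X T w) (grid n w).
have bg : bounded_meas gT by exact: envelope_grid_bounded_meas (X_meas TTT).
have g0 w : 0 <= gT w by apply: (envelope_ge U0 hC) => a.
have small : Ex P gT <= e' / 2 * (k / 2).
  have -> : Ex P gT = Ex P (fun w => gT w * 1).
    by congr Ex; apply/funext => w; rewrite mulr1.
  move: lim1 lim2; rewrite ler_norml ler_distl => /andP[_ h1] /andP[h2 _].
  by rewrite /gT; lra.
have e'20 : 0 < e' / 2 by rewrite divr_gt0.
have mk : ((P^*)%mu [set w | (e' / 2 <= gT w)%R] <= (k / 2)%:E)%E.
  rewrite (le_trans (markov_outer P bg g0 e'20))// lee_fin ler_pdivrMr//.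
  by rewrite mulrC.
have maj' : ((P^*)%mu [set w | (gT w + k1 < h (u T w) (v T w))%R] <= (k / 2)%:E)%E.
  by apply: le_trans maj _; rewrite lee_fin ge_min lexx orbT.
rewrite [k]splitr; apply: le_trans (outerU_le maj' mk).
apply: le_outer_measure => w /=; rewrite lte_fin fnorm_norm => euv.
have euv' : e' <= h (u T w) (v T w).
  rewrite le_min !ge_min lexx orbT andbT; apply/orP; left.
  rewrite ler_pdivrMr// (le_trans (ltW euv))//.
  rewrite (le_trans (fnorm_le _))// muln1 mulrC ler_wpM2l// lerDl.
  exact: ler01.
have [gh|gh] := ltP (gT w + k1) (h (u T w) (v T w)); [by left|right].
have : k1 <= e' / 2 by rewrite ge_min lexx.
by lra.
Qed.

End stable.

(** * Second-order Taylor formula on a star-shaped open set *)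

Section one_dimension.
Context {R : realType}.

Lemma mean_value_bound (f df : R -> R) (a b c : R) : a <= b ->
  (forall x, a <= x <= b -> is_derive x 1 f (df x)) ->
  (forall x, a <= x <= b -> `|df x| <= c) -> `|f b - f a| <= c * (b - a).
Proof.
move=> ab fd dfc; have [||x xab ->] := @MVT_segment R f df a b ab.
- move=> x; rewrite in_itv/= => /andP[ax xb]; apply: fd.
  by rewrite (ltW ax) (ltW xb).
- apply: derivable_within_continuous => x; rewrite in_itv/= => xab.
  by have [] := fd x xab.
- rewrite normrM [X in _ * X]ger0_norm ?subr_ge0//.
  by apply: ler_wpM2r; [rewrite subr_ge0|apply: dfc; rewrite in_itv/= in xab].
Qed.

Lemma is_derive_lim (V : normedModType R) (f : V -> R) (x v : V) (l : R) :
  (forall e : R, 0 < e -> exists2 del : R, 0 < del &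
    forall t : R, t != 0 -> `|t| < del ->
      `|l - t^-1 * (f (t *: v + x) - f x)| <= e) ->
  is_derive x v f l.
Proof.
move=> h; have lim : (fun t : R => t^-1 *: ((f \o shift x) (t *: v) - f x)) @ 0^' --> l.
  apply/cvgrPdist_le => e e0; have [del del0 hd] := h e e0.
  exists del => // t /=; rewrite sub0r normrN => td t0.
  exact: hd.
by apply: DeriveDef; [apply/cvg_ex; exists l|apply/cvg_lim].
Qed.

Lemma is_derive_line (V : normedModType R) (f : V -> R) (x v : V) (s l : R) :
  is_derive (x + s *: v) v f l -> is_derive s 1 (fun r => f (x + r *: v)) l.
Proof.
have e : (fun t : R => t^-1 *: ((f \o shift (x + s *: v)) (t *: v) - f (x + s *: v)))
  = (fun t => t^-1 *: (((fun r => f (x + r *: v)) \o shift s) (t *: 1) - f (x + s *: v))).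
  apply/funext => t /=; congr (_ *: (f _ - _)).
  by rewrite addrCA -scalerDl [t *: 1]mulr1.
by move=> [fd fl]; apply: DeriveDef; [rewrite /derivable -e|rewrite /derive -e].
Qed.

End one_dimension.

Section directional_derivative.
Context {R : realType} {n : nat}.
Implicit Types (f : 'cV[R]_n -> R) (x z h : 'cV[R]_n).

Lemma norm_unitv (i : 'I_n) : `|unitv i : 'cV[R]_n| <= 1.
Proof.
apply: mx_norm_le => // j k; rewrite mxE; case: (_ && _); rewrite ?normr1 ?normr0//.
Qed.

Lemma coordinate_step f z (i : 'I_n) (r l e : R) :
  (forall s : R, `|s| <= `|r| -> derivable f (z + s *: unitv i) (unitv i)) ->
  (forall s : R, `|s| <= `|r| -> `|'D_(unitv i) f (z + s *: unitv i) - l| <= e) ->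
  `|f (z + r *: unitv i) - f z - r * l| <= e * `|r|.
Proof.
move=> fd fl.
pose F (s : R) := f (z + s *: unitv i) - s * l.
have Fd (s : R) : `|s| <= `|r| -> is_derive s 1 F ('D_(unitv i) f (z + s *: unitv i) - l).
  move=> sr; apply: is_deriveB; first exact/is_derive_line/derivableP/fd.
  by apply: is_derive_eq; rewrite scaler0 add0r; exact: mulr1.
have -> : f (z + r *: unitv i) - f z - r * l = F r - F 0.
  by rewrite /F scale0r addr0 mul0r subr0 addrAC.
have [r0|r0] := leP 0 r.
  rewrite (@ger0_norm _ r)// -[in leRHS](subr0 r); apply: mean_value_bound => // [s|s] /andP[s0 sr].
    by apply: Fd; rewrite !ger0_norm.
  by apply: fl; rewrite !ger0_norm.
rewrite distrC (@ltr0_norm _ r)// -[in leRHS](sub0r r).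
apply: mean_value_bound => [|s|s]; first exact: ltW.
  by move=> /andP[rs s0]; apply: Fd; rewrite !ler0_norm ?lerN2// ltW.
by move=> /andP[rs s0]; apply: fl; rewrite !ler0_norm ?lerN2// ltW.
Qed.

(** The increment is split along the coordinate axes, and the mean value theorem is
    applied to each piece. *)
Lemma C1_increment f x h (del e : R) :
  (forall y i, `|x - y| < del -> derivable f y (unitv i)) ->
  (forall y i, `|x - y| < del -> `|'D_(unitv i) f y - 'D_(unitv i) f x| <= e) ->
  `|h| < del -> `|f (x + h) - f x - dotv (grad f x) h| <= n%:R * (e * `|h|).
Proof.
move=> fd fe hdel.
have e0 : 0 <= n%:R * e.
  case: (posnP n) => [->|n0]; first by rewrite mul0r.
  by rewrite mulr_ge0// (le_trans _ (fe x (Ordinal n0) _))// subrr normr0 (le_lt_trans _ hdel).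
(* z k moves the first k coordinates from x to x + h. *)
pose z (k : nat) : 'cV[R]_n := x + \col_(i < n) (if (i < k)%N then h i 0 else 0).
have step k : (k <= n)%N ->
    `|f (z k) - f x - \sum_(i < n | (i < k)%N) 'D_(unitv i) f x * h i 0| <= k%:R * (e * `|h|).
  elim: k => [_|k IH kn].
    rewrite big_pred0// mul0r (_ : z 0%N = x) ?subrr ?subr0 ?normr0//.
    by rewrite /z (_ : \col_i _ = 0) ?addr0//; apply/colP => i; rewrite !mxE.
  pose i := Ordinal kn.
  have zS : z k.+1 = z k + h i 0 *: unitv i.
    rewrite /z -addrA; congr (_ + _); apply/colP => j; rewrite !mxE ltnS andbT.
    rewrite leq_eqVlt -[(j == k :> nat)]/(j == i).
    by have [->|ji] := eqVneq j i; rewrite /= ?ltnn ?mulr1 ?add0r// mulr0 addr0.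
  have zdel s : `|s| <= `|h i 0| -> `|x - (z k + s *: unitv i)| < del.
    move=> sh; apply: le_lt_trans hdel; rewrite distrC /z addrAC [x + _]addrC addrK.
    apply: mx_norm_le => // j l; rewrite !mxE (ord1 l) andbT.
    have [->|ji] := eqVneq j i.
      by rewrite ltnn mulr1 add0r (le_trans sh)// mx_coord_le.
    by rewrite mulr0 addr0; case: ifP => _; rewrite ?normr0// mx_coord_le.
  have hstep := @coordinate_step f (z k) i (h i 0) ('D_(unitv i) f x) e
     (fun s sh => fd _ i (zdel s sh)) (fun s sh => fe _ i (zdel s sh)).
  have -> : \sum_(j < n | (j < k.+1)%N) 'D_(unitv j) f x * h j 0 =
      'D_(unitv i) f x * h i 0 + \sum_(j < n | (j < k)%N) 'D_(unitv j) f x * h j 0.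
    rewrite (bigD1 i)//=; congr (_ + _); apply: eq_bigl => j.
    by rewrite ltnS leq_eqVlt -[(j == k :> nat)]/(j == i); have [->|ji] := eqVneq j i;
      rewrite /= ?ltnn ?andbT.
  rewrite zS.
  have -> : f (z k + h i 0 *: unitv i) - f x - ('D_(unitv i) f x * h i 0 +
      \sum_(j < n | (j < k)%N) 'D_(unitv j) f x * h j 0) =
    (f (z k) - f x - \sum_(j < n | (j < k)%N) 'D_(unitv j) f x * h j 0) +
    (f (z k + h i 0 *: unitv i) - f (z k) - h i 0 * 'D_(unitv i) f x) by ring.
  rewrite (le_trans (ler_normD _ _))// -natr1 mulrDl mul1r lerD ?IH ?(ltnW kn)//.
  rewrite (le_trans hstep)// ler_wpM2l ?mx_coord_le//.
  by rewrite -(pmulr_rge0 _ (_ : 0 < n%:R))// ltr0n (leq_ltn_trans _ kn).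
have := step n (leqnn n).
rewrite (_ : z n = x + h); last first.
  by rewrite /z; congr (_ + _); apply/colP => i; rewrite !mxE ltn_ord.
rewrite (_ : \sum_(i < n | _) _ = dotv (grad f x) h)//.
by rewrite /dotv; apply: eq_big => i; [rewrite ltn_ord|rewrite mxE].
Qed.

Lemma C1_directional f (N : set 'cV[R]_n) x h : open N -> N x ->
  (forall y i, N y -> derivable f y (unitv i)) ->
  {within N, continuous (grad f)} ->
  is_derive x h f (dotv (grad f x) h).
Proof.
move=> oN Nx fd; rewrite continuous_open_subspace// => /(_ x (mem_set Nx)) cg.
apply: is_derive_lim => e e0.
pose c := n%:R * `|h| + 1 : R.
have c0 : 0 < c by rewrite ltr_wpDl// mulr_ge0.
have ec0 : 0 < e / c by rewrite divr_gt0.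
have /nbhs_ballP[d1 /= d10 N1] : nbhs x N by exact: open_nbhs_nbhs.
have /nbhs_ballP[d2 /= d20 N2] : nbhs x [set y | `|grad f x - grad f y| < e / c].
  exact: cg _ (near_dist_lt (grad f x) ec0).
pose dd := Num.min d1 d2.
have dd0 : 0 < dd by rewrite lt_min d10.
exists (dd / (`|h| + 1)); first by rewrite divr_gt0// ltr_wpDl.
move=> t t0; rewrite ltr_pdivlMr ?ltr_wpDl// => th.
have th' : `|t *: h| < dd.
  by rewrite normrZ (le_lt_trans _ th)// ler_wpM2l// lerDl.
have := @C1_increment f x (t *: h) dd (e / c) _ _ th'.
rewrite [t *: h + x]addrC => inc.
have {}inc : `|f (x + t *: h) - f x - dotv (grad f x) (t *: h)| <=
    n%:R * (e / c * `|t *: h|).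
  apply: inc => y i; rewrite lt_min => /andP[xy1 xy2].
    by apply: fd; apply: N1; rewrite -ball_normE.
  have /N2/ltW gy : ball x d2 y by rewrite -ball_normE.
  apply: le_trans gy; rewrite distrC.
  by have := mx_coord_le (grad f x - grad f y) i 0; rewrite !mxE.
have dZ : dotv (grad f x) (t *: h) = t * dotv (grad f x) h.
  by rewrite !dotvE -scalemxAr mxE.
rewrite dZ in inc; rewrite distrC.
have -> : t^-1 * (f (x + t *: h) - f x) - dotv (grad f x) h =
    t^-1 * (f (x + t *: h) - f x - t * dotv (grad f x) h).
  by rewrite [RHS]mulrBr mulrA mulVf// mul1r.
rewrite normrM normfV ler_pdivrMl ?normr_gt0// (le_trans inc)//.
rewrite normrZ.
have -> : n%:R * (e / c * (`|t| * `|h|)) = (e / c) * `|t| * (n%:R * `|h|) by ring.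
have -> : `|t| * e = (e / c) * `|t| * c by field; rewrite gt_eqF.
by apply: ler_wpM2l; [apply: mulr_ge0 => //; exact: ltW|rewrite /c lerDl].
Qed.

End directional_derivative.

Lemma within_subset_cvg (T : topologicalType) (A B : set T) (x : T) : A `<=` B ->
  within A (nbhs x) --> within B (nbhs x).
Proof.
move=> AB D wD; apply: (@filterS _ (nbhs x) _ (fun y => B y -> D y)) wD => y BD Ay.
by apply/BD/AB.
Qed.

Section taylor.
Context {R : realType} {n : nat}.
Variables (N : set 'cV[R]_n) (ths : 'cV[R]_n).
Hypothesis N_open : open N.
Hypothesis N_star : forall th (t : R), N th -> 0 < t -> t <= 1 ->
  N (t *: th + (1 - t) *: ths).
Hypothesis N_ths : closure N ths.

(** The closed-set derivatives [gradc] and [hessc] are defined as limits from within N;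
    a continuous extension makes these limits exist on the closure. *)
Lemma extension_cvg (V : normedModType R) (g : 'cV[R]_n -> V) x :
  continuously_extendable N g -> closure N x ->
  g y @[y --> within N (nbhs x)] --> lim (g y @[y --> within N (nbhs x)]).
Proof.
move=> [g' /subspace_continuousP cg' gg'] Nx.
have FN : ProperFilter (within N (nbhs x)) by exact: within_nbhs_proper.
apply/cvg_ex; exists (g' x).
have lim : g' y @[y --> within N (nbhs x)] --> g' x.
  apply: cvg_trans (cg' x Nx); apply: cvg_app; apply: within_subset_cvg.
  exact: subset_closure.
apply: cvg_trans lim; apply: near_eq_cvg; near=> y; apply: gg'.
by near: y; exact: withinT.
Unshelve. all: by end_near. Qed.

Lemma extension_lim_in (V : normedModType R) (g : 'cV[R]_n -> V) x :
  {within N, continuous g} -> N x -> lim (g y @[y --> within N (nbhs x)]) = g x.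
Proof.
move=> /subspace_continuousP cg Nx.
have FN : ProperFilter (within N (nbhs x)).
  by apply: within_nbhs_proper; exact: subset_closure.
by apply/cvg_lim => //; exact: cg.
Qed.

Lemma segment_in (h : 'cV[R]_n) (s : R) : N (ths + h) -> 0 < s -> s <= 1 ->
  N (ths + s *: h).
Proof.
move=> Nh s0 s1; have := N_star Nh s0 s1.
by rewrite scalerDr addrAC -scalerDl subrKC scale1r.
Qed.

Lemma segment_cvg (h : 'cV[R]_n) : N (ths + h) ->
  (fun s : R => ths + s *: h) @ 0^'+ --> within N (nbhs ths).
Proof.
move=> Nh A /= wA.
have h0 : 0 < `|h| + 1 by rewrite ltr_wpDl.
have /nbhs_ballP[d /= d0 dA] : nbhs ths (fun y => N y -> A y) by [].
suff : \forall s \near (0 : R)^'+, A (ths + s *: h) by [].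
near=> s.
have bs : `|ths - (ths + s *: h)| < d.
  rewrite opprD addrA subrr add0r normrN normrZ ger0_norm//.
  have : s < d / (`|h| + 1).
    by near: s; apply: nbhs_right_lt; rewrite divr_gt0.
  rewrite ltr_pdivlMr//; apply: le_lt_trans; rewrite ler_wpM2l// ?lerDl//.
apply: dA; first by rewrite -ball_normE.
by apply: segment_in => //; near: s; exact: nbhs_right_le.
Unshelve. all: by end_near. Qed.

Lemma is_derive_mulr_cst (s l : R) : is_derive s (1 : R) (fun r : R => r * l) l.
Proof. by apply: is_derive_eq; rewrite scaler0 add0r; exact: mulr1. Qed.

Lemma is_derive_sqr_cst (s l : R) :
  is_derive s (1 : R) (fun r : R => 2^-1 * (r ^+ 2 * l)) (s * l).
Proof.
apply: is_derive_eq; rewrite ?scaler0 ?add0r ?addr0 /GRing.scale /=.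
by field.
Qed.

Variable f : 'cV[R]_n -> R.
Hypothesis f_C2 : C2_closure N f.

Lemma grad_line (h : 'cV[R]_n) (s : R) : N (ths + s *: h) ->
  is_derive s 1 (fun r => f (ths + r *: h)) (dotv (grad f (ths + s *: h)) h).
Proof.
case: f_C2 => -[f1 _ [_ cg _] _ _ _] Ns; apply: is_derive_line.
by apply: (C1_directional _ N_open Ns) => // y i; exact: f1.
Qed.

Lemma within_continuous_comp (V W : normedModType R) (g : 'cV[R]_n -> V) (k : V -> W) :
  {within N, continuous g} -> continuous k -> {within N, continuous (k \o g)}.
Proof.
move=> /subspace_continuousP cg ck; apply/subspace_continuousP => x Nx.
exact: (cvg_comp g k (cg x Nx) (ck (g x))).
Qed.

Lemma hess_line (h : 'cV[R]_n) (s : R) : N (ths + s *: h) ->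
  is_derive s 1 (fun r => dotv (grad f (ths + r *: h)) h)
    (quadf (hess f (ths + s *: h)) h).
Proof.
case: f_C2 => -[_ f2 [_ _ ch] _ _ _] Ns.
have Dj (j : 'I_n) : is_derive s 1 (fun r => 'D_(unitv j) f (ths + r *: h) * h j 0)
    (dotv (grad ('D_(unitv j) f) (ths + s *: h)) h * h j 0).
  have : is_derive s 1 (fun r => 'D_(unitv j) f (ths + r *: h))
      (dotv (grad ('D_(unitv j) f) (ths + s *: h)) h).
    apply: (@is_derive_line _ _ ('D_(unitv j) f)); apply: (C1_directional h N_open Ns) => [y i Ny|].
      exact: f2.
    rewrite (_ : grad _ = col j \o hess f).
      apply: within_continuous_comp ch _.
      apply: norm_lip_continuous => A B; rewrite -linearB.
      by apply: mx_norm_le => // i k; rewrite mxE mx_coord_le.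
    by apply/funext => y; apply/colP => i; rewrite !mxE.
  move=> D; apply: is_derive_eq.
  by rewrite scaler0 add0r /GRing.scale /= mulrC.
rewrite (_ : (fun r => _) = \sum_(j < n) (fun r => 'D_(unitv j) f (ths + r *: h) * h j 0)).
  apply: is_derive_eq.
  rewrite /quadf mxE; apply: eq_bigr => j _; congr (_ * _).
  by rewrite /dotv mxE; apply: eq_bigr => i _; rewrite !mxE mulrC.
apply/funext => r; rewrite fct_sumE /dotv; apply: eq_bigr => j _.
by rewrite mxE.
Qed.

(** Taylor's formula along the segment from ths, when the second derivative stays
    within c of the constant - m. As ths may lie on the boundary of N, the mean value
    bounds are taken between t and s, for t > 0, and t is sent to 0. The factor 1/2 in
    front of c is not recovered by applying the mean value theorem twice. *)
Lemma taylor_segment (h : 'cV[R]_n) (m c : R) : N (ths + h) ->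
  (forall s : R, 0 < s -> s <= 1 -> `|quadf (hess f (ths + s *: h)) h + m| <= c) ->
  `|f (ths + h) - f ths - (dotv (gradc N f ths) h - 2^-1 * m)| <= c.
Proof.
move=> Nh bnd; set L := dotv _ _.
have c0 : 0 <= c by apply: le_trans (bnd 1 _ _).
case: f_C2 => _ cf eg eh.
have seg s : 0 < s -> s <= 1 -> N (ths + s *: h) by move=> s0 s1; exact: segment_in.
pose g1 (s : R) := dotv (grad f (ths + s *: h)) h + s * m.
have g1_lip (t s : R) : 0 < t -> t <= s -> s <= 1 -> `|g1 s - g1 t| <= c.
  move=> t0 ts s1; apply: (@le_trans _ _ (c * (s - t))); last first.
    by rewrite ler_piMr//; lra.
  apply: (@mean_value_bound _ _ (fun r => quadf (hess f (ths + r *: h)) h + m)) => // r /andP[tr rs].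
    have r0 : 0 < r by lra.
    have r1 : r <= 1 by lra.
    by apply: is_deriveD; [exact/hess_line/seg|exact: is_derive_mulr_cst].
  by apply: bnd; lra.
have g1_lim : g1 @ 0^'+ --> L.
  rewrite -[L]addr0; apply: cvgD.
    have : grad f (ths + s *: h) @[s --> 0^'+] --> gradc N f ths.
      apply: cvg_comp (segment_cvg Nh) _.
      exact: (extension_cvg eg N_ths).
    move=> gl; suff dc : continuous (fun D : 'cV[R]_n => dotv D h).
      exact: (cvg_comp (fun s : R => grad f (ths + s *: h)) (fun D : 'cV[R]_n => dotv D h) gl (dc _)).
    apply: eps_delta_continuous => x e e0.
    have h0 : 0 < n%:R * `|h| + 1 by rewrite ltr_wpDl// mulr_ge0.
    exists (e / (n%:R * `|h| + 1)); first by rewrite divr_gt0.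
    move=> y; rewrite ltr_pdivlMr// -dotvBl; apply: le_lt_trans.
    rewrite (le_trans (dotv_le _ _))// -mulrA mulrCA ler_wpM2l// lerDl//.
  rewrite -[X in _ --> X](mul0r m).
  by apply: cvgMl; exact: cvg_within.
have g1_bnd (s : R) : 0 < s -> s <= 1 -> `|g1 s - L| <= c.
  move=> s0 s1; apply/ler_addgt0Pr => e e0; near (0 : R)^'+ => t.
  have tL : `|L - g1 t| <= e by near: t; move/cvgrPdist_le: g1_lim; exact.
  have := @g1_lip t s; move/(_ _ _ s1) => lip.
  rewrite -[L](subrK (g1 t)) opprD addrA addrAC (le_trans (ler_normB _ _))// lerD//.
  by apply: lip => //; near: t; exact: nbhs_right_le.
pose g0 (s : R) := f (ths + s *: h) - s * L + 2^-1 * (s ^+ 2 * m).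
have g0_lip (t : R) : 0 < t -> t <= 1 -> `|g0 1 - g0 t| <= c.
  move=> t0 t1; apply: (@le_trans _ _ (c * (1 - t))); last by rewrite ler_piMr//; lra.
  apply: (@mean_value_bound _ _ (fun r => dotv (grad f (ths + r *: h)) h - L + r * m)) => //
      r /andP[tr r1]; last first.
    by rewrite addrAC; apply: g1_bnd; lra.
  have r0 : 0 < r by lra.
  apply: is_deriveD; last exact: is_derive_sqr_cst.
  by apply: is_deriveB; [exact/grad_line/seg|exact: is_derive_mulr_cst].
have g0_lim : g0 @ 0^'+ --> f ths.
  rewrite -[f ths]addr0; apply: cvgD.
    rewrite -[f ths]subr0; apply: cvgB.
      have /subspace_continuousP/(_ _ N_ths) cfths := cf.
      apply: (cvg_comp (fun s : R => ths + s *: h) f _ cfths).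
      apply: cvg_trans (segment_cvg Nh) _; apply: within_subset_cvg.
      exact: subset_closure.
    rewrite -[X in _ --> X](mul0r L).
    by apply: cvgMl; exact: cvg_within.
  rewrite [X in _ --> X](_ : 0 = 2^-1 * (0 ^+ 2 * m)); last by rewrite expr0n mul0r mulr0.
  apply: cvgMr; apply: cvgMl; apply: (cvg_comp (fun s : R => s) (fun s => s ^+ 2)).
    exact: cvg_within.
  exact: exprn_continuous.
have -> : f (ths + h) - f ths - (L - 2^-1 * m) = g0 1 - f ths.
  by rewrite /g0 scale1r; lra.
apply/ler_addgt0Pr => e e0; near (0 : R)^'+ => t.
have tL : `|f ths - g0 t| <= e by near: t; move/cvgrPdist_le: g0_lim; exact.
rewrite -[f ths](subrK (g0 t)) opprD addrA addrAC (le_trans (ler_normB _ _))// lerD//.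
by apply: g0_lip => //; near: t; exact: nbhs_right_le.
Unshelve. all: by end_near. Qed.

End taylor.

(** * Quadratic expansion in the local coordinate *)

Section local_expansion.
Context {R : realType} {p : nat}.
Variables (N : set 'cV[R]_p) (ths : 'cV[R]_p).
Hypothesis N_open : open N.
Hypothesis N_star : forall th (t : R), N th -> 0 < t -> t <= 1 ->
  N (t *: th + (1 - t) *: ths).
Hypothesis N_ths : closure N ths.
Variable f : 'cV[R]_p -> R.
Hypothesis f_C2 : C2_closure N f.
Variables (a Gam : 'M[R]_p) (del e : R).
Hypothesis a_unit : a \in unitmx.
Hypothesis hess_close : forall x, closure N x -> `|x - ths| < del ->
  `|a^T *m hessc N f x *m a + Gam| <= e.

Lemma dotv_mulmx (v u : 'cV[R]_p) : dotv v (a *m u) = dotv (a^T *m v) u.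
Proof. by rewrite !dotvE mulmxA trmx_mul trmxK. Qed.

Lemma quadf_mulmx (M : 'M[R]_p) (u : 'cV[R]_p) : quadf M (a *m u) = quadf (a^T *m M *m a) u.
Proof. by rewrite /quadf trmx_mul !mulmxA. Qed.

Let expansion_inner (u : 'cV[R]_p) : N (ths + a *m u) -> `|a *m u| < del ->
  `|f (ths + a *m u) - f ths - qcrit (a^T *m gradc N f ths) Gam u| <=
    p%:R ^+ 2 * e * `|u| ^+ 2.
Proof.
move=> Nu udel; rewrite /qcrit -dotv_mulmx.
apply: (taylor_segment N_open N_star N_ths f_C2 Nu) => s s0 s1.
have Ns : N (ths + s *: (a *m u)) by exact: segment_in.
have -> : hess f (ths + s *: (a *m u)) = hessc N f (ths + s *: (a *m u)).
  by case: f_C2 => -[_ _ [_ _ ch]] _ _ _; rewrite /hessc extension_lim_in.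
rewrite quadf_mulmx -quadfDl (le_trans (quadf_le _ _))//.
rewrite ler_wpM2r ?exprn_ge0// ler_wpM2l ?exprn_ge0//.
apply: hess_close; first exact: subset_closure.
rewrite addrAC subrr add0r normrZ ger0_norm ?(ltW s0)//.
by apply: le_lt_trans udel; rewrite ler_piMl.
Qed.

(** The quadratic expansion in the local coordinate u, extended to boundary
    points of N by continuity. *)
Lemma local_expansion (u : 'cV[R]_p) : closure N (ths + a *m u) -> `|a *m u| < del ->
  `|f (ths + a *m u) - f ths - qcrit (a^T *m gradc N f ths) Gam u| <=
    p%:R ^+ 2 * e * `|u| ^+ 2.
Proof.
set th := ths + a *m u => Nth udel.
pose loc y : 'cV[R]_p := invmx a *m (y - ths).
have locth : loc th = u by rewrite /loc /th addrAC subrr add0r mulKmx.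
have thloc y : y = ths + a *m loc y by rewrite /loc mulKVmx// addrC subrK.
have cloc : continuous loc by exact: affine_continuous.
set D := a^T *m gradc N f ths.
have FN : ProperFilter (within N (nbhs th)) by exact: within_nbhs_proper.
have f_lim : f y @[y --> within N (nbhs th)] --> f th.
  case: f_C2 => _ /subspace_continuousP/(_ th Nth) cf _ _.
  apply: cvg_trans cf; apply: cvg_app; apply: within_subset_cvg.
  exact: subset_closure.
have loc_lim : loc y @[y --> within N (nbhs th)] --> loc th.
  by apply: cvg_trans (cloc th); apply: cvg_app; exact: cvg_within.
have q_lim : qcrit D Gam (loc y) @[y --> within N (nbhs th)] --> qcrit D Gam u.
  rewrite -[in X in _ --> X]locth.
  exact: (cvg_comp loc (qcrit D Gam) loc_lim (@qcrit_continuous _ _ _ _ _)).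
have s_lim : p%:R ^+ 2 * e * `|loc y| ^+ 2 @[y --> within N (nbhs th)] -->
    p%:R ^+ 2 * e * `|u| ^+ 2.
  rewrite -[in X in _ --> X]locth; apply: cvgMr.
  apply: (cvg_comp (fun y => `|loc y|) (fun r => r ^+ 2)).
    exact: cvg_norm loc_lim.
  exact: exprn_continuous.
apply/ler_addgt0Pr => r r0.
have r30 : 0 < r / 3 by rewrite divr_gt0.
have /(near_dist_lt th) nb : 0 < del - `|a *m u| by rewrite subr_gt0.
near (within N (nbhs th)) => y.
have Ny : N y by near: y; exact: withinT.
have d1 : `|f th - f y| <= r / 3 by near: y; move/cvgrPdist_le: f_lim; exact.
have d2 : `|qcrit D Gam u - qcrit D Gam (loc y)| <= r / 3.
  by near: y; move/cvgrPdist_le: q_lim; exact.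
have d3 : `|p%:R ^+ 2 * e * `|u| ^+ 2 - p%:R ^+ 2 * e * `|loc y| ^+ 2| <= r / 3.
  by near: y; move/cvgrPdist_le: s_lim; exact.
have ydel : `|a *m loc y| < del.
  have : `|th - y| < del - `|a *m u| by near: y; exact: cvg_within nb.
  have -> : a *m loc y = a *m u - (th - y).
    rewrite /loc mulKVmx// /th opprB opprD addrCA; congr (_ + _).
    by rewrite addrC subrK.
  move=> h; rewrite (le_lt_trans (ler_normB _ _))//; lra.
have := @expansion_inner (loc y); rewrite -thloc => /(_ Ny ydel).
move: d1 d2 d3; rewrite !ler_norml => /andP[? ?] /andP[? ?] /andP[? ?] /andP[? ?].
by apply/andP; split; lra.
Unshelve. all: by end_near. Qed.

End local_expansion.

(** * Convergence of the local parameter sets *)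

Section local_sets.
Context {R : realType} {p : nat}.
Variables (a : R -> 'M[R]_p) (Theta : set 'cV[R]_p) (ths : 'cV[R]_p) (TT : set R).
Hypothesis ths_Theta : Theta ths.
Local Notation F := (to_infty TT).
Local Notation UT := (local_set a Theta ths).
Local Notation U := (limit_set a Theta ths TT).

Lemma near_to_infty (Q : R -> Prop) (M : R) :
  (forall T, TT T -> M < T -> Q T) -> \forall T \near F, Q T.
Proof. by move=> MQ; exists M; split; [exact: num_real|move=> T MT TTT; exact: MQ]. Qed.

Lemma to_inftyP (Q : R -> Prop) : (\forall T \near F, Q T) ->
  exists M : nat, (1 <= M)%N /\ forall T, TT T -> M%:R <= T -> Q T.
Proof.
move=> [M [_ MQ]]; exists (Num.truncn M).+1; split => // T TTT MT; apply: MQ => //.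
by rewrite (lt_le_trans _ MT)// truncnS_gt.
Qed.

Lemma enlargeP (A : set 'cV[R]_p) (r : R) x :
  enlarge A r x <-> exists2 y, A y & fnorm (x - y) < r.
Proof.
split=> [/ereal_inf_lt[_ [y Ay <-]]|[y Ay xy]]; first by exists y.
apply: (@le_lt_trans _ _ (fnorm (x - y))%:E); last by rewrite lte_fin.
by apply: ereal_inf_lbound; exists y.
Qed.

Lemma fnorm_lt (x : 'cV[R]_p) r : `|x| < r / (p%:R + 1) -> fnorm x < r.
Proof.
have p1 : 0 < p%:R + 1 :> R by rewrite ltr_wpDl.
rewrite ltr_pdivlMr//; apply: le_lt_trans.
by rewrite (le_trans (fnorm_le _))// muln1 mulrC ler_wpM2l// lerDl.
Qed.

(** [U] is the lower Kuratowski limit of the local parameter sets. *)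
Lemma limit_setP x : U x <-> forall e : R, 0 < e ->
  \forall T \near F, exists2 y, UT T y & `|x - y| < e.
Proof.
split=> [Ux e e0|h e /= e0].
  have [M _ MU] := Ux e e0; apply: (@near_to_infty _ M%:R) => T TTT MT.
  have /enlargeP[y Uy xy] : enlarge (UT T) e x by apply: MU; split => //=; exact: ltW.
  by exists y => //; apply: le_lt_trans xy; exact: fnorm_ge.
have p1 : 0 < p%:R + 1 :> R by rewrite ltr_wpDl.
have /to_inftyP[M [M1 MP]] := h (e / (p%:R + 1)) (divr_gt0 e0 p1).
exists M => // T [TTT MT]; apply/enlargeP.
by have [y Uy xy] := MP T TTT MT; exists y => //; exact: fnorm_lt.
Qed.

Lemma limit_set_closed : closed U.
Proof.
move=> x Ux; apply/limit_setP => e e0.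
have e20 : 0 < e / 2 by rewrite divr_gt0.
have [y [Uy]] := Ux _ (nbhsx_ballx x (e / 2) e20); rewrite -ball_normE /= => xy.
have := (limit_setP y).1 Uy _ e20; apply: filterS => T [z Uz yz].
exists z => //; have -> : x - z = (x - y) + (y - z) by rewrite addrA subrK.
by rewrite (le_lt_trans (ler_normD _ _))//; lra.
Qed.

Lemma limit_set0 : U 0.
Proof.
apply/limit_setP => e e0; apply: filterE => T; exists 0; last by rewrite subrr normr0.
by rewrite /local_set /= mulmx0 addr0.
Qed.

Hypothesis A3 : \bigcap_(M in [set M : nat | (1 <= M)%N])
  closure (\bigcup_(T in TT `&` [set T | M%:R <= T]) UT T) `<=` U.

(** The contrapositive of the inclusion of the upper limit in the lower limit. *)
Lemma notin_limit_set x : ~ U x -> exists2 e : R, 0 < e &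
  \forall T \near F, forall y, UT T y -> e <= `|x - y|.
Proof.
move=> nU; apply: contrapT => h; apply: nU; apply: A3 => M /= M1.
move=> B /nbhs_ballP[e /= e0 eB]; apply: contrapT => nB; apply: h.
exists e => //; apply: (@near_to_infty _ M%:R) => T TTT MT y Uy.
rewrite leNgt; apply/negP => xy; apply: nB; exists y; split.
  by exists T => //; split => //=; exact: ltW.
by apply: eB; rewrite -ball_normE.
Qed.

(** Near a point of U there is nothing to find, and near any other point of the compact
    ball the local sets are eventually empty. *)
Lemma local_set_near n e : 0 < e -> \forall T \near F,
  forall u, UT T u -> `|u| <= n%:R -> exists2 v, U v & `|u - v| < e.
Proof.
move=> e0; have FF := to_infty_filter TT.
pose Q T u := UT T u -> exists2 v, U v & `|u - v| < e.
suff /compact_near_coveringP cov : compact [set u : 'cV[R]_p | `|u| <= n%:R].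
  suff near_x x : [set u : 'cV[R]_p | `|u| <= n%:R] x ->
      \forall y \near x & T \near F, Q T y.
    apply: filterS (cov _ F Q FF near_x) => T QT u Uu un.
    exact: QT.
  move=> _; have [Ux|/notin_limit_set[r r0 rT]] := pselect (U x).
    exists (ball x e, setT); first by split; [exact: nbhsx_ballx|exact: filterT].
    move=> [y T] /= [xy _] _; exists x => //.
    by rewrite distrC; rewrite -ball_normE in xy.
  exists (ball x r, [set T | forall y, UT T y -> r <= `|x - y|]).
    by split; [exact: nbhsx_ballx|exact: rT].
  move=> [y T] /= [xy rTy] Uy; move: (rTy y Uy).
  by rewrite leNgt; rewrite -ball_normE /= in xy; rewrite xy.
exact: closed_ball_mx_compact.
Qed.

(** Each point of U is a limit of points of the local sets; uniformity is compactness. *)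
Lemma limit_set_near n e : 0 < e -> \forall T \near F,
  forall u, truncset U n u -> exists2 v, UT T v & `|u - v| < e.
Proof.
move=> e0; have FF := to_infty_filter TT.
have e20 : 0 < e / 2 by rewrite divr_gt0.
have Uco : compact (truncset U n).
  apply: (@subclosed_compact _ _ [set u | `|u| <= n%:R]).
  - exact: (closedI limit_set_closed (@closed_norm_le _ _ _)).
  - exact: closed_ball_mx_compact.
  - by move=> u [].
move/compact_near_coveringP: Uco => cov.
pose Q T u := exists2 v, UT T v & `|u - v| < e.
suff near_x x : truncset U n x -> \forall y \near x & T \near F, Q T y.
  by apply: filterS (cov _ F Q FF near_x) => T QT u Uu; exact: QT.
move=> [Ux _]; exists (ball x (e / 2), [set T | exists2 y, UT T y & `|x - y| < e / 2]).
  by split; [exact: nbhsx_ballx|exact: (limit_setP x).1].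
move=> [y T] /= [xy [v Uv xv]]; exists v => //.
rewrite -ball_normE /= in xy.
have -> : y - v = (x - v) - (x - y) by rewrite opprB [RHS]addrC addrA subrK.
by rewrite (le_lt_trans (ler_normB _ _))//; lra.
Qed.

End local_sets.

(** * Sign of the rate and measurability of the statistics *)

Section rate_nonneg.
Context {R : realType} {p : nat}.

(** The rate is nonnegative because (A'A)^-1 is a Gram matrix: its eigenvalues
    are nonnegative. *)
Lemma rate_ge0 (a : R -> 'M[R]_p) (T : R) : a T \in unitmx -> 0 <= rate a T.
Proof.
move=> aT; rewrite /rate /lambda_min.
set B := invmx (a T).
have eqB : invmx ((a T)^T *m a T) = B *m B^T.
  apply: (can_inj (mulKmx (_ : (a T)^T *m a T \in unitmx))).
    by rewrite unitmx_mul unitmx_tr aT.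
  rewrite mulmxV ?unitmx_mul ?unitmx_tr ?aT// -mulmxA (mulmxA _ B) mulmxV//.
  by rewrite mul1mx trmx_inv mulmxV// unitmx_tr.
set E := [set l | _].
have E0 l : E l -> 0 <= l.
  move=> /eigenvalueP[v vl v0].
  have vv : 0 < \tr (v *m v^T).
    rewrite tr_mulmx_tr lt_neqAle eq_sym; apply/andP; split; last first.
      by apply: sumr_ge0 => i _; apply: sumr_ge0 => j _; exact: sqr_ge0.
    apply: contra v0 => /eqP h; apply/eqP/matrixP => i j; rewrite mxE.
    move/psumr_eq0P : h => /(_ (fun i _ => sumr_ge0 _ (fun j _ => sqr_ge0 _)) i isT).
    by move/psumr_eq0P => /(_ (fun j _ => sqr_ge0 _) j isT)/eqP; rewrite sqrf_eq0 => /eqP.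
  rewrite -(pmulr_lge0 _ vv) -mxtraceZ scalemxAl -vl eqB.
  have -> : v *m (B *m B^T) *m v^T = (v *m B) *m (v *m B)^T.
    by rewrite trmx_mul !mulmxA.
  rewrite tr_mulmx_tr.
  by apply: sumr_ge0 => i _; apply: sumr_ge0 => j _; exact: sqr_ge0.
have [ne|ne] := pselect (E !=set0); first exact: lb_le_inf.
suff -> : E = set0 by rewrite inf0.
by apply/seteqP; split => // l El; apply: ne; exists l.
Qed.

End rate_nonneg.

Section score_measurable.
Context {R : realType} {d : measure_display} {Om : measurableType d} {p : nat}.
Variables (N : set 'cV[R]_p) (ths : 'cV[R]_p).
Hypothesis N_open : open N.
Hypothesis N_ths : closure N ths.
Variable f : Om -> 'cV[R]_p -> R.
Hypothesis f_meas : forall y, closure N y -> measurable_fun setT (fun w => f w y).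
Hypothesis f_C2 : forall w, C2_closure N (f w).

(** A partial derivative inside N is a pointwise limit of difference quotients. *)
Lemma grad_measurable y i : N y -> measurable_fun setT (fun w => grad (f w) y i 0).
Proof.
move=> Ny; have /nbhs_ballP[r /= r0 rN] : nbhs y N by exact: open_nbhs_nbhs.
have [m0 m0r] := @ltr_add_invr R 0 r r0; rewrite add0r in m0r.
(* The increments are so small that the difference quotients stay inside N. *)
pose t m : R := (m + m0).+1%:R^-1.
have t0 m : 0 < t m by rewrite invr_gt0.
have tr m : t m < r.
  by apply: le_lt_trans m0r; rewrite lef_pV2 ?posrE// ler_nat ltnS leq_addl.
apply: (@measurable_fun_cvg _ _ _ _
  (fun m w => (t m)^-1 * (f w (t m *: unitv i + y) - f w y))) => [m|w _].
  apply: measurable_funM => //; apply: measurable_funB; apply: f_meas.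
    apply: subset_closure; apply: rN; rewrite -ball_normE /= opprD addrCA subrr.
    rewrite addr0 normrN normrZ gtr0_norm//; apply: le_lt_trans (tr m).
    by apply: ler_piMr; [exact: ltW|exact: norm_unitv].
  exact: subset_closure.
rewrite mxE; case: (f_C2 w) => -[fd _ _] _ _ _.
have /cvgrPdist_le := fd y i Ny; rewrite -/('D_(unitv i) (f w) y) => lim.
apply/cvgrPdist_le => e e0; have [del /= del0 delP] := lim e e0.
have [m1 m1del] := @ltr_add_invr R 0 del del0; rewrite add0r in m1del.
near=> m; apply: delP; last by rewrite gt_eqF.
rewrite /= sub0r normrN gtr0_norm// (le_lt_trans _ m1del)// lef_pV2 ?posrE// ler_nat ltnS.
by rewrite (leq_trans _ (leq_addr _ _))//; near: m; exact: nbhs_infty_ge.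
Unshelve. all: by end_near. Qed.

(** The gradient at ths is a limit of gradients at a deterministic sequence in N. *)
Lemma gradc_measurable i : measurable_fun setT (fun w => gradc N (f w) ths i 0).
Proof.
have near_ths k : exists y, N y /\ `|ths - y| < k.+1%:R^-1.
  have k0 : (0 : R) < k.+1%:R^-1 by rewrite invr_gt0.
  have [y [Ny]] := N_ths (nbhsx_ballx ths _ k0); rewrite -ball_normE => yk.
  by exists y.
have [y yP] := choice near_ths.
apply: (@measurable_fun_cvg _ _ _ _ (fun k w => grad (f w) (y k) i 0)) => [k|w _].
  exact: grad_measurable (yP k).1.
case: (f_C2 w) => _ _ eg _.
have lim := extension_cvg eg N_ths.
apply/cvgrPdist_le => e e0.
move/cvgrPdist_le: lim => /(_ e e0) h.
have /nbhs_ballP[r /= r0 rP] : nbhs ths [set z | N z ->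
  `|lim (grad (f w) y @[y --> within N (nbhs ths)]) - grad (f w) z| <= e] by exact: h.
have [m mr] := @ltr_add_invr R 0 r r0; rewrite add0r in mr.
near=> k.
have /rP/(_ (yP k).1) : ball ths r (y k).
  rewrite -ball_normE /= (lt_trans (yP k).2)// (le_lt_trans _ mr)//.
  rewrite lef_pV2 ?posrE// ler_nat ltnS.
  by near: k; exact: nbhs_infty_ge.
apply: le_trans; rewrite -/(gradc N (f w) ths).
by have := mx_coord_le (gradc N (f w) ths - grad (f w) (y k)) i 0; rewrite [X in `|X|]mxE [X in _ + X]mxE.
Unshelve. all: by end_near. Qed.

Lemma score_vec_meas (A : 'M[R]_p) : vec_meas (fun w => A *m gradc N (f w) ths).
Proof.
move=> g cg; apply: measurable_coord_comp => // i j.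
rewrite (_ : (fun w => _) = fun w => \sum_k A i k * gradc N (f w) ths k 0).
  apply: measurable_sum => k; apply: measurable_funM => //.
  exact: gradc_measurable.
by apply/funext => w; rewrite mxE (ord1 j).
Qed.

End score_measurable.

Lemma within_dense_le {R : realType} (V : pseudoMetricType R) (A : set V) (f : V -> R) x c :
  {within A, continuous f} -> A x ->
  (forall e : R, 0 < e -> exists y, [/\ A y, ball x e y & f y <= c]) -> f x <= c.
Proof.
move=> /subspace_continuousP/(_ x) cf Ax h; rewrite leNgt; apply/negP => cx.
have /cvgrPdist_lt := cf Ax; move=> /(_ (f x - c)); rewrite subr_gt0 => /(_ cx) near_x.
have /nbhs_ballP[r /= r0 rP] : nbhs x [set y | A y -> `|f x - f y| < f x - c].
  exact: near_x.
have [y [Ay xy fy]] := h r r0.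
by have := rP y xy Ay; rewrite ltr_norml => /andP[_]; lra.
Qed.

Section fields.
Context {R : realType} {d : measure_display} {Om : measurableType d}.

(** On a compact set a continuous field has measurable exceedance events, through
    a countable dense subset. *)
Lemma exceedance_measurable (V : normedModType R) (A : set V) (X : Om -> V -> R) (c : R) :
  compact A -> (forall x, A x -> measurable_fun setT (X ^~ x)) ->
  (forall w, {within A, continuous (X w)}) ->
  measurable [set w | exists2 x, A x & c < X w x].
Proof.
move=> Aco mX cX; have [[x0 Ax0]|A0] := pselect (A !=set0); last first.
  rewrite [mkset _](_ : _ = set0)//; apply/seteqP; split => // w [x Ax _].
  by apply: A0; exists x.
have [s sA sd] := dense_seq Aco Ax0.
rewrite [mkset _](_ : _ = \bigcup_k [set w | c < X w (s k)]); last first.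
  apply/seteqP; split => [w [x Ax cx]|w [k _ /= ck]]; last by exists (s k).
  apply: contrapT => h; move: cx; rewrite ltNge => /negP; apply.
  apply: (within_dense_le (cX w) Ax) => e e0; have [k xk] := sd x Ax e e0.
  by exists (s k); split => //; rewrite leNgt; apply/negP => ck; apply: h; exists k.
apply: bigcupT_measurable => k; rewrite -[mkset _]setTI.
by apply: measurable_fun_ltr => //; exact: mX.
Qed.

Section two_parameters.
Context {p q : nat}.
Variables (A : set 'cV[R]_p) (B : set 'cV[R]_q) (X : Om -> 'cV[R]_p -> 'cV[R]_q -> R).
Hypothesis Aco : compact A.
Hypothesis Bco : compact B.
Hypothesis X_field : continuous_random_field (A `*` B)
  (fun w (x : 'cV[R]_p * 'cV[R]_q) => X w x.1 x.2).

Lemma field_at_measurable (x : Om -> 'cV[R]_p) (y : Om -> 'cV[R]_q) :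
  (forall w, A (x w)) -> (forall w, B (y w)) ->
  (forall c e, 0 < e -> measurable [set w | ball c e (x w)]) ->
  (forall c e, 0 < e -> measurable [set w | ball c e (y w)]) ->
  measurable_fun setT (fun w => X w (x w) (y w)).
Proof.
move=> xA yB mx my; have ABco := compact_setX Aco Bco.
have net n : exists s : seq ('cV[R]_p * 'cV[R]_q), (forall c, c \in s -> (A `*` B) c) /\
    forall z, (A `*` B) z -> exists2 c, c \in s & ball c n.+1%:R^-1 z.
  by have [|s sA sP] := finite_net (e := n.+1%:R^-1) ABco; [rewrite invr_gt0|exists s].
have [s sP] := choice net.
apply: (@measurable_field _ _ _ _ (A `*` B) (fun w z => X w z.1 z.2)
  (fun w => (x w, y w)) s).
- move=> z ABz; apply: (@borel_comp _ _ _ _ (fun w => X w z.1 z.2) id).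
    exact: X_field.1.
  by move=> r; exact: cvg_id.
- exact: X_field.2.
- by move=> w; split; [exact: xA|exact: yB].
- move=> [c1 c2] e e0; rewrite [mkset _](_ : _ =
      [set w | ball c1 e (x w)] `&` [set w | ball c2 e (y w)])//.
  by apply: measurableI; [exact: mx|exact: my].
- by move=> n c; exact: (sP n).1.
- by move=> w; apply: nearW => n; apply: (sP n).2; split; [exact: xA|exact: yB].
Qed.

(** Maximality over the compact set A is tested on a countable dense subset. *)
Lemma max_event_measurable (x : Om -> 'cV[R]_p) (y : Om -> 'cV[R]_q) :
  (forall w, A (x w)) -> (forall w, B (y w)) -> borel_rv x -> borel_rv y ->
  measurable [set w | (X w (x w) (y w))%:E =
    ereal_sup [set (X w z (y w))%:E | z in A]].
Proof.
move=> xA yB mx my.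
have mbx c e : 0 < e -> measurable [set w | ball c e (x w)].
  by move=> _; apply: (borel_open (B := ball c e) mx); exact: ball_open.
have mby c e : 0 < e -> measurable [set w | ball c e (y w)].
  by move=> _; apply: (borel_open (B := ball c e) my); exact: ball_open.
have [[w0 _]|Om0] := pselect (exists w : Om, True); last first.
  rewrite [mkset _](_ : _ = set0)//; apply/seteqP; split => // w.
  by exfalso; apply: Om0; exists w.
have [s sA sd] := dense_seq Aco (xA w0).
rewrite [mkset _](_ : _ = \bigcap_k [set w | X w (s k) (y w) <= X w (x w) (y w)]).
  apply: bigcapT_measurable => k; rewrite -[mkset _]setTI.
  apply: measurable_fun_ler => //; apply: field_at_measurable => // c e e0.
  have [ce|ce] := pselect (ball c e (s k)).
    by rewrite [mkset _](_ : _ = setT)//; apply/seteqP; split.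
  by rewrite [mkset _](_ : _ = set0)//; apply/seteqP; split.
apply/seteqP; split => w /=.
  by move=> xmax k _ /=; rewrite -lee_fin xmax; apply: ereal_sup_ubound; exists (s k).
move=> xmax; apply/eqP; rewrite eq_le; apply/andP; split.
  by apply: ereal_sup_ubound; exists (x w).
apply: ge_ereal_sup => _ [z Az <-]; rewrite lee_fin.
apply: (@within_dense_le _ _ (A `*` B) (fun z => X w z.1 z.2) (z, y w)).
- exact: X_field.2.
- by split => //; exact: yB.
- move=> e e0; have [k zk] := sd z Az e e0; exists (s k, y w); split.
  - by split; [exact: sA|exact: yB].
  - by split => //; exact: ballxx.
  - exact: xmax.
Qed.

End two_parameters.
End fields.

(** * Consistency and local behaviour of the estimators *)

Section slow_rate.
Context {R : realType} {d : measure_display} {Om : measurableType d}.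
Variables (P : probability Om R) (TT : set R).
Local Notation F := (to_infty TT).

(** A diagonal argument: the rate at T is 1/(n+1) for the largest n <= T such that
    D T exceeds 1/(n+1) with outer probability at most 1/(n+1). *)
Lemma exists_slow_rate (D : R -> Om -> R) :
  (forall r k : R, 0 < r -> 0 < k ->
     ultimately_le P TT k (fun T => [set w | r <= D T w])) ->
  exists del : R -> R, [/\ forall T, 0 < del T, del T @[T --> F] --> (0 : R) &
    forall k : R, 0 < k -> ultimately_le P TT k (fun T => [set w | del T <= D T w])].
Proof.
move=> D0.
pose ok T n := `[< ((P^*)%mu [set w | (n.+1%:R^-1 <= D T w)%R] <= (n.+1%:R^-1)%:E)%E >].
have ok0 T : ok T 0%N.
  apply/asboolP; rewrite invr1; apply: (@le_trans _ _ ((P^*)%mu setT)).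
    exact: le_outer_measure.
  by rewrite measurable_mu_extE// probability_le1.
pose best T : 'I_(Num.truncn T).+1 := [arg max_(n > ord0 | ok T n) n].
pose del T : R := (best T).+1%:R^-1.
have best_ok T : ok T (best T) by rewrite /best; case: arg_maxnP => //; exact: ok0.
have best_max T m : (m <= Num.truncn T)%N -> ok T m -> (m <= best T)%N.
  move=> mT okm; rewrite /best; case: arg_maxnP => [|n _ nmax]; first exact: ok0.
  by have := nmax (Ordinal (mT : (m < (Num.truncn T).+1)%N)) okm.
have del_lim e : 0 < e -> \forall T \near F, del T <= e.
  move=> e0; have [m me] := @ltr_add_invr R 0 e e0; rewrite add0r in me.
  have m0 : (0 : R) < m.+1%:R^-1 by rewrite invr_gt0.
  have big : \forall T \near F, m%:R < T.
    by apply: (@near_to_infty _ _ _ m%:R) => T _.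
  apply: filterS2 big (D0 _ _ m0 m0) => T mT okm.
  rewrite /del (le_trans _ (ltW me))// lef_pV2 ?posrE// ler_nat ltnS.
  have T0 : 0 <= T by rewrite (le_trans _ (ltW mT)).
  by apply: best_max; [rewrite truncn_ge_nat// ltW|exact/asboolP].
exists del; split => [T| |k k0]; first by rewrite invr_gt0.
  apply/cvgrPdist_le => e e0; apply: filterS (del_lim e e0) => T de.
  by rewrite sub0r normrN ger0_norm// invr_ge0.
apply: filterS (del_lim k k0) => T dk; have /asboolP h := best_ok T.
by rewrite (le_trans h)// lee_fin.
Qed.

End slow_rate.

Lemma clip_lip {R : realType} (s t : R) :
  `|Num.min 1 (Num.max 0 s) - Num.min 1 (Num.max 0 t)| <= `|s - t|.
Proof.
have h1 := ler_norm (s - t); have h2 := ler_norm (t - s); rewrite distrC in h2.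
rewrite ler_norml.
by case: (leP 0 s) => hs; case: (leP 0 t) => ht;
  [case: (leP 1 s) => h3; case: (leP 1 t) => h4
  |case: (leP 1 s) => h3; case: (leP (1 : R) 0) => h4
  |case: (leP (1 : R) 0) => h3; case: (leP 1 t) => h4
  |case: (leP (1 : R) 0) => h3]; apply/andP; split; lra.
Qed.

Lemma expansion_ge0 {R : realType} (h1 h0 q b : R) :
  `|h1 - h0 - q| <= b -> h0 <= h1 -> 0 <= q + b.
Proof. by rewrite ler_norml => /andP[_]; lra. Qed.

Lemma expansion_compare {R : realType} (h0 h1 h2 q1 q2 b1 b2 s : R) :
  `|h1 - h0 - q1| <= b1 -> `|h2 - h0 - q2| <= b2 -> h2 <= h1 ->
  b1 <= s -> b2 <= s -> q2 <= q1 + 2 * s.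
Proof. by rewrite !ler_norml => /andP[_ ?] /andP[? _]; lra. Qed.

Lemma six_parts {R : realType} (eta x y : R) : x <= eta / 6 -> y <= eta / 6 ->
  2 * (eta / 6) + 2 * x + 2 * y <= eta.
Proof. by lra. Qed.

Lemma near_compare {R : realType} (eta a1 a2 b1 b2 : R) :
  `|a1 - a2| <= eta / 2 -> `|b1 - b2| <= eta / 2 -> a1 <= b1 -> a2 <= b2 + eta.
Proof. by rewrite !ler_norml => /andP[? ?] /andP[? ?]; lra. Qed.

Section deterministic_bounds.
Context {R : realType} {p : nat}.
Implicit Types (u v D X : 'cV[R]_p) (M : 'M[R]_p).

(** If the criterion is not too negative at u, then the linear term there is at least
    a fraction of the coercive quadratic term, which bounds u. *)
Lemma coercive_bound D M u (c b : R) : 0 < c -> coercive M c -> b <= c / 4 ->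
  0 <= qcrit D M u + b * `|u| ^+ 2 -> `|u| <= 4 * (p%:R * `|D|) / c.
Proof.
move=> c0 cM bc pos; rewrite leNgt; apply/negP; rewrite ltr_pdivrMr// => h.
have D0 : 0 <= p%:R * `|D| by rewrite mulr_ge0.
have u0 : 0 < `|u|.
  rewrite lt_neqAle normr_ge0 andbT eq_sym; apply/eqP => u0.
  by move: h; rewrite u0 mul0r; lra.
have q1 := coercive_qcrit_le D u cM.
have q2 : b * `|u| ^+ 2 <= c / 4 * `|u| ^+ 2 by rewrite ler_wpM2r ?exprn_ge0.
have : `|u| * (p%:R * `|D| - 4^-1 * c * `|u|) < 0.
  by rewrite pmulr_rlt0//; lra.
by lra.
Qed.

Lemma coercive_closed (c : R) : closed [set M : 'M[R]_p | coercive M c].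
Proof.
rewrite [mkset _](_ : _ = \bigcap_(u in [set: 'cV[R]_p])
    [set M : 'M[R]_p | c * `|u| ^+ 2 <= quadf M u]); last first.
  by apply/seteqP; split => M h u; [move=> _; exact: h|exact: h].
apply: closed_bigI => u _.
rewrite (_ : [set _ | _] = (fun M => quadf M u) @^-1` [set r | c * `|u| ^+ 2 <= r])//.
apply: preimage_closed => [M _|]; last exact: closed_ge.
suff : continuous (fun M : 'M[R]_p => quadf M u) by exact.
apply: eps_delta_continuous => x e e0.
have k0 : 0 < p%:R ^+ 2 * `|u| ^+ 2 + 1 :> R.
  by rewrite ltr_wpDl// mulr_ge0// exprn_ge0.
exists (e / (p%:R ^+ 2 * `|u| ^+ 2 + 1)); first by rewrite divr_gt0.
move=> y; rewrite ltr_pdivlMr// -quadfBl; apply: le_lt_trans.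
rewrite (le_trans (quadf_le _ _))// mulrAC mulrC ler_wpM2l// lerDl//.
Qed.

(** Transfer of near-optimality: u nearly beats a point near each point of the
    ball for the criterion with score D; hence a nearby point of U nearly
    maximises the criterion with the nearby score X. *)
Lemma near_max_transfer (U : set 'cV[R]_p) n D X M u v (r eps eps' eta L : R) :
  truncset U n v -> `|u - v| <= eps' -> `|u| <= n%:R + 1 -> eps' <= 1 -> eps' <= eta ->
  `|D - X| <= eps -> p%:R * `|X| + p%:R ^+ 2 * `|M| * (n%:R + 1) <= L ->
  (forall u2, truncset U n u2 -> exists2 u3, `|u2 - u3| <= eps' &
     qcrit D M u3 <= qcrit D M u + r) ->
  r + 2 * (p%:R * eps * (n%:R + 1)) + 2 * (L * eps') <= eta ->
  near_max U n eta X M u.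
Proof.
move=> Kv uv un eps'1 eps'eta DX LX h tot; exists v => //; split.
  exact: le_trans uv _.
move=> u2 Ku2; have [u3 u23 q3] := h u2 Ku2.
have vn : `|v| <= n%:R + 1 by rewrite (le_trans Kv.2)// lerDl.
have u2n : `|u2| <= n%:R + 1 by rewrite (le_trans Ku2.2)// lerDl.
have u3n : `|u3| <= n%:R + 1.
  have -> : u3 = u2 - (u2 - u3) by rewrite subKr.
  by rewrite (le_trans (ler_normB _ _))// lerD//; [exact: Ku2.2|exact: le_trans u23 _].
have lip x y : `|x| <= n%:R + 1 -> `|y| <= n%:R + 1 -> `|x - y| <= eps' ->
    `|qcrit X M x - qcrit X M y| <= L * eps'.
  move=> xn yn xy; rewrite (le_trans (qcrit_lip _ _ xn yn))//; apply: ler_pM => //.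
have par x : `|x| <= n%:R + 1 -> `|qcrit D M x - qcrit X M x| <= p%:R * eps * (n%:R + 1).
  move=> xn; rewrite (le_trans (qcrit_lip_score _ _ _ xn))// ler_wpM2r ?addr_ge0//.
  by rewrite ler_wpM2l.
have := lip _ _ u2n u3n u23; have := lip _ _ un vn uv.
have := par _ u3n; have := par _ un.
rewrite !ler_norml => /andP[? ?] /andP[? ?] /andP[? ?] /andP[? ?].
by lra.
Qed.

End deterministic_bounds.

Section estimators.
Context {R : realType} {d : measure_display} {Om : measurableType d}.
Variable P : probability Om R.
Variables (G : set (set Om)) (p q : nat).
Hypothesis G_sigma : sigma_algebra [set: Om] G.
Hypothesis G_sub : G `<=` @measurable d Om.
Variables (Theta : set 'cV[R]_p) (Tau : set 'cV[R]_q).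
Hypothesis Theta_compact : compact Theta.
Hypothesis Tau_compact : compact Tau.
Variables (TT : set R) (ths : 'cV[R]_p).
Hypothesis ths_Theta : Theta ths.
Variables (N : set 'cV[R]_p) (H : R -> Om -> 'cV[R]_p -> 'cV[R]_q -> R).
Hypothesis H_field : forall T, TT T -> continuous_random_field (Theta `*` Tau)
  (fun w (x : 'cV[R]_p * 'cV[R]_q) => H T w x.1 x.2).
Hypothesis N_open : open N.
Hypothesis N_nbhs : exists2 delta : R, 0 < delta &
  Theta `&` [set th | fnorm (th - ths) < delta] `<=` closure N.
Hypothesis N_star : forall th (t : R), N th -> 0 < t -> t <= 1 ->
  N (t *: th + (1 - t) *: ths).
Hypothesis H_ext_field : forall T, TT T -> continuous_random_field (closure N `*` Tau)
  (fun w (x : 'cV[R]_p * 'cV[R]_q) => H T w x.1 x.2).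
Hypothesis H_C2 : forall T w tau, TT T -> Tau tau ->
  C2_closure N (fun th => H T w th tau).
Variable tauh : R -> Om -> 'cV[R]_q.
Hypothesis tauh_rv : forall T, TT T -> borel_rv (tauh T).
Hypothesis tauh_Tau : forall T w, TT T -> Tau (tauh T w).
Variable thh : R -> Om -> 'cV[R]_p.
Hypothesis thh_rv : forall T, TT T -> borel_rv (thh T).
Hypothesis thh_Theta : forall T w, TT T -> Theta (thh T w).
Let max_event T := [set w | (H T w (thh T w) (tauh T w))%:E =
  ereal_sup [set (H T w th (tauh T w))%:E | th in Theta]].
Hypothesis thh_max : P (max_event T) @[T --> to_infty TT] --> 1%E.
Variable a : R -> 'M[R]_p.
Hypothesis a_unit : forall T, TT T -> a T \in unitmx.
Hypothesis a_cvg0 : fnorm (a T) @[T --> to_infty TT] --> (0 : R).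
Local Notation F := (to_infty TT).
Local Notation U := (limit_set a Theta ths TT).
Local Notation ulocal T w := (invmx (a T) *m (thh T w - ths)).

Lemma ths_closure : closure N ths.
Proof.
have [del del0 h] := N_nbhs; apply: h; split => //=.
by rewrite subrr (le_lt_trans (fnorm_le _))// normr0 mulr0.
Qed.

Lemma max_event_ultimately k : 0 < k -> ultimately_le P TT k (fun T => ~` max_event T).
Proof.
move=> k0; have /fine_cvgP[_ /cvgrPdist_le/(_ _ k0)] := thh_max.
apply: filterS2 (near_index TT) => T TTT h.
have mE : measurable (max_event T).
  apply: (max_event_measurable Theta_compact Tau_compact (H_field TTT)).
  - by move=> w; exact: thh_Theta.
  - by move=> w; exact: tauh_Tau.
  - exact: thh_rv.
  - exact: tauh_rv.
rewrite measurable_mu_extE; last exact: measurableC.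
rewrite (_ : _ (~` _) = (1 - P (max_event T))%E); last exact: probability_setC.
rewrite -[P (max_event T)]fineK ?fin_num_measure// -EFinB lee_fin.
by apply: le_trans h; rewrite ler_norm.
Qed.

Lemma max_event_ge T w th : max_event T w -> Theta th ->
  H T w th (tauh T w) <= H T w (thh T w) (tauh T w).
Proof. by rewrite -lee_fin => -> Tth; apply: ereal_sup_ubound; exists th. Qed.

Section consistency.
Variable Y : Om -> 'cV[R]_p -> R.
Hypothesis Y_field : continuous_random_field Theta Y.
Hypothesis B1_cvg : cvg_proba0 P TT (fun T w => ereal_sup
  [set `|YY a ths H T w x.1 x.2 - Y w x.1|%:E | x in Theta `*` Tau]).
Hypothesis B1_neg : {ae P, forall w, forall th, Theta th -> th != ths -> Y w th < 0}.

(** Off a small event the limit field is bounded away from 0 outside the ball of radius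
    r, by compactness. The normalised contrast at the estimator is nonnegative, since
    ths is a competitor and the rate is nonnegative; being uniformly close to the limit
    field, it keeps the estimator inside the ball. *)
Lemma consistency r k : 0 < r -> 0 < k ->
  ultimately_le P TT k (fun T => [set w | r <= `|thh T w - ths|]).
Proof.
move=> r0 k0; have k30 : 0 < k / 3 by rewrite divr_gt0.
pose K := Theta `&` [set th | r <= `|th - ths|].
have Kco : compact K.
  apply: (@subclosed_compact _ _ Theta) => //; last by move=> x [].
  apply: closedI; first exact: compact_closed.
  rewrite (_ : [set _ | _] = (fun x => `|x - ths|) @^-1` [set y | r <= y])//.
  apply: preimage_closed => [x _|]; last exact: closed_ge.
  suff : continuous (fun x : 'cV[R]_p => `|x - ths|) by exact.
  apply: norm_lip_continuous => y z; rewrite (le_trans (ler_dist_dist _ _))//.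
  by rewrite opprB addrA subrK.
have Ycont w : {within K, continuous (Y w)}.
  by apply: continuous_subspaceW (Y_field.2 w) => x [].
pose E (m : nat) := [set w | exists2 th, K th & - m.+1%:R^-1 < Y w th].
have [|||m mk] := @decreasing_outer_small _ _ _ P E _ _ _ _ k30.
- move=> m; apply: exceedance_measurable => // x [Tx _].
  by apply: (@borel_comp _ _ _ _ (fun w => Y w x) id); [exact: Y_field.1|move=> ?; exact: cvg_id].
- move=> m n mn w [th Kth nY]; exists th => //; apply: le_lt_trans nY.
  by rewrite lerN2 lef_pV2 ?posrE// ler_nat.
- apply: filterS B1_neg => w Yneg.
  have [K0|K0] := pselect (K !=set0); last by exists 0%N => -[th Kth _]; apply: K0; exists th.
  have [th /set_mem Kth thmax] := compact_EVT_max K0 Kco (Ycont w).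
  have Y0 : Y w th < 0.
    apply: Yneg; first exact: Kth.1.
    by apply/eqP => e; have := Kth.2; rewrite /= e subrr normr0 leNgt r0.
  have Y1 : 0 < - Y w th by rewrite oppr_gt0.
  have [m mY] := @ltr_add_invr R 0 _ Y1; rewrite add0r in mY.
  exists m => -[th' Kth' h]; have := thmax th' (mem_set Kth').
  by rewrite leNgt => /negP; apply; apply: lt_trans h; rewrite ltrNr.
have e0 : (0 : R) < m.+2%:R^-1 by rewrite invr_gt0.
have B1 := (cvg_proba0P _ _ _).1 B1_cvg _ _ e0 k30.
have -> : k = k / 3 + k / 3 + k / 3 by field.
apply: ultimately_leS (ultimately_leU (ultimately_leU (ultimately_le_cst TT mk)
  (max_event_ultimately k30)) B1) _.
apply: filterS (near_index TT) => T TTT w /= rw.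
apply: contrapT => /not_orP[/not_orP[nE /contrapT maxw]] /negP; rewrite -leNgt => supw.
apply: nE; exists (thh T w); first by split => //=; exact: thh_Theta.
have YYge : 0 <= YY a ths H T w (thh T w) (tauh T w).
  rewrite /YY mulr_ge0// ?invr_ge0 ?rate_ge0 ?a_unit//.
  by rewrite subr_ge0; exact: max_event_ge.
have dist : `|YY a ths H T w (thh T w) (tauh T w) - Y w (thh T w)| <= m.+2%:R^-1.
  rewrite -lee_fin; apply: le_trans supw; apply: le_trans (lee_abs _).
  apply: ereal_sup_ubound; exists (thh T w, tauh T w) => //.
  by split; [exact: thh_Theta|exact: tauh_Tau].
have lt12 : (m.+2%:R^-1 : R) < m.+1%:R^-1 by rewrite ltf_pV2 ?posrE// ltr_nat.
move: dist lt12; set x2 := m.+2%:R^-1; set x1 := m.+1%:R^-1.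
by rewrite ler_norml => /andP[_ dist] lt12; lra.
Qed.

End consistency.

Variables (Delta : Om -> 'cV[R]_p) (Gamma : Om -> 'M[R]_p).
Hypothesis Delta_rv : borel_rv Delta.
Hypothesis Gamma_G : measurable_wrt G Gamma.
Variable tau0 : 'cV[R]_q.
Hypothesis tau0_Tau : Tau tau0.
Let D T w := score a N ths H T w (tauh T w).
Let X T w := score a N ths H T w tau0.
Hypothesis score_diff : cvg_proba0 P TT (fun T w => ereal_sup
  [set (fnorm (score a N ths H T w tau - score a N ths H T w tau0))%:E | tau in Tau]).
Hypothesis score_stable : cvg_stable P TT G X Delta.
Hypothesis B2_hess : forall delta : R -> R, (forall T, TT T -> 0 < delta T) ->
  delta T @[T --> F] --> (0 : R) ->
  cvg_proba0 P TT (fun T w => ereal_sup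
    [set (fnorm (scaled_hess a N H T w x.1 x.2 + Gamma w))%:E
      | x in [set x : 'cV[R]_p * 'cV[R]_q |
          [/\ closure N x.1, Tau x.2 & fnorm (x.1 - ths) < delta T]]]).
Hypothesis Gamma_pos : {ae P, forall w, posdef (Gamma w)}.
Hypothesis A3 : \bigcap_(M in [set M : nat | (1 <= M)%N])
  closure (\bigcup_(T in TT `&` [set T | M%:R <= T]) local_set a Theta ths T) `<=` U.
Hypothesis thh_cons : forall r k : R, 0 < r -> 0 < k ->
  ultimately_le P TT k (fun T => [set w | r <= `|thh T w - ths|]).

Lemma score_meas T : TT T -> vec_meas (X T).
Proof.
move=> TTT; apply: (score_vec_meas N_open ths_closure
  (f := fun w th => H T w th tau0)) => [y Ny|w]; last exact: H_C2.
apply: (@borel_comp _ _ _ _ (fun w => H T w y tau0) id); last by move=> r; exact: cvg_id.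
exact: ((H_ext_field TTT).1 (y, tau0) (conj Ny tau0_Tau)).
Qed.

(** Convergence in law, that is with Z = 1, tested on a continuous version of the
    indicator of a large norm. *)
Lemma score_tight k : 0 < k -> exists L : R, 0 <= L /\
  ultimately_le P TT k (fun T => [set w | L < `|X T w|]).
Proof.
move=> k0; have k20 : 0 < k / 2 by rewrite divr_gt0.
have [n nP] := borel_tight P Delta_rv k20.
exists (n%:R + 1); split; first by rewrite addr_ge0.
pose f (x : 'cV[R]_p) : R := Num.min 1 (Num.max 0 (`|x| - n%:R)).
have f0 x : 0 <= f x by rewrite le_min ler01 le_max lexx.
have f1 x : f x <= 1 by rewrite ge_min lexx.
have fn x : `|f x| <= 1 by rewrite ger0_norm.
have cf : continuous f.
  apply: norm_lip_continuous => x y; apply: le_trans (ler_dist_dist x y).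
  have := clip_lip (`|x| - n%:R) (`|y| - n%:R).
  by rewrite (_ : _ - n%:R - _ = `|x| - `|y|); last lra.
have bf : exists M, forall x, `|f x| <= M by exists 1.
have b1 := bounded_wrtG_cst G_sigma (1 : R).
have lim := stable_Ex G_sub score_meas Delta_rv score_stable cf bf b1.
have bfY (Z : Om -> 'cV[R]_p) : vec_meas Z -> bounded_meas (fun w => f (Z w)).
  by move=> mZ; split; [exact: mZ|exists 1].
have ExDelta : Ex P (fun w => f (Delta w) * 1) <= k / 2.
  rewrite (_ : (fun w => f (Delta w) * 1) = fun w => f (Delta w)); last first.
    by apply/funext => w; rewrite mulr1.
  have -> : k / 2 = Ex P (fun=> 0) + 0 + 1 * (k / 2) by rewrite Ex_cst; lra.
  apply: Ex_le_outer => //.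
  - exact/bfY/(Delta_meas Delta_rv).
  - exact: bounded_meas_cst.
  - by move=> w; rewrite add0r.
  - apply: le_trans (nP n (leqnn n)); apply: le_outer_measure => w /=.
    rewrite addr0 /f lt_min => /andP[_]; rewrite lt_max ltxx /=.
    by rewrite subr_gt0.
move/cvgrPdist_le: lim => /(_ _ k20); apply: filterS2 (near_index TT) => T TTT near_lim.
have ExX : Ex P (fun w => f (X T w)) <= k.
  rewrite (_ : (fun w => f (X T w)) = fun w => f (X T w) * 1); last first.
    by apply/funext => w; rewrite mulr1.
  by move: near_lim; rewrite ler_distl => /andP[+ _]; lra.
have := markov_outer P (bfY _ (score_meas TTT)) (fun w => f0 (X T w)) ltr01.
rewrite divr1 => mk; apply: (@le_trans _ _ (Ex P (fun w => f (X T w)))%:E); last first.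
  by rewrite lee_fin.
apply: le_trans mk; apply: le_outer_measure => w /= Xw.
by rewrite /f le_min lexx le_max; apply/orP; right; lra.
Qed.

Lemma coercive_ultimately k : 0 < k -> exists2 c : R, 0 < c &
  ((P^*)%mu [set w | ~ coercive (Gamma w) c] <= k%:E)%E.
Proof.
move=> k0; have mG := Gamma_rv G_sub Gamma_G.
have [|||m mk] := @decreasing_outer_small _ _ _ P
  (fun m => [set w | ~ coercive (Gamma w) m.+1%:R^-1]) k _ _ _ k0.
- move=> m; apply: measurableC.
  exact: (borel_closed (B := [set M | coercive M m.+1%:R^-1]) mG (@coercive_closed _ _ _)).
- move=> m n mn w /= nc cm; apply: nc => u; apply: le_trans (cm u).
  by rewrite ler_wpM2r ?exprn_ge0// lef_pV2 ?posrE// ler_nat.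
- apply: filterS Gamma_pos => w /posdef_coercive[c c0 cw].
  have [m mc] := @ltr_add_invr R 0 c c0; rewrite add0r in mc.
  exists m => /= h; apply: h => u; apply: le_trans (cw u).
  by rewrite ler_wpM2r ?exprn_ge0// ltW.
by exists m.+1%:R^-1; rewrite ?invr_gt0.
Qed.

Lemma score_close e k : 0 < e -> 0 < k ->
  ultimately_le P TT k (fun T => [set w | e < `|D T w - X T w|]).
Proof.
move=> e0 k0; have := (cvg_proba0P _ _ _).1 score_diff _ _ e0 k0.
move=> h; apply: ultimately_leS h _; apply: filterS (near_index TT) => T TTT w /= ew.
apply: lt_le_trans (lee_abs _); apply: (@lt_le_trans _ _ (fnorm (D T w - X T w))%:E).
  by rewrite lte_fin (lt_le_trans ew)// fnorm_ge.
by apply: ereal_sup_ubound; exists (tauh T w) => //; exact: tauh_Tau.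
Qed.

Lemma a_norm_cvg0 : `|a T| @[T --> F] --> (0 : R).
Proof.
have FF := to_infty_filter TT.
apply: (@squeeze_cvgr _ _ _ _ (fun=> 0) (fun T => fnorm (a T))) => //.
  by apply: nearW => T; rewrite normr_ge0 fnorm_ge.
exact: cvg_cst.
Qed.

(** A radius that exceeds both the slow rate at which the estimator is consistent and
    the image under a_T of the ball of radius n + 1 in the local coordinate. *)
Let radius (del : R -> R) n T := del T + p%:R * (n%:R + 1) * `|a T|.

Lemma radius_cvg0 (del : R -> R) n : del T @[T --> F] --> (0 : R) ->
  radius del n T @[T --> F] --> (0 : R).
Proof.
move=> dlim; have FF := to_infty_filter TT.
rewrite -[X in _ --> X]addr0; apply: cvgD => //.
rewrite -[X in _ --> X](mulr0 (p%:R * (n%:R + 1))); apply: cvgMr.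
exact: a_norm_cvg0.
Qed.

Lemma hess_ultimately (del : R -> R) n e k : (forall T, 0 < del T) ->
  del T @[T --> F] --> (0 : R) -> 0 < e -> 0 < k ->
  ultimately_le P TT k (fun T => [set w | ~ forall x, closure N x ->
    `|x - ths| < radius del n T ->
    `|scaled_hess a N H T w x (tauh T w) + Gamma w| <= e]).
Proof.
move=> del0 dlim e0 k0; have FF := to_infty_filter TT.
have rad0 T : 0 < radius del n T by rewrite ltr_wpDr// !mulr_ge0.
have p1 : 0 < p%:R + 1 :> R by rewrite ltr_wpDl.
have dpos T : TT T -> 0 < radius del n T * (p%:R + 1) by move=> _; rewrite mulr_gt0.
have dcvg : radius del n T * (p%:R + 1) @[T --> F] --> (0 : R).
  by rewrite -[X in _ --> X](mul0r (p%:R + 1)); apply: cvgMl; exact: radius_cvg0.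
have h := (cvg_proba0P _ _ _).1 (B2_hess dpos dcvg) _ _ e0 k0.
apply: ultimately_leS h _; apply: filterS (near_index TT) => T TTT w /= nh.
rewrite ltNge; apply/negP => supe; apply: nh => x Nx xr.
rewrite -lee_fin; apply: le_trans supe; apply: le_trans (lee_abs _).
apply: (@le_trans _ _ (fnorm (scaled_hess a N H T w x (tauh T w) + Gamma w))%:E).
  by rewrite lee_fin fnorm_ge.
apply: ereal_sup_ubound; exists (x, tauh T w) => //; split => //=.
  exact: tauh_Tau.
by apply: fnorm_lt; rewrite mulfK// gt_eqF.
Qed.

Lemma score_expansion T w (u : 'cV[R]_p) (e rad : R) : TT T ->
  (forall x, closure N x -> `|x - ths| < rad ->
    `|scaled_hess a N H T w x (tauh T w) + Gamma w| <= e) ->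
  closure N (ths + a T *m u) -> `|a T *m u| < rad ->
  `|H T w (ths + a T *m u) (tauh T w) - H T w ths (tauh T w) - qcrit (D T w) (Gamma w) u|
    <= p%:R ^+ 2 * e * `|u| ^+ 2.
Proof.
move=> TTT hess.
have C2 : C2_closure N (fun th => H T w th (tauh T w)) by apply: H_C2 => //; exact: tauh_Tau.
exact: (@local_expansion _ _ N ths N_open N_star ths_closure _ C2 (a T) (Gamma w) rad e
  (a_unit TTT) hess).
Qed.

Lemma ulocalK T w : TT T -> ths + a T *m ulocal T w = thh T w.
Proof. by move=> TTT; rewrite mulKVmx ?a_unit// addrC subrK. Qed.

(** Comparing with ths, the expansion and the coercivity of Gamma bound the estimator in
    the local coordinate. Comparing with the other points of the local set, it nearly
    maximises the quadratic criterion there, hence over a ball of U, since the local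
    set and U are close to each other on balls. *)
Lemma estimator_asymptotic_maximiser :
  asymptotic_maximiser P TT X Gamma U (fun T w => ulocal T w).
Proof.
move=> k k0; have k70 : 0 < k / 7 by rewrite divr_gt0.
have [c c0 cP] := coercive_ultimately k70.
have [L1 [L10 L1P]] := score_tight k70.
have [n2 /(_ n2 (leqnn _)) L2P] := borel_tight P (Gamma_rv G_sub Gamma_G) k70.
have [del [del0 dlim delP]] := exists_slow_rate thh_cons.
(* The bound of [coercive_bound] for a score of norm at most L1 + 1. *)
pose B := 4 * (p%:R * (L1 + 1)) / c.
exists (Num.truncn B).+2 => n nB eta eta0.
have Bn : B + 1 <= n%:R.
  apply: (@le_trans _ _ (Num.truncn B).+2%:R); last by rewrite ler_nat.
  by rewrite -natr1 lerD2r ltW// truncnS_gt.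
pose r1 := (n%:R + 1 : R).
have r10 : 0 <= r1 by rewrite addr_ge0.
(* The Lipschitz constant of the criterion in u on the ball of radius n + 1. *)
pose L := p%:R * L1 + p%:R ^+ 2 * n2%:R * r1.
have L0 : 0 <= L by rewrite /L addr_ge0// !mulr_ge0// exprn_ge0.
pose q1 := p%:R ^+ 2 * r1 ^+ 2 + 1; pose q2 := p%:R * r1 + 1.
have p20 : 0 < p%:R ^+ 2 + 1 :> R by rewrite ltr_wpDl// exprn_ge0.
have q10 : 0 < q1 by rewrite ltr_wpDl// mulr_ge0// exprn_ge0.
have q20 : 0 < q2 by rewrite ltr_wpDl// mulr_ge0.
have L10' : 0 < L + 1 by rewrite ltr_wpDl.
have eta60 : 0 < eta / 6 by rewrite divr_gt0.
(* Tolerances for the Hessian, for the score, and for passing between the local set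
   and U: each of the six errors that add up below is at most eta / 6. *)
pose e := Num.min (c / 4 / (p%:R ^+ 2 + 1)) (eta / 6 / q1).
pose eps := Num.min 1 (eta / 6 / q2).
pose eps' := Num.min 1 (Num.min eta (eta / 6 / (L + 1))).
have e0 : 0 < e by rewrite lt_min !divr_gt0.
have eps0 : 0 < eps by rewrite lt_min ltr01 divr_gt0.
have eps'0 : 0 < eps' by rewrite lt_min ltr01 lt_min eta0 divr_gt0.
have e_c : p%:R ^+ 2 * e <= c / 4.
  apply: (@le_trans _ _ (e * (p%:R ^+ 2 + 1))).
    by rewrite mulrC ler_wpM2l ?(ltW e0)// lerDl.
  by rewrite -ler_pdivlMr// ge_min lexx.
have e_eta : p%:R ^+ 2 * e * r1 ^+ 2 <= eta / 6.
  apply: (@le_trans _ _ (e * q1)).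
    by rewrite mulrAC mulrC ler_wpM2l ?(ltW e0)// /q1 lerDl.
  by rewrite -ler_pdivlMr// ge_min lexx orbT.
have eps_eta : p%:R * eps * r1 <= eta / 6.
  apply: (@le_trans _ _ (eps * q2)).
    by rewrite mulrAC mulrC ler_wpM2l ?(ltW eps0)// /q2 lerDl.
  by rewrite -ler_pdivlMr// ge_min lexx orbT.
have eps1 : eps <= 1 by rewrite ge_min lexx.
have eps'1 : eps' <= 1 by rewrite ge_min lexx.
have eps'eta : eps' <= eta by rewrite ge_min ge_min lexx orbT.
have eps'L : L * eps' <= eta / 6.
  apply: (@le_trans _ _ (eps' * (L + 1))).
    by rewrite mulrC ler_wpM2l ?(ltW eps'0)// lerDl.
  by rewrite -ler_pdivlMr// ge_min ge_min lexx !orbT.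
have [d1 d10 nbhsN] := N_nbhs.
have p1 : 0 < p%:R + 1 :> R by rewrite ltr_wpDl.
have rad_small : \forall T \near F, radius del n T < d1 / (p%:R + 1).
  have FF := to_infty_filter TT.
  have d1p : 0 < d1 / (p%:R + 1) by rewrite divr_gt0.
  move/cvgrPdist_lt: (radius_cvg0 n dlim) => /(_ _ d1p); apply: filterS => T.
  by rewrite sub0r normrN; apply: le_lt_trans; exact: ler_norm.
have tot : k / 7 + k / 7 + k / 7 + k / 7 + k / 7 + k / 7 + k / 7 = k by field.
rewrite -tot.
apply: ultimately_leS (ultimately_leU (ultimately_leU (ultimately_leU (ultimately_leU
  (ultimately_leU (ultimately_leU (ultimately_le_cst TT cP) L1P)
   (ultimately_le_cst TT L2P)) (delP _ k70)) (max_event_ultimately k70))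
   (score_close eps0 k70)) (hess_ultimately n del0 dlim e0 k70)) _.
have near_in := @local_set_near R p a Theta ths TT A3 n eps' eps'0.
have near_out := @limit_set_near R p a Theta ths TT n eps' eps'0.
apply: filterS (filterI (filterI near_in near_out) (filterI rad_small (near_index TT))).
move=> T [[inT outT] [radT TTT]] w /= nmax; apply: contrapT.
move=> /not_orP[/not_orP[/not_orP[/not_orP[/not_orP[/not_orP[/contrapT cw
  /negP + ] /negP +] /negP +] /contrapT maxw] /negP +] /contrapT hess].
rewrite -!leNgt -ltNge => X_L1 G_L2 th_del DX.
apply: nmax; set u := ulocal T w.
have thE : ths + a T *m u = thh T w by exact: ulocalK.
have in_N th : Theta th -> `|th - ths| < radius del n T -> closure N th.
  move=> Tth thr; apply: nbhsN; split => //=; apply: fnorm_lt.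
  exact: lt_trans radT.
have C0 : 0 <= p%:R * (n%:R + 1) * `|a T| by rewrite !mulr_ge0.
have u_rad : `|a T *m u| < radius del n T.
  rewrite mulKVmx ?a_unit//; apply: lt_le_trans th_del _.
  by rewrite lerDl.
have u_exp := @score_expansion T w u e _ TTT hess.
have {}u_exp : `|H T w (thh T w) (tauh T w) - H T w ths (tauh T w) -
    qcrit (D T w) (Gamma w) u| <= p%:R ^+ 2 * e * `|u| ^+ 2.
  rewrite -thE; apply: u_exp => //; rewrite thE; apply: in_N; first exact: thh_Theta.
  by rewrite -thE addrAC subrr add0r.
have D_L1 : `|D T w| <= L1 + 1.
  have -> : D T w = X T w + (D T w - X T w) by rewrite addrC subrK.
  by rewrite (le_trans (ler_normD _ _))// lerD// (le_trans DX).
have uB : `|u| <= B.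
  have pos := expansion_ge0 u_exp (max_event_ge maxw ths_Theta).
  apply: le_trans (coercive_bound c0 cw e_c pos) _.
  rewrite /B ler_wpM2r ?invr_ge0 ?(ltW c0)// ler_wpM2l// ler_wpM2l//.
have un : `|u| <= n%:R by rewrite (le_trans uB)// (le_trans _ Bn)// lerDl.
have ur1 : `|u| <= r1 by rewrite (le_trans un)// lerDl.
have [v Uv uv] : exists2 v, U v & `|u - v| < eps'.
  by apply: inT => //; rewrite /local_set /= thE; exact: thh_Theta.
have vn : `|v| <= n%:R.
  have -> : v = u - (u - v) by rewrite subKr.
  rewrite (le_trans (ler_normB _ _))// (le_trans _ Bn)// lerD//.
  by rewrite (le_trans (ltW uv)).
have u2_le : p%:R ^+ 2 * e * `|u| ^+ 2 <= eta / 6.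
  apply: le_trans e_eta; rewrite ler_wpM2l ?mulr_ge0 ?exprn_ge0 ?(ltW e0)//.
  by rewrite lerXn2r ?nnegrE.
apply: (@near_max_transfer _ _ U n (D T w) (X T w) (Gamma w) u v (2 * (eta / 6)) eps eps' eta L) => //.
- exact: ltW.
- rewrite /L lerD// -/r1.
    by rewrite ler_wpM2l.
  by rewrite ler_wpM2r// ler_wpM2l// exprn_ge0.
- move=> u2 Ku2; have [u3 Uu3 u23] := outT u2 Ku2.
  exists u3; first exact: ltW.
  have u3n : `|u3| <= r1.
    have -> : u3 = u2 - (u2 - u3) by rewrite subKr.
    rewrite (le_trans (ler_normB _ _))// lerD//; first exact: Ku2.2.
    exact: le_trans (ltW u23) _.
  have u3_rad : `|a T *m u3| < radius del n T.
    rewrite (le_lt_trans (mulmx_norm_le _ _))// /radius ltr_pwDl//.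
    by rewrite mulrAC ler_wpM2r// ler_wpM2l.
  have u3_N : closure N (ths + a T *m u3).
    by apply: in_N => //; rewrite addrAC subrr add0r.
  have u3_exp := score_expansion TTT hess u3_N u3_rad.
  have u3_le : p%:R ^+ 2 * e * `|u3| ^+ 2 <= eta / 6.
    apply: le_trans e_eta; rewrite ler_wpM2l ?mulr_ge0 ?exprn_ge0 ?(ltW e0)//.
    by rewrite lerXn2r ?nnegrE.
  exact: expansion_compare u_exp u3_exp (max_event_ge maxw Uu3) u2_le u3_le.
- exact: six_parts eps_eta eps'L.
Qed.

(** An exact maximiser for the score at the nuisance estimator nearly maximises the
    criterion with the nearby score at tau0; tightness confines it to a ball. *)
Lemma limit_maximiser_asymptotic_maximiser (T0 : R) (vh : R -> Om -> 'cV[R]_p) :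
  (forall T, TT T -> T0 <= T -> borel_rv (vh T)) ->
  (forall T w, TT T -> T0 <= T -> U (vh T w)) ->
  (forall T, TT T -> T0 <= T -> {ae P, forall w,
     (ZZ (D T w) (Gamma w) (vh T w))%:E =
     ereal_sup [set (ZZ (D T w) (Gamma w) u)%:E | u in U]}) ->
  tight P (TT `&` [set T | T0 <= T]) vh ->
  asymptotic_maximiser P TT X Gamma U vh.
Proof.
move=> vh_rv vh_U vh_max vh_tight k k0; have k30 : 0 < k / 3 by rewrite divr_gt0.
have [K Kco KP] := vh_tight _ k30.
have [M [_ /(_ (M + 1))]] := compact_bounded Kco; rewrite ltrDl ltr01 => /(_ isT) KM.
exists (Num.truncn (M + 1)).+1 => n nM eta eta0.
have Mn : M + 1 <= n%:R.
  by rewrite (@le_trans _ _ (Num.truncn (M + 1)).+1%:R) ?ler_nat// ltW// truncnS_gt.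
pose q2 := p%:R * n%:R + 1 : R.
have q20 : 0 < q2 by rewrite ltr_wpDl// mulr_ge0.
pose eps := eta / 2 / q2.
have eps0 : 0 < eps by rewrite !divr_gt0.
have eps_eta : p%:R * eps * n%:R <= eta / 2.
  apply: (@le_trans _ _ (eps * q2)); last by rewrite divfK// gt_eqF.
  by rewrite mulrAC mulrC ler_wpM2l ?(ltW eps0)// /q2 lerDl.
have late : \forall T \near F, T0 <= T.
  by apply: (@near_to_infty _ _ _ T0) => T _ /ltW.
have outK : ultimately_le P TT (k / 3) (fun T => vh T @^-1` (~` K)).
  apply: filterS (filterI late (near_index TT)) => T [T0T TTT].
  rewrite measurable_mu_extE; first by apply: KP; split.
  apply: (borel_open (vh_rv _ TTT T0T)); apply: closed_openC.
  exact: compact_closed.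
have not_max : ultimately_le P TT 0 (fun T => [set w |
    ~ (ZZ (D T w) (Gamma w) (vh T w))%:E =
      ereal_sup [set (ZZ (D T w) (Gamma w) u)%:E | u in U]]).
  apply: filterS (filterI late (near_index TT)) => T [T0T TTT].
  by rewrite (ae_outer (vh_max T TTT T0T)).
apply: (@ultimately_le_weaken _ _ _ _ _ (k / 3 + k / 3 + 0)); first by lra.
apply: ultimately_leS (ultimately_leU (ultimately_leU outK (score_close eps0 k30)) not_max) _.
apply: filterS (filterI late (near_index TT)) => T [T0T TTT] w /= nmax.
apply: contrapT => /not_orP[/not_orP[/contrapT Kw /negP +] /contrapT maxw].
rewrite -leNgt => DX; apply: nmax.
exists (vh T w); first by split; [exact: vh_U|rewrite /= (le_trans (KM _ Kw))].
split; first by rewrite subrr normr0 ltW.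
move=> u [Uu un].
have q_max : qcrit (D T w) (Gamma w) u <= qcrit (D T w) (Gamma w) (vh T w).
  rewrite -ler_expR -[_ <= _]/(ZZ (D T w) (Gamma w) u <= ZZ (D T w) (Gamma w) (vh T w)).
  by rewrite -lee_fin maxw; apply: ereal_sup_ubound; exists u.
have par x : `|x| <= n%:R -> `|qcrit (D T w) (Gamma w) x - qcrit (X T w) (Gamma w) x| <= eta / 2.
  move=> xn; apply: le_trans (qcrit_lip_score _ _ _ xn) _.
  by apply: le_trans eps_eta; rewrite ler_wpM2r// ler_wpM2l.
have vn : `|vh T w| <= n%:R by apply: le_trans (KM _ Kw) Mn.
exact: near_compare (par _ un) (par _ vn) q_max.
Qed.

End estimators.

Theorem theorem3p1 (R : realType) (d : measure_display) (Om : measurableType d)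
  (P : probability Om R)
  (G : set (set Om)) (G_sigma : sigma_algebra [set: Om] G)
  (G_sub : G `<=` @measurable d Om)
  (p q : nat) (p_gt0 : (0 < p)%N)
  (Theta : set 'cV[R]_p) (Tau : set 'cV[R]_q)
  (Theta_compact : compact Theta) (Tau_compact : compact Tau)
  (TT : set R) (TT_sup : ereal_sup [set T%:E | T in TT] = +oo%E)
  (ths : 'cV[R]_p) (ths_Theta : Theta ths)
  (* H T is defined on the union of Theta and the closure of N, times Tau *)
  (N : set 'cV[R]_p)
  (H : R -> Om -> 'cV[R]_p -> 'cV[R]_q -> R)
  (H_field : forall T, TT T -> continuous_random_field (Theta `*` Tau)
     (fun w (x : 'cV[R]_p * 'cV[R]_q) => H T w x.1 x.2))
  (N_bounded : bounded_set N) (N_open : open N)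
  (N_nbhs : exists2 delta : R, 0 < delta &
     Theta `&` [set th | fnorm (th - ths) < delta] `<=` closure N)
  (N_star : forall th (t : R), N th -> 0 < t -> t <= 1 ->
     N (t *: th + (1 - t) *: ths))
  (H_ext_field : forall T, TT T -> continuous_random_field (closure N `*` Tau)
     (fun w (x : 'cV[R]_p * 'cV[R]_q) => H T w x.1 x.2))
  (H_C2 : forall T w tau, TT T -> Tau tau ->
     C2_closure N (fun th => H T w th tau))
  (tauh : R -> Om -> 'cV[R]_q)
  (tauh_rv : forall T, TT T -> borel_rv (tauh T))
  (tauh_Tau : forall T w, TT T -> Tau (tauh T w))
  (thh : R -> Om -> 'cV[R]_p)
  (thh_rv : forall T, TT T -> borel_rv (thh T))
  (thh_Theta : forall T w, TT T -> Theta (thh T w))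
  (thh_max : P [set w | (H T w (thh T w) (tauh T w))%:E =
       ereal_sup [set (H T w th (tauh T w))%:E | th in Theta]]
     @[T --> to_infty TT] --> 1%E)
  (a : R -> 'M[R]_p)
  (a_unit : forall T, TT T -> a T \in unitmx)
  (a_cvg0 : fnorm (a T) @[T --> to_infty TT] --> (0 : R))
  (Delta : Om -> 'cV[R]_p) (Delta_rv : borel_rv Delta)
  (Gamma : Om -> 'M[R]_p) (Gamma_G : measurable_wrt G Gamma)
  (Y : Om -> 'cV[R]_p -> R) (Y_field : continuous_random_field Theta Y)
  (B1_cvg : cvg_proba0 P TT (fun T w => ereal_sup
     [set `|YY a ths H T w x.1 x.2 - Y w x.1|%:E | x in Theta `*` Tau]))
  (B1_neg : {ae P, forall w, forall th, Theta th -> th != ths -> Y w th < 0})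
  (B2_grad : exists2 tau0, Tau tau0 &
     cvg_proba0 P TT (fun T w => ereal_sup
       [set (fnorm (score a N ths H T w tau - score a N ths H T w tau0))%:E
         | tau in Tau]) /\
     cvg_stable P TT G (fun T w => score a N ths H T w tau0) Delta)
  (B2_hess : forall delta : R -> R, (forall T, TT T -> 0 < delta T) ->
     delta T @[T --> to_infty TT] --> (0 : R) ->
     cvg_proba0 P TT (fun T w => ereal_sup
       [set (fnorm (scaled_hess a N H T w x.1 x.2 + Gamma w))%:E
         | x in [set x : 'cV[R]_p * 'cV[R]_q |
             [/\ closure N x.1, Tau x.2 & fnorm (x.1 - ths) < delta T]]]))
  (B3 : {ae P, forall w, posdef (Gamma w)})
  (A3 : \bigcap_(M in [set M : nat | (1 <= M)%N])
          closure (\bigcup_(T in TT `&` [set T | M%:R <= T])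
                     local_set a Theta ths T)
        `<=` limit_set a Theta ths TT)
  (uh : Om -> 'cV[R]_p) (uh_rv : borel_rv uh)
  (uh_U : forall w, limit_set a Theta ths TT (uh w))
  (A4_max : {ae P, forall w, (ZZ (Delta w) (Gamma w) (uh w))%:E =
     ereal_sup [set (ZZ (Delta w) (Gamma w) u)%:E
       | u in limit_set a Theta ths TT]})
  (A4_unique : {ae P, forall w, forall u, limit_set a Theta ths TT u ->
     u != uh w -> ZZ (Delta w) (Gamma w) u < ZZ (Delta w) (Gamma w) (uh w)}) :
  cvg_stable P TT G (fun T w => invmx (a T) *m (thh T w - ths)) uh /\
  (forall (T0 : R) (vh : R -> Om -> 'cV[R]_p),
     TT T0 ->
     (forall T, TT T -> T0 <= T -> borel_rv (vh T)) ->
     (forall T w, TT T -> T0 <= T -> limit_set a Theta ths TT (vh T w)) ->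
     (forall T, TT T -> T0 <= T ->
        {ae P, forall w,
          (ZZ (score a N ths H T w (tauh T w)) (Gamma w) (vh T w))%:E =
          ereal_sup
            [set (ZZ (score a N ths H T w (tauh T w)) (Gamma w) u)%:E
              | u in limit_set a Theta ths TT]}) ->
     tight P (TT `&` [set T | T0 <= T]) vh ->
     cvg_proba0 P TT (fun T w =>
       (fnorm (invmx (a T) *m (thh T w - ths) - vh T w))%:E)).
Proof.
case: B2_grad => tau0 tau0_Tau [score_diff score_stable].
have thh_cons : forall r k : R, 0 < r -> 0 < k ->
    ultimately_le P TT k (fun T => [set w | r <= `|thh T w - ths|]).
  exact: (consistency Theta_compact Tau_compact ths_Theta H_field tauh_rv tauh_Tau thh_rv
    thh_Theta thh_max a_unit Y_field B1_cvg B1_neg).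
have uhat_max := estimator_asymptotic_maximiser G_sigma G_sub Theta_compact Tau_compact
  ths_Theta H_field N_open N_nbhs N_star H_ext_field H_C2 tauh_rv tauh_Tau thh_rv
  thh_Theta thh_max a_unit a_cvg0 Delta_rv Gamma_G tau0_Tau score_diff score_stable
  B2_hess B3 A3 thh_cons.
have X_meas := score_meas ths_Theta N_open N_nbhs H_ext_field H_C2 a tau0_Tau.
have U0 := @limit_set0 R p a Theta ths TT ths_Theta.
have Ucl := @limit_set_closed R p a Theta ths TT.
have uh_unique : {ae P, forall w, forall u, limit_set a Theta ths TT u -> u != uh w ->
    qcrit (Delta w) (Gamma w) u < qcrit (Delta w) (Gamma w) (uh w)}.
  apply: filterS A4_unique => w uw u Uu uuh; rewrite -ltr_expR; exact: uw.
have net n : exists s : seq 'M[R]_p, forall M : 'M[R]_p, `|M| <= n%:R ->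
    exists2 c, c \in s & ball c (n.+1%:R ^+ 4)^-1 M.
  have [||s _ sP] := @finite_net R _ [set M : 'M[R]_p | `|M| <= n%:R] (n.+1%:R ^+ 4)^-1.
  - exact: closed_ball_mx_compact.
  - by rewrite invr_gt0 exprn_gt0.
  - by exists s.
have [s sP] := choice net.
split.
  apply: (maximiser_stable G_sigma G_sub X_meas Delta_rv Gamma_G score_stable U0 B3 uh_rv
    uh_U uh_unique Ucl sP uhat_max) => T TTT.
  exact: (measurable_wrt_comp (thh_rv T TTT) (@affine_continuous _ _ _ (invmx (a T)) ths)).
move=> T0 vh _ vh_rv vh_U vh_max vh_tight.
apply: (maximisers_merge G_sigma G_sub X_meas Delta_rv Gamma_G score_stable U0 B3
    uh_U uh_unique Ucl sP uhat_max).
exact: (limit_maximiser_asymptotic_maximiser tauh_Tau score_diff vh_rv vh_U vh_max vh_tight).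
Qed.
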